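(* Let $G$ be a (discrete) group, $S\subset G$ a submonoid and $(X;\varphi)$ a measure-preserving $G$-dynamical system with $X$ separable. Then the assignments $$(E;\Phi)\mapsto(\Gamma^1(E);\mathcal{T}_\Phi),\qquad\Theta\mapsto V_\Theta$$ define an essentially surjective, fully faithful functor from the category of $S$-dynamical separable measurable Banach bundles over $(X;\varphi)$ to the category of $S$-dynamical separable $\mathrm{L}^1(X)$-normed modules over $(\mathrm{L}^\infty(X);T_\varphi)$.
   Context: Conventions. All vector spaces are over a fixed field $\mathbb{K}\in\{\mathbb{R},\mathbb{C}\}$; $\mathscr{L}(Y,Z)$ denotes bounded linear maps. A measure space $X=(\Omega_X,\Sigma_X,\mu_X)$ is always $\sigma$-finite and complete. $X$ is separable if there is a sequence $(A_n)_{n\in\mathbb{N}}$ in $\Sigma_X$ such that for every $B\in\Sigma_X$ and $\varepsilon>0$ there is $n$ with $\mu_X(A_n\Delta B)<\varepsilon$. Measurable Banach bundle over $X$: a triple $(E,p_E,\mathcal{M}_E)$ with $E$ a set, $p_E\colon E\to\Omega_X$ surjective, each fiber $E_x=p_E^{-1}(x)$ a Banach space, and $\mathcal{M}_E$ a linear subspace of the space $\mathcal{S}_E$ of all sections ($s\colon\Omega_X\to E$ with $p_E\circ s=\mathrm{id}$) such that (i) $fs\in\mathcal{M}_E$ for measurable $f\colon\Omega_X\to\mathbb{K}$ and $s\in\mathcal{M}_E$; (ii) $|s|\colon x\mapsto\|s(x)\|_{E_x}$ is measurable for $s\in\mathcal{M}_E$; (iii) if $(s_n)$ in $\mathcal{M}_E$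 converges almost everywhere to $s\in\mathcal{S}_E$, then $s\in\mathcal{M}_E$. It is separable if there is a sequence $(s_n)$ in $\mathcal{M}_E$ with $\mathrm{lin}\{s_n(x):n\in\mathbb{N}\}$ dense in $E_x$ for almost every $x$. Morphisms of measure spaces are measurable measure-preserving maps modulo equality almost everywhere; $\mathrm{Aut}(X)$ is the group of automorphisms (invertible morphisms) of $X$. A measure-preserving $G$-dynamical system $(X;\varphi)$ is a measure space $X$ with a group homomorphism $\varphi\colon G\to\mathrm{Aut}(X)$, $g\mapsto\varphi_g$. A submonoid is a subsemigroup containing the neutral element. Representatives of equivalence classes are chosen whenever necessary. Let $\psi\colon X\to X$ be a morphism and $E,F$ measurable Banach bundles over $X$. A premorphism from $E$ to $F$ over $\psi$ is a map $\Phi\colon E\to F$ such that (i) for every $s\in\mathcal{M}_E$ there is $t\in\mathcal{M}_F$ with $\Phi\circ s=t\circ\psi$ almost everywhere; (ii) $p_F\circ\Phi=\psi\circ p_E$ almost everywhere (i.e. on $E_x$ for almost every $x$); (iii) $\Phi|_{E_x}\in\mathscr{L}(E_x,F_{\psi(x)})$ for almost every $x$; (iv) $\|\Phi\|:=\mathrm{ess\,sup}_{x}\|\Phi|_{E_x}\|<\infty$. A morphism over $\psi$ is an equivalence class of premorphisms over $\psi$, two being identified if they agree on $E_x$ for almost every $x$. For $\psi=\mathrm{id}_X$ one speaks of a morphism of measurable Banach bundles. $S$-dynamical Banach bundle over $(X;\varphi)$: a pair $(E;\Phi)$ of a measurable Banach bundle $E$ over $X$ and morphisms $\Phi_g\colon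 E\to E$ over $\varphi_g$ ($g\in S$) with $\Phi_g\circ\Phi_h=\Phi_{gh}$ for $g,h\in S$ and $\Phi_e=\mathrm{Id}_E$ for the neutral element $e$; it is separable if $E$ is. A morphism $(E;\Phi)\to(F;\Psi)$ is a morphism $\Theta\colon E\to F$ of measurable Banach bundles with $\Theta\circ\Phi_g=\Psi_g\circ\Theta$ for all $g\in S$. $\Gamma^1(E)$ is the space of $s\in\mathcal{M}_E$ with $|s|$ integrable, modulo sections vanishing almost everywhere, with norm $\int|s|\,d\mu_X$ and pointwise multiplication by $\mathrm{L}^\infty(X)$. Banach module over a commutative Banach algebra $A$: a Banach space $\Gamma$ that is an $A$-module with $\|fs\|\le\|f\|\|s\|$, always assumed non-degenerate, i.e. $\Gamma=\overline{\mathrm{lin}}\{fs:f\in A,s\in\Gamma\}$. An $\mathrm{L}^1(X)$-normed module is a Banach module $\Gamma$ over $\mathrm{L}^\infty(X)$ together with a map $|\cdot|\colon\Gamma\to\mathrm{L}^\infty(X)'_+$ such that $\||s|\|=\|s\|$, $|fs|=|f|\cdot|s|$ and $|s_1+s_2|\le|s_1|+|s_2|$ for all $s,s_1,s_2\in\Gamma$, $f\in\mathrm{L}^\infty(X)$, and such that $|s|$ lies in the canonical image of $\mathrm{L}^1(X)$ in $\mathrm{L}^\infty(X)'$ for every $s\in\Gamma$ (so $|\cdot|$ is regarded as a map $\Gamma\to\mathrm{L}^1(X)_+$); such a map is automatically unique. It is separable if $\Gamma$ is a separable Banach space. $S$-dynamical Banach module over $(\mathrm{L}^\infty(X);T_\varphi)$,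 where $T_\varphi(g)f=f\circ\varphi_g^{-1}$ for $g\in G$: a pair $(\Gamma;\mathcal{T})$ of a Banach module $\Gamma$ over $\mathrm{L}^\infty(X)$ and a monoid homomorphism $\mathcal{T}\colon S\to\mathscr{L}(\Gamma)$ with $\mathcal{T}(g)(fs)=T_\varphi(g)f\cdot\mathcal{T}(g)s$ for $f\in\mathrm{L}^\infty(X)$, $s\in\Gamma$, $g\in S$ ($G$ is discrete, so continuity is no condition). A homomorphism $(\Gamma;\mathcal{T})\to(\Lambda;\mathcal{S})$ is a bounded $\mathrm{L}^\infty(X)$-linear operator $V$ with $V\mathcal{T}(g)=\mathcal{S}(g)V$ for $g\in S$. $S$-dynamical separable $\mathrm{L}^1(X)$-normed modules are those with $\Gamma$ a separable $\mathrm{L}^1(X)$-normed module, with these homomorphisms as morphisms. Weighted Koopman representation: $\mathcal{T}_\Phi(g)s=\Phi_g\circ s\circ\varphi_g^{-1}$ for $s\in\Gamma^1(E)$, $g\in S$; $V_\Theta s=\Theta\circ s$. *)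

(* Defs.v *)
From HB Require Import structures.
From mathcomp Require Import all_boot all_order all_algebra.
From mathcomp Require Import generic_quotient ring_quotient complex.
From mathcomp Require Import all_classical all_reals all_analysis.
From mathcomp Require Import measurable_realfun ess_sup_inf.

Set Implicit Arguments.
Unset Strict Implicit.
Unset Printing Implicit Defensive.

Import Order.TTheory GRing.Theory Num.Theory.
Import numFieldNormedType.Exports.

Local Open Scope classical_set_scope.
Local Open Scope ring_scope.
Local Open Scope quotient_scope.

Inductive scalar_kind := RealScalars | ComplexScalars.

Definition scalar_field (R : realType) (k : scalar_kind) : numFieldType :=
  match k with RealScalars => R | ComplexScalars => R[i] end.

Section scalars.
Context {R : realType} {k : scalar_kind}.
Local Notation K := (scalar_field R k).

Definition re : K -> R :=
  match k return scalar_field R k -> R with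
  | RealScalars => fun z => z
  | ComplexScalars => fun z : R[i] => complex.Re z
  end.

Definition im : K -> R :=
  match k return scalar_field R k -> R with
  | RealScalars => fun=> 0
  | ComplexScalars => fun z : R[i] => complex.Im z
  end.

Definition emb : R -> K :=
  match k return R -> scalar_field R k with
  | RealScalars => fun a => a
  | ComplexScalars => fun a => (a%:C)%C
  end.

(* The norm of a normed module over K takes values in K; [rnorm] is the same
   norm as a real number. *)
Definition rnorm {V : normedZmodType K} (v : V) : R := re `|v|.

Lemma emb_re (z : K) : 0 <= z -> emb (re z) = z.
Proof.
move: z; rewrite /emb /re; case: k => //= z z0.
by rewrite [RHS]complexE; move: z0; rewrite lecE /= => /andP[/eqP -> _];
   rewrite mulr0 addr0.
Qed.

Lemma re_emb (a : R) : re (emb a) = a.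
Proof. by rewrite /emb /re; case: k. Qed.

Lemma ler_emb (a b : R) : (emb a <= emb b) = (a <= b).
Proof. by rewrite /emb; case: k => //; exact: lecR. Qed.

Lemma emb0 : emb 0 = 0.
Proof. by rewrite /emb; case: k. Qed.

Lemma embD (a b : R) : emb (a + b) = emb a + emb b.
Proof. by rewrite /emb; case: k => //=; exact: rmorphD. Qed.

Lemma embM (a b : R) : emb (a * b) = emb a * emb b.
Proof. by rewrite /emb; case: k => //=; exact: rmorphM. Qed.

Lemma rnormE (V : normedZmodType K) (v : V) : emb (rnorm v) = `|v|.
Proof. exact: emb_re. Qed.

Lemma rnorm_ge0 (V : normedZmodType K) (v : V) : 0 <= rnorm v.
Proof. by rewrite -ler_emb rnormE emb0. Qed.

Lemma emb_inj : injective emb.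
Proof. by move=> a b /(congr1 re); rewrite !re_emb. Qed.

Lemma rnormD (V : normedZmodType K) (v w : V) :
  rnorm (v + w) <= rnorm v + rnorm w.
Proof. by rewrite -ler_emb embD !rnormE ler_normD. Qed.

Lemma rnormZ (V : normedModType K) (a : K) (v : V) :
  rnorm (a *: v) = rnorm a * rnorm v.
Proof. by apply: emb_inj; rewrite embM !rnormE normrZ. Qed.

Lemma rnormN (V : normedZmodType K) (v : V) : rnorm (- v) = rnorm v.
Proof. by rewrite /rnorm normrN. Qed.

Lemma rnorm0 (V : normedZmodType K) : rnorm (0 : V) = 0.
Proof. by apply: emb_inj; rewrite rnormE normr0 emb0. Qed.

Lemma rnorm_eq0 (V : normedZmodType K) (v : V) : (rnorm v == 0) = (v == 0).
Proof. by rewrite -(inj_eq emb_inj) rnormE emb0 normr_eq0. Qed.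

Lemma rnorm_emb (a : R) : 0 <= a -> rnorm (emb a) = a.
Proof.
move=> a0; apply: emb_inj; rewrite rnormE ger0_norm //.
by rewrite -emb0 ler_emb.
Qed.

Definition lin {V : lmodType K} (A : set V) : set V :=
  [set v | exists n (c : 'I_n -> K) (a : 'I_n -> V),
     (forall i, A (a i)) /\ v = \sum_(i < n) c i *: a i].

Definition bounded_linear {V W : normedModType K} (L : V -> W) : Prop :=
  linear L /\ exists C : R, forall v, rnorm (L v) <= C * rnorm v.

Lemma bounded_linear_id (V : normedModType K) : bounded_linear (@id V).
Proof. by split=> //; exists 1 => v; rewrite mul1r. Qed.

Lemma bounded_linear_comp (U V W : normedModType K) (L : U -> V) (L' : V -> W) :
  bounded_linear L -> bounded_linear L' -> bounded_linear (L' \o L).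
Proof.
move=> [lL [C CL]] [lL' [C' CL']]; split=> [a u v|]; first by rewrite /= lL lL'.
exists (`|C'| * C) => v /=; rewrite -mulrA.
apply: (le_trans (CL' _)); apply: (@le_trans _ _ (`|C'| * rnorm (L v))).
  by rewrite ler_wpM2r ?rnorm_ge0 ?ler_norm.
by rewrite ler_wpM2l.
Qed.

End scalars.

Definition separable_measure d (Omega : measurableType d) (R : realType)
    (mu : {measure set Omega -> \bar R}) : Prop :=
  exists2 A : nat -> set Omega, (forall n, measurable (A n)) &
    forall (B : set Omega) (e : R), measurable B -> 0 < e ->
      exists n, (mu ((A n `\` B) `|` (B `\` A n)) < e%:E)%E.

(* A homomorphism from G to Aut(X): [mp_fun g] is a representative of the class
   of g, so the homomorphism laws hold almost everywhere, and the inverse of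
   the class of g is represented by [mp_fun g^-1]. *)
Record mp_system d (Omega : measurableType d) (R : realType)
    (mu : {measure set Omega -> \bar R}) (G : groupType) := MPSystem {
  mp_fun :> G -> Omega -> Omega;
  mp_measurable : forall g, measurable_fun setT (mp_fun g);
  mp_preserving : forall g A, measurable A -> mu (mp_fun g @^-1` A) = mu A;
  mp_one : \forall x \ae mu, mp_fun 1%g x = x;
  mp_mul : forall g h,
    \forall x \ae mu, mp_fun (g * h)%g x = mp_fun g (mp_fun h x) }.

Section bundles.
Context {R : realType} (k : scalar_kind).
Context {d : measure_display} {Omega : measurableType d}.
Variable mu : {measure set Omega -> \bar R}.
Local Notation K := (scalar_field R k).

Definition kmeasurable (f : Omega -> K) : Prop :=
  measurable_fun setT (re \o f) /\ measurable_fun setT (im \o f).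

(* The set E is the disjoint union [total_space E] of the fibers, with projection
   [projT1] (onto, since the fibers are inhabited), and a section of E is a
   dependent function. *)
Record mbundle := MBundle {
  fiber :> Omega -> completeNormedModType K;
  msec : set (forall x, fiber x);
  msec0 : msec (fun x => 0);
  msecD : forall s t, msec s -> msec t -> msec (fun x => s x + t x);
  msecZ : forall (a : K) s, msec s -> msec (fun x => a *: s x);
  msecM : forall (f : Omega -> K) s,
    kmeasurable f -> msec s -> msec (fun x => f x *: s x);
  msec_norm : forall s, msec s -> measurable_fun setT (fun x => rnorm (s x));
  msec_lim : forall (u : nat -> forall x, fiber x) s, (forall n, msec (u n)) ->
    (\forall x \ae mu, u n x @[n --> \oo] --> s x) -> msec s }.

Definition separable_bundle (E : mbundle) : Prop :=
  exists2 u : nat -> forall x, E x, (forall n, msec (u n)) &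
    \forall x \ae mu, dense (lin [set u n x | n in [set: nat]]).

Definition total_space (E : mbundle) : Type := {x : Omega & E x}.

Definition at_fiber {E : mbundle} (x : Omega) (v : E x) : total_space E :=
  existT (fun y => E y) x v.

Definition tnorm {E : mbundle} (p : total_space E) : R := rnorm (projT2 p).

Definition fiber_opnorm {E F : mbundle} (Phi : total_space E -> total_space F)
    (x : Omega) : \bar R :=
  ereal_sup [set (tnorm (Phi (at_fiber v)))%:E | v in [set v : E x | rnorm v <= 1]].

Record premorphism (psi : Omega -> Omega) (E F : mbundle) := Premorphism {
  pm_fun :> total_space E -> total_space F;
  pm_section : forall s : forall x, E x, msec s ->
    exists2 t : forall x, F x, msec t &
      \forall x \ae mu, pm_fun (at_fiber (s x)) = at_fiber (t (psi x));
  pm_proj : \forall x \ae mu,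
    forall v : E x, projT1 (pm_fun (at_fiber v)) = psi x;
  pm_linear : \forall x \ae mu, exists2 L : E x -> F (psi x),
    bounded_linear L & forall v, pm_fun (at_fiber v) = at_fiber (L v);
  pm_bounded : (ess_sup mu (fiber_opnorm pm_fun) < +oo)%E }.

(* Morphisms over psi are premorphisms up to this relation. *)
Definition pm_eq {E F : mbundle} (Phi Psi : total_space E -> total_space F) : Prop :=
  \forall x \ae mu, forall v : E x, Phi (at_fiber v) = Psi (at_fiber v).

Lemma pm_eq_refl E F (Phi : total_space E -> total_space F) : pm_eq Phi Phi.
Proof. by rewrite /pm_eq; apply: aeW => x v. Qed.

Lemma pm_eq_sym E F (Phi Psi : total_space E -> total_space F) :
  pm_eq Phi Psi -> pm_eq Psi Phi.
Proof. by apply: filterS => x e v; rewrite e. Qed.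

Lemma pm_eq_trans E F (Phi Psi Xi : total_space E -> total_space F) :
  pm_eq Phi Psi -> pm_eq Psi Xi -> pm_eq Phi Xi.
Proof. by apply: filterS2 => x e e' v; rewrite e e'. Qed.

Lemma fiber_opnorm_le E F (Phi : total_space E -> total_space F) (x : Omega) (C : R) :
  (forall v : E x, tnorm (Phi (at_fiber v)) <= C * rnorm v) -> 0 <= C ->
  (fiber_opnorm Phi x <= C%:E)%E.
Proof.
move=> h C0; apply: ge_ereal_sup => _ [v /= v1 <-]; rewrite lee_fin.
by apply: (le_trans (h v)); rewrite ler_piMr.
Qed.

Lemma opnorm_bound E F (Phi : total_space E -> total_space F) (x y : Omega) (C : R)
    (L : E x -> F y) : bounded_linear L ->
  (forall v, Phi (at_fiber v) = at_fiber (L v)) ->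
  (fiber_opnorm Phi x <= C%:E)%E -> forall v, rnorm (L v) <= C * rnorm v.
Proof.
move=> [linL _] PL hC v.
have L0 : L 0 = 0.
  by have := linL (-1) 0 0; rewrite scaler0 addr0 scaleN1r addNr.
have LZ a u : L (a *: u) = a *: L u.
  by have := linL a u 0; rewrite !addr0 L0 addr0.
have [v0|v0] := eqVneq v 0; first by rewrite v0 L0 !rnorm0 mulr0.
have nv0 : rnorm v != 0 by rewrite rnorm_eq0.
have nv : 0 < rnorm v by rewrite lt_neqAle eq_sym nv0 rnorm_ge0.
have iv0 : 0 <= (rnorm v)^-1 by rewrite invr_ge0 ltW.
pose w : E x := emb (rnorm v)^-1 *: v.
have w1 : rnorm w = 1 by rewrite rnormZ rnorm_emb // mulVf.
have : rnorm (L w) <= C.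
  rewrite -lee_fin; apply: le_trans hC; apply: ereal_sup_ubound.
  by exists w; rewrite /= ?w1 // PL.
by rewrite LZ rnormZ rnorm_emb // mulrC ler_pdivrMr.
Qed.

Lemma pm_bound psi E F (Phi : premorphism psi E F) : exists2 C : R, 0 <= C &
  \forall x \ae mu, forall v : E x, tnorm (Phi (at_fiber v)) <= C * rnorm v.
Proof.
have [y [hy1 hy2]] : exists y : \bar R,
    (\forall x \ae mu, fiber_opnorm Phi x <= y)%E /\ (y < +oo)%E.
  exists (ess_sup mu (fiber_opnorm Phi)); split; [exact: ess_sup_ge|].
  exact: pm_bounded.
have [C C0 yC] : exists2 C : R, 0 <= C & (y <= C%:E)%E.
  case: y {hy1} hy2 => [r _|//|_]; last by exists 0 => //; exact: leNye.
  by exists `|r|; rewrite // lee_fin ler_norm.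
exists C => //; apply: (filterS2 _ _ hy1 (pm_linear Phi)) => x h [L bL PL] v.
rewrite PL; apply: (opnorm_bound bL PL); exact: le_trans yC.
Qed.

Lemma pm_id_section (E : mbundle) (s : forall x, E x) : msec s ->
  exists2 t : forall x, E x, msec t &
    \forall x \ae mu, @id (total_space E) (at_fiber (s x)) = at_fiber (t (id x)).
Proof. by move=> ms; exists s => //; by apply: aeW => x. Qed.

Lemma pm_id_proj (E : mbundle) : \forall x \ae mu,
  forall v : E x, projT1 (@id (total_space E) (at_fiber v)) = id x.
Proof. by rewrite /pm_eq; apply: aeW => x v. Qed.

Lemma pm_id_linear (E : mbundle) : \forall x \ae mu, exists2 L : E x -> E (id x),
  bounded_linear L & forall v, @id (total_space E) (at_fiber v) = at_fiber (L v).
Proof. by apply: aeW => x; exists id => //; exact: bounded_linear_id. Qed.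

Lemma pm_id_bounded (E : mbundle) : (ess_sup mu (fiber_opnorm (@id (total_space E))) < +oo)%E.
Proof.
apply: (@le_lt_trans _ _ 1%:E); last exact: ltry.
apply/ess_supP; apply: aeW => x; apply: fiber_opnorm_le => // v.
by rewrite mul1r.
Qed.

Definition pm_id (E : mbundle) : premorphism id E E :=
  Premorphism (@pm_id_section E) (pm_id_proj E) (pm_id_linear E)
    (pm_id_bounded E).

Section composition.
Variables (E F H : mbundle).
Variables (Psi : premorphism id F H) (Phi : premorphism id E F).

Lemma pm_comp_section (s : forall x, E x) : msec s ->
  exists2 t : forall x, H x, msec t &
    \forall x \ae mu, (Psi \o Phi) (at_fiber (s x)) = at_fiber (t (id x)).
Proof.
move=> /(pm_section Phi)[t /(pm_section Psi)[u mu' htu] hst]; exists u => //.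
by apply: (filterS2 _ _ hst htu) => x /= -> ->.
Qed.

Lemma pm_comp_linear : \forall x \ae mu, exists2 L : E x -> H (id x),
  bounded_linear L & forall v, (Psi \o Phi) (at_fiber v) = at_fiber (L v).
Proof.
apply: (filterS2 _ _ (pm_linear Phi) (pm_linear Psi)).
move=> x [L bL PL] [L' bL' PL']; exists (L' \o L).
  exact: bounded_linear_comp.
by move=> v /=; rewrite PL PL'.
Qed.

Lemma pm_comp_proj : \forall x \ae mu,
  forall v : E x, projT1 ((Psi \o Phi) (at_fiber v)) = id x.
Proof. by apply: (filterS _ pm_comp_linear) => x [L _ PL] v; rewrite PL. Qed.

Lemma pm_comp_bounded : (ess_sup mu (fiber_opnorm (Psi \o Phi)) < +oo)%E.
Proof.
have [C C0 hC] := pm_bound Phi; have [C' C'0 hC'] := pm_bound Psi.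
apply: (@le_lt_trans _ _ (C' * C)%:E); last exact: ltry.
apply/ess_supP; apply: (filterS3 _ _ hC hC' (pm_linear Phi)).
move=> x h h' [L _ PL]; apply: fiber_opnorm_le; last exact: mulr_ge0.
move=> v /=; rewrite PL -mulrA; apply: (le_trans (h' _)).
by rewrite ler_wpM2l //; have := h v; rewrite PL.
Qed.

Definition pm_comp : premorphism id E H :=
  Premorphism pm_comp_section pm_comp_proj pm_comp_linear pm_comp_bounded.

End composition.

Lemma pm_comp_eq E F H (Psi Psi' : total_space F -> total_space H)
    (Phi : total_space E -> total_space F) (Phi' : premorphism id E F) :
  pm_eq Psi Psi' -> pm_eq Phi Phi' -> pm_eq (Psi \o Phi) (Psi' \o Phi').
Proof.
move=> h1 h2; apply: (filterS3 _ _ h1 h2 (pm_linear Phi')).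
by move=> x e1 e2 [L _ PL] v; rewrite /= e2 PL e1.
Qed.

End bundles.

Section Gamma1.
Context {R : realType} {k : scalar_kind}.
Context {d : measure_display} {Omega : measurableType d}.
Context {mu : {measure set Omega -> \bar R}}.
Local Notation K := (scalar_field R k).
Implicit Types E F : mbundle k mu.

Definition section E : Type := forall x, E x.

HB.instance Definition _ E := Choice.on (section E).

Section section_lmodule.
Variable E : mbundle k mu.
Implicit Types s t u : section E.

Let sadd s t : section E := fun x => s x + t x.
Let sopp s : section E := fun x => - s x.
Let szero : section E := fun x => 0.
Let sscale (a : K) s : section E := fun x => a *: s x.

Let saddA : associative sadd.
Proof. by move=> s t u; apply: functional_extensionality_dep => x; exact: addrA. Qed.
Let saddC : commutative sadd.
Proof. by move=> s t; apply: functional_extensionality_dep => x; exact: addrC. Qed.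
Let sadd0 : left_id szero sadd.
Proof. by move=> s; apply: functional_extensionality_dep => x; exact: add0r. Qed.
Let saddN : left_inverse szero sopp sadd.
Proof. by move=> s; apply: functional_extensionality_dep => x; exact: addNr. Qed.

HB.instance Definition _ :=
  GRing.isZmodule.Build (section E) saddA saddC sadd0 saddN.

Let sscaleA a b s : sscale a (sscale b s) = sscale (a * b) s.
Proof. by apply: functional_extensionality_dep => x; exact: scalerA. Qed.
Let sscale1 : left_id 1 sscale.
Proof. by move=> s; apply: functional_extensionality_dep => x; exact: scale1r. Qed.
Let sscaleDr : right_distributive sscale +%R.
Proof. by move=> a s t; apply: functional_extensionality_dep => x; exact: scalerDr. Qed.
Let sscaleDl s : {morph sscale^~ s : a b / a + b}.
Proof. by move=> a b; apply: functional_extensionality_dep => x; exact: scalerDl. Qed.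

HB.instance Definition _ := GRing.Zmodule_isLmodule.Build K (section E)
  sscaleA sscale1 sscaleDr sscaleDl.

End section_lmodule.

Definition integrable_section E : {pred section E} := [pred s : section E |
  `[< msec s /\ mu.-integrable setT (fun x => (rnorm (s x))%:E) >]].

Arguments integrable_section : clear implicits.

Lemma integrable_sectionP (E : mbundle k mu) (s : section E) :
  reflect (msec s /\ mu.-integrable setT (fun x => (rnorm (s x))%:E))
          (s \in integrable_section E).
Proof. exact: asboolP. Qed.

Lemma measurable_rnorm E (s : section E) : msec s ->
  measurable_fun setT (fun x => (rnorm (s x))%:E).
Proof. by move=> /msec_norm ms; apply/measurable_EFinP. Qed.

Lemma integrable_section_submod E : submod_closed (integrable_section E).
Proof.
split=> [|a s t /integrable_sectionP[ms js] /integrable_sectionP[mt jt]].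
  apply/integrable_sectionP; split; first exact: msec0.
  rewrite (_ : (fun=> _) = cst 0%E); first exact: integrable0.
  by apply/funext => x; rewrite rnorm0.
have mst : msec (a *: s + t : section E) by apply: msecD => //; exact: msecZ.
apply/integrable_sectionP; split=> //.
apply: (@le_integrable _ _ _ mu _ measurableT _
  (fun x => ((rnorm a)%:E * (rnorm (s x))%:E + (rnorm (t x))%:E)%E)).
- exact: measurable_rnorm.
- move=> x _; rewrite -EFinM -EFinD !abse_EFin lee_fin.
  rewrite !ger0_norm ?addr_ge0 ?mulr_ge0 ?rnorm_ge0 //.
  by rewrite (le_trans (rnormD _ _)) // rnormZ.
- by apply: integrableD => //; exact: integrableZl.
Qed.

HB.instance Definition _ E := GRing.isSubmodClosed.Build K (section E)
  (integrable_section E) (integrable_section_submod E).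

Record L1section E := L1Section {
  L1val : section E; L1valP : L1val \in integrable_section E }.

HB.instance Definition _ E := [isSub for @L1val E].
HB.instance Definition _ E := [Choice of L1section E by <:].
HB.instance Definition _ E := [SubChoice_isSubLmodule of L1section E by <:].

Definition null_section E : {pred L1section E} :=
  [pred s : L1section E | `[< \forall x \ae mu, L1val s x = 0 >]].

Arguments null_section : clear implicits.

Lemma null_sectionP E (s : L1section E) :
  reflect (\forall x \ae mu, L1val s x = 0) (s \in null_section E).
Proof. exact: asboolP. Qed.

Lemma null_section_submod E : submod_closed (null_section E).
Proof.
split=> [|a s t /null_sectionP s0 /null_sectionP t0].
  by apply/null_sectionP; apply: aeW.
apply/null_sectionP; apply: (filterS2 _ _ s0 t0) => x sx tx.
by rewrite -[LHS]/(a *: L1val s x + L1val t x) sx tx scaler0 addr0.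
Qed.

HB.instance Definition _ E := GRing.isSubmodClosed.Build K (L1section E)
  (null_section E) (null_section_submod E).

Definition Gamma1 E : Type := Quotient.quot (null_section E).

HB.instance Definition _ E := GRing.Zmodule.on (Gamma1 E).
HB.instance Definition _ E := EqQuotient.on (Gamma1 E).

Lemma Gamma1P E (s t : L1section E) :
  \pi_(Gamma1 E) s = \pi_(Gamma1 E) t <-> \forall x \ae mu, L1val s x = L1val t x.
Proof.
have -> : (\forall x \ae mu, L1val s x = L1val t x) <-> (s - t \in null_section E).
  split=> [h|/null_sectionP h].
    apply/null_sectionP; apply: filterS h => x e.
    by rewrite -[LHS]/(L1val s x - L1val t x) e subrr.
  by apply: filterS h => x /eqP; rewrite -[X in X == 0]/(L1val s x - L1val t x) subr_eq0 => /eqP.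
rewrite Quotient.idealrBE; split=> [->|/eqP] //.
Qed.

End Gamma1.

Arguments integrable_section {R k d Omega mu} E.
Arguments null_section {R k d Omega mu} E.

Section Gamma1_norm.
Context {R : realType} {k : scalar_kind}.
Context {d : measure_display} {Omega : measurableType d}.
Context {mu : {measure set Omega -> \bar R}}.
Local Notation K := (scalar_field R k).
Variable E : mbundle k mu.
Implicit Types s t : Gamma1 E.

Definition Gamma1_repr s : section E := L1val (repr s).

Lemma Gamma1_reprP s : msec (Gamma1_repr s) /\
  mu.-integrable setT (fun x => (rnorm (Gamma1_repr s x))%:E).
Proof. exact/integrable_sectionP/L1valP. Qed.

Lemma Gamma1_repr_pi (u : L1section E) :
  \forall x \ae mu, Gamma1_repr (\pi_(Gamma1 E) u) x = L1val u x.
Proof. by apply/Gamma1P; rewrite reprK. Qed.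

Lemma Gamma1_eq s t :
  (\forall x \ae mu, Gamma1_repr s x = Gamma1_repr t x) -> s = t.
Proof. by move=> /Gamma1P; rewrite !reprK. Qed.

Definition Gamma1_scale (a : K) s : Gamma1 E :=
  \pi_(Gamma1 E) (a *: repr s).

Lemma Gamma1_repr_scale a s : \forall x \ae mu,
  Gamma1_repr (Gamma1_scale a s) x = a *: Gamma1_repr s x.
Proof. exact: (Gamma1_repr_pi (a *: repr s)). Qed.

Lemma Gamma1_repr_add s t : \forall x \ae mu,
  Gamma1_repr (s + t) x = Gamma1_repr s x + Gamma1_repr t x.
Proof.
have -> : s + t = \pi_(Gamma1 E) (repr s + repr t) by rewrite raddfD /= !reprK.
exact: (Gamma1_repr_pi (repr s + repr t)).
Qed.

Let scaleA a b s : Gamma1_scale a (Gamma1_scale b s) = Gamma1_scale (a * b) s.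
Proof.
apply: Gamma1_eq; apply: (filterS3 _ _ (Gamma1_repr_scale a (Gamma1_scale b s))
  (Gamma1_repr_scale b s) (Gamma1_repr_scale (a * b) s)).
by move=> x -> -> ->; rewrite scalerA.
Qed.

Let scale1 : left_id 1 Gamma1_scale.
Proof.
move=> s; apply: Gamma1_eq; apply: (filterS _ (Gamma1_repr_scale 1 s)).
by move=> x ->; rewrite scale1r.
Qed.

Let scaleDr : right_distributive Gamma1_scale +%R.
Proof.
move=> a s t; apply: Gamma1_eq.
near=> x; rewrite (near (Gamma1_repr_scale a (s + t)) x) //.
rewrite (near (Gamma1_repr_add s t) x) //.
rewrite (near (Gamma1_repr_add (Gamma1_scale a s) (Gamma1_scale a t)) x) //.
rewrite (near (Gamma1_repr_scale a s) x) // (near (Gamma1_repr_scale a t) x) //.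
by rewrite scalerDr.
Unshelve. all: by end_near. Qed.

Let scaleDl s : {morph Gamma1_scale^~ s : a b / a + b}.
Proof.
move=> a b; apply: Gamma1_eq.
near=> x; rewrite (near (Gamma1_repr_scale (a + b) s) x) //.
rewrite (near (Gamma1_repr_add (Gamma1_scale a s) (Gamma1_scale b s)) x) //.
rewrite (near (Gamma1_repr_scale a s) x) // (near (Gamma1_repr_scale b s) x) //.
by rewrite scalerDl.
Unshelve. all: by end_near. Qed.

HB.instance Definition _ := GRing.Zmodule_isLmodule.Build K (Gamma1 E)
  scaleA scale1 scaleDr scaleDl.

Definition Gamma1_norm s : R := \int[mu]_x rnorm (Gamma1_repr s x).

Lemma Gamma1_norm_ge0 s : 0 <= Gamma1_norm s.
Proof. by apply: Rintegral_ge0 => x _; exact: rnorm_ge0. Qed.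

Lemma EFin_Gamma1_norm s :
  (Gamma1_norm s)%:E = (\int[mu]_x (rnorm (Gamma1_repr s x))%:E)%E.
Proof.
by rewrite /Gamma1_norm /Rintegral fineK //; apply: integrable_fin_num => //;
  exact: (Gamma1_reprP s).2.
Qed.

Lemma Gamma1_ler_normD s t :
  emb (Gamma1_norm (s + t)) <= emb (Gamma1_norm s) + emb (Gamma1_norm t) :> K.
Proof.
rewrite -embD ler_emb -lee_fin EFinD !EFin_Gamma1_norm -ge0_integralD //=; first last.
- exact: measurable_rnorm (Gamma1_reprP t).1.
- by move=> x _; rewrite lee_fin rnorm_ge0.
- exact: measurable_rnorm (Gamma1_reprP s).1.
- by move=> x _; rewrite lee_fin rnorm_ge0.
apply: ae_ge0_le_integral => //=.
- by move=> x _; rewrite lee_fin rnorm_ge0.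
- exact: measurable_rnorm (Gamma1_reprP (s + t)).1.
- by move=> x _; rewrite -EFinD lee_fin addr_ge0 ?rnorm_ge0.
- by apply: emeasurable_funD; apply: measurable_rnorm;
    exact: (Gamma1_reprP _).1.
apply: filterS (Gamma1_repr_add s t) => x -> _.
by rewrite -EFinD lee_fin rnormD.
Qed.

Lemma Gamma1_normZ (a : K) s :
  emb (Gamma1_norm (a *: s)) = `|a| * emb (Gamma1_norm s) :> K.
Proof.
rewrite -(rnormE a) -embM; congr emb; apply: EFin_inj.
rewrite EFinM !EFin_Gamma1_norm -ge0_integralZl_EFin ?rnorm_ge0 //; first last.
- exact: measurable_rnorm (Gamma1_reprP s).1.
- by move=> x _; rewrite lee_fin rnorm_ge0.
apply: ae_eq_integral => //=.
- exact: measurable_rnorm (Gamma1_reprP (a *: s)).1.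
- by apply: measurable_funeM; exact: measurable_rnorm (Gamma1_reprP s).1.
apply: filterS (Gamma1_repr_scale a s) => x e _.
by rewrite -[Gamma1_repr (a *: s) x]/(Gamma1_repr (Gamma1_scale a s) x) e rnormZ.
Qed.

Lemma Gamma1_norm0_eq0 s : emb (Gamma1_norm s) = 0 :> K -> s = 0.
Proof.
rewrite -(@emb0 R k) => /emb_inj n0.
have : (\int[mu]_x `|(rnorm (Gamma1_repr s x))%:E| = 0)%E.
  rewrite -[RHS]/((0:R)%:E) -n0 EFin_Gamma1_norm; apply: eq_integral => x _.
  by rewrite abse_EFin ger0_norm // rnorm_ge0.
move/(ae_eq_integral_abs mu measurableT (measurable_rnorm (Gamma1_reprP s).1)).
move=> h; rewrite -[s]reprK; have -> : 0 = \pi_(Gamma1 E) 0 by rewrite raddf0.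
apply/Gamma1P; apply: filterS h => x /(_ I) [/eqP].
by rewrite rnorm_eq0 => /eqP.
Qed.

HB.instance Definition _ := @Lmodule_isNormed.Build K (Gamma1 E)
  (fun s => emb (Gamma1_norm s)) Gamma1_ler_normD Gamma1_normZ Gamma1_norm0_eq0.

End Gamma1_norm.

Section Linfty.
Context {R : realType} {k : scalar_kind}.
Context {d : measure_display} {Omega : measurableType d}.
Variable mu : {measure set Omega -> \bar R}.
Local Notation K := (scalar_field R k).

Definition Linf_norm (f : Omega -> K) : \bar R :=
  Lnorm mu +oo%E (fun x => (rnorm (f x))%:E).

Definition Linf (f : Omega -> K) : Prop :=
  kmeasurable f /\ (Linf_norm f < +oo)%E.

Lemma Linf_bound (f : Omega -> K) : Linf f ->
  exists2 C : R, 0 <= C & \forall x \ae mu, rnorm (f x) <= C.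
Proof.
move=> [_]; rewrite /Linf_norm unlock /Lnorm; case: ifPn => [mu0 fy|].
  have [y [hy yoo]] : exists y : \bar R,
      (\forall x \ae mu, (rnorm (f x))%:E <= y)%E /\ (y < +oo)%E.
    eexists; split; last exact: fy.
    apply: filterS (ess_sup_ge mu (abse \o (fun x => (rnorm (f x))%:E))) => x.
    by rewrite /= ger0_norm ?rnorm_ge0.
  case: y hy yoo => [r h _|//|h _].
    exists `|r| => //; apply: filterS h => x; rewrite lee_fin => h.
    exact: le_trans h (ler_norm _).
  by exists 0 => //; apply: filterS h => x; rewrite leeNy_eq.
rewrite -leNgt measure_le0 => /eqP mu0 _; exists 0 => //.
exact: measure0_ae.
Qed.

End Linfty.

Section Gamma1_operations.
Context {R : realType} {k : scalar_kind}.
Context {d : measure_display} {Omega : measurableType d}.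
Context {mu : {measure set Omega -> \bar R}}.
Local Notation K := (scalar_field R k).
Implicit Types E F : mbundle k mu.

Lemma ae_integrable_section E (s : section E) (g : Omega -> R) : msec s ->
  mu.-integrable setT (EFin \o g) -> (\forall x \ae mu, rnorm (s x) <= g x) ->
  s \in integrable_section E.
Proof.
move=> ms ig h; apply/integrable_sectionP; split=> //.
apply/integrableP; split; first exact: measurable_rnorm.
have /integrableP[mg] := ig; apply: le_lt_trans.
apply: ae_ge0_le_integral => //.
- by apply: measurableT_comp => //; exact: measurable_rnorm.
- by apply: measurableT_comp.
apply: filterS h => x h _; rewrite /= lee_fin ger0_norm ?rnorm_ge0 //.
exact: le_trans h (ler_norm _).
Qed.

Lemma act_integrable E (f : Omega -> K) (s : Gamma1 E) : Linf mu f ->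
  (fun x => f x *: Gamma1_repr s x) \in integrable_section E.
Proof.
move=> Lf; have [ms js] := Gamma1_reprP s; have [C C0 hC] := Linf_bound Lf.
apply: (@ae_integrable_section _ _ (fun x => C * rnorm (Gamma1_repr s x))).
- by apply: msecM => //; exact: Lf.1.
- rewrite (_ : _ \o _ = fun x => (C%:E * (rnorm (Gamma1_repr s x))%:E)%E) //.
  exact: integrableZl.
- by apply: filterS hC => x h; rewrite rnormZ ler_wpM2r ?rnorm_ge0.
Qed.

(* Pointwise multiplication by f in L^oo(X); zero (a junk value) otherwise. *)
Definition Gamma1_act E (f : Omega -> K) (s : Gamma1 E) : Gamma1 E :=
  match pselect (Linf mu f) with
  | left Lf => \pi_(Gamma1 E) (L1Section (act_integrable s Lf))
  | right _ => 0
  end.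

Definition Gamma1_pnorm E (s : Gamma1 E) : Omega -> R :=
  fun x => rnorm (Gamma1_repr s x).

(* The vector of E x underlying a point of [total_space E] over x; zero (a junk
   value) at points that do not lie over x. *)
Definition vec_at {E} (p : total_space E) (x : Omega) : E x :=
  match pselect (projT1 p = x) with
  | left e => eq_rect _ (fun y => E y) (projT2 p) x e
  | right _ => 0
  end.

Lemma vec_atK E (x : Omega) (v : E x) : vec_at (at_fiber v) x = v.
Proof.
rewrite /vec_at; case: pselect => [e|] //=.
by rewrite (Prop_irrelevance e erefl).
Qed.

(* Phi \o s \o psi' as a section of F.  It is used for Phi over psi with
   psi \o psi' = id almost everywhere: then Phi (s (psi' x)) lies over x for
   almost every x (see [push_at_fiber]), and the junk value of [vec_at] only
   matters on a null set. *)
Definition push {E F} (Phi : total_space E -> total_space F) (psi' : Omega -> Omega)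
  (s : section E) : section F :=
  fun x => vec_at (Phi (at_fiber (s (psi' x)))) x.

Section push_integrable.
Variables (E F : mbundle k mu) (psi psi' : Omega -> Omega).
Variable Phi : premorphism psi E F.
Hypothesis mpsi' : measurable_fun setT psi'.
Hypothesis ppsi' : forall A, measurable A -> mu (psi' @^-1` A) = mu A.
Hypothesis psiK : \forall x \ae mu, psi (psi' x) = x.

Lemma ae_preimage (P : Omega -> Prop) :
  (\forall x \ae mu, P x) -> \forall x \ae mu, P (psi' x).
Proof.
move=> [A [mA A0 PA]]; exists (psi' @^-1` A); split.
- by rewrite -[X in measurable X]setTI; exact: mpsi'.
- by rewrite ppsi'.
- by move=> x /= Px; apply: PA.
Qed.

Lemma push_at_fiber (s : section E) : msec s ->
  \forall x \ae mu, Phi (at_fiber (s (psi' x))) = at_fiber (push Phi psi' s x).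
Proof.
move=> ms; have [t mt ht] := pm_section Phi ms.
apply: (filterS2 _ _ (ae_preimage ht) psiK) => x e px.
by rewrite /push e px vec_atK.
Qed.

Lemma push_msec (s : section E) : msec s -> msec (push Phi psi' s).
Proof.
move=> ms; have [t mt ht] := pm_section Phi ms.
apply: (msec_lim (u := fun=> t)) => //.
apply: (filterS2 _ _ (ae_preimage ht) psiK) => x e px.
by rewrite /push e px vec_atK; exact: cvg_cst.
Qed.

Lemma push_integrable (s : section E) :
  s \in integrable_section E -> push Phi psi' s \in integrable_section F.
Proof.
move=> /integrable_sectionP[ms js]; have [C C0 hC] := pm_bound Phi.
apply: (@ae_integrable_section _ _ (fun x => C * rnorm (s (psi' x)))).
- exact: push_msec.
- rewrite (_ : _ \o _ = fun x => (C%:E * (rnorm (s (psi' x)))%:E)%E) //.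
  apply: integrableZl => //; apply/integrableP; split.
    by apply: (measurableT_comp (measurable_rnorm ms)).
  have /integrableP[_] := js; apply: le_lt_trans.
  have mn : measurable_fun setT (fun x => `|(rnorm (s x))%:E|%E).
    by apply: measurableT_comp => //; exact: measurable_rnorm.
  have <- : (\int[pushforward mu psi']_x `|(rnorm (s x))%:E| =
             \int[mu]_x `|(rnorm (s (psi' x)))%:E|)%E.
    by rewrite ge0_integral_pushforward.
  pose f : {mfun Omega >-> Omega} :=
    HB.pack psi' (isMeasurableFun.Build _ _ _ _ _ mpsi').
  rewrite (@eq_measure_integral _ _ _ setT mu (pushforward mu f)) //.
  by move=> A mA _; rewrite -[RHS]ppsi'.
- apply: (filterS2 _ _ (ae_preimage hC) (push_at_fiber ms)) => x h e.
  by move: (h (s (psi' x))); rewrite e.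
Qed.

Definition Gamma1_push (s : Gamma1 E) : Gamma1 F :=
  \pi_(Gamma1 F) (L1Section (push_integrable (L1valP (repr s)))).

(* [Gamma1_push] sends the class of u to the class of Phi \o u \o psi'. *)
Lemma Gamma1_pushE (u : L1section E) : \forall x \ae mu,
  Phi (at_fiber (L1val u (psi' x))) =
  at_fiber (Gamma1_repr (Gamma1_push (\pi_(Gamma1 E) u)) x).
Proof.
have /integrable_sectionP[mu' _] := L1valP u.
have h := Gamma1_repr_pi
  (L1Section (push_integrable (L1valP (repr (\pi_(Gamma1 E) u))))).
apply: (filterS3 _ _ h (ae_preimage (Gamma1_repr_pi u)) (push_at_fiber mu')).
by move=> x e1 e2 ->; congr at_fiber; rewrite e1 /= /push -e2.
Qed.

End push_integrable.

(* V_Theta s = Theta \o s, by [Gamma1_pushE] with psi = psi' = id. *)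
Definition V_op E F (Theta : premorphism id E F) : Gamma1 E -> Gamma1 F :=
  Gamma1_push Theta (psi' := id) (@measurable_id _ _ setT) (fun _ _ => erefl)
    (aeW mu (fun _ => erefl)).

End Gamma1_operations.

(* Categories whose homs are setoids: morphisms are identified up to
   [hom_eq]. *)
Record category := Category {
  obj :> Type;
  hom : obj -> obj -> Type;
  hom_eq : forall A B, hom A B -> hom A B -> Prop;
  hom_id : forall A, hom A A;
  hom_comp : forall A B C, hom B C -> hom A B -> hom A C;
  hom_eq_refl : forall A B (f : hom A B), hom_eq f f;
  hom_eq_sym : forall A B (f g : hom A B), hom_eq f g -> hom_eq g f;
  hom_eq_trans : forall A B (f g h : hom A B),
    hom_eq f g -> hom_eq g h -> hom_eq f h;
  hom_comp_eq : forall A B C (g g' : hom B C) (f f' : hom A B),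
    hom_eq g g' -> hom_eq f f' -> hom_eq (hom_comp g f) (hom_comp g' f');
  hom_comp1 : forall A B (f : hom A B), hom_eq (hom_comp f (hom_id A)) f;
  hom_1comp : forall A B (f : hom A B), hom_eq (hom_comp (hom_id B) f) f;
  hom_compA : forall A B C D (h : hom C D) (g : hom B C) (f : hom A B),
    hom_eq (hom_comp h (hom_comp g f)) (hom_comp (hom_comp h g) f) }.

Arguments hom {c} A B.
Arguments hom_eq {c A B} f g.
Arguments hom_id {c} A.
Arguments hom_comp {c A B C} g f.

Section functors.
Context {C D : category}.
Variables (Fo : C -> D) (Fm : forall A B : C, hom A B -> hom (Fo A) (Fo B)).

Definition is_functor : Prop :=
  [/\ forall A B (f g : hom A B), hom_eq f g -> hom_eq (Fm f) (Fm g),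
      forall A, hom_eq (Fm (hom_id A)) (hom_id (Fo A)) &
      forall A B A' (g : hom B A') (f : hom A B),
        hom_eq (Fm (hom_comp g f)) (hom_comp (Fm g) (Fm f))].

Definition isomorphic (X Y : D) : Prop :=
  exists (f : hom X Y) (g : hom Y X),
    hom_eq (hom_comp g f) (hom_id X) /\ hom_eq (hom_comp f g) (hom_id Y).

Definition essentially_surjective : Prop :=
  forall Y : D, exists X : C, isomorphic (Fo X) Y.

Definition fully_faithful : Prop := forall A B : C,
  (forall f g : hom A B, hom_eq (Fm f) (Fm g) -> hom_eq f g) /\
  (forall h : hom (Fo A) (Fo B), exists f : hom A B, hom_eq (Fm f) h).

End functors.

Section dynamics.
Context {R : realType} (k : scalar_kind).
Context {d : measure_display} {Omega : measurableType d}.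
Context {mu : {measure set Omega -> \bar R}}.
Context {G : groupType} (S : umagmaClosed G) (phi : mp_system mu G).
Local Notation K := (scalar_field R k).

Record dyn_bundle := DynBundle {
  db_bundle :> mbundle k mu;
  db_map : forall g, g \in S -> premorphism (phi g) db_bundle db_bundle;
  db_one : forall h1 : 1%g \in S, pm_eq (db_map h1) id;
  db_mul : forall g h (gS : g \in S) (hS : h \in S) (ghS : (g * h)%g \in S),
    pm_eq (db_map gS \o db_map hS) (db_map ghS);
  db_separable : separable_bundle db_bundle }.

Record dyn_bundle_mor (E F : dyn_bundle) := DynBundleMor {
  dbm_map :> premorphism id E F;
  dbm_comm : forall g (gS : g \in S),
    pm_eq (dbm_map \o db_map E gS) (db_map F gS \o dbm_map) }.

Lemma dbm_id_comm (E : dyn_bundle) g (gS : g \in S) :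
  pm_eq (pm_id E \o db_map E gS) (db_map E gS \o pm_id E).
Proof. exact: pm_eq_refl. Qed.

Definition dbm_id (E : dyn_bundle) : dyn_bundle_mor E E :=
  DynBundleMor (@dbm_id_comm E).

Lemma dbm_comp_comm (E F H : dyn_bundle) (Xi : dyn_bundle_mor F H)
    (Theta : dyn_bundle_mor E F) g (gS : g \in S) :
  pm_eq (pm_comp Xi Theta \o db_map E gS) (db_map H gS \o pm_comp Xi Theta).
Proof.
apply: (filterS3 _ _ (dbm_comm Theta gS) (dbm_comm Xi gS) (pm_linear Theta)).
by move=> x e1 e2 [L _ PL] v; move: (e1 v) => /= ->; rewrite PL; exact: e2.
Qed.

Definition dbm_comp (E F H : dyn_bundle) (Xi : dyn_bundle_mor F H)
    (Theta : dyn_bundle_mor E F) : dyn_bundle_mor E H :=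
  DynBundleMor (dbm_comp_comm Xi Theta).

Definition bundle_category : category :=
  @Category dyn_bundle dyn_bundle_mor
    (fun E F Theta Xi => pm_eq Theta Xi) dbm_id dbm_comp
    (fun E F Theta => pm_eq_refl Theta)
    (fun E F Theta Xi => @pm_eq_sym _ _ _ _ _ _ _ Theta Xi)
    (fun E F Theta Xi H => @pm_eq_trans _ _ _ _ _ _ _ Theta Xi H)
    (fun E F H Xi Xi' Theta Theta' => @pm_comp_eq _ _ _ _ _ _ _ _ Xi Xi' Theta Theta')
    (fun E F Theta => pm_eq_refl Theta)
    (fun E F Theta => pm_eq_refl Theta)
    (fun E F H I Z Xi Theta => pm_eq_refl _).

(* Raw data of an S-dynamical L^1(X)-normed module.  L^oo(X) acts through
   essentially bounded functions, the action depending only on the almost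
   everywhere class; the values of [dm_act] at other functions are irrelevant.
   [dm_pnorm s] is a representative of the element |s| of L^1(X)_+, where L^1(X)
   is identified with its (isometric) image in the dual of L^oo(X). *)
Record dyn_module_data := DynModuleData {
  dm_space :> normedModType K;
  dm_act : (Omega -> K) -> dm_space -> dm_space;
  dm_pnorm : dm_space -> Omega -> R;
  dm_op : forall g, g \in S -> dm_space -> dm_space }.

Record is_banach_module (M : dyn_module_data) : Prop := {
  bm_complete : forall U : set_system M, ProperFilter U -> cauchy U -> cvg U;
  bm_ae : forall f f' (s : M), Linf mu f -> Linf mu f' ->
    (\forall x \ae mu, f x = f' x) -> dm_act f s = dm_act f' s;
  bm_addl : forall f f' (s : M), Linf mu f -> Linf mu f' ->
    dm_act (fun x => f x + f' x) s = dm_act f s + dm_act f' s;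
  bm_scalel : forall a f (s : M), Linf mu f ->
    dm_act (fun x => a * f x) s = a *: dm_act f s;
  bm_linear : forall f, Linf mu f -> linear (dm_act f : M -> M);
  bm_mul : forall f f' (s : M), Linf mu f -> Linf mu f' ->
    dm_act (fun x => f x * f' x) s = dm_act f (dm_act f' s);
  bm_norm : forall f (s : M), Linf mu f ->
    ((rnorm (dm_act f s))%:E <= Linf_norm mu f * (rnorm s)%:E)%E;
  bm_nondegenerate : dense (lin [set v : M | exists f (s : M),
    Linf mu f /\ v = dm_act f s]) }.

Record is_L1_normed (M : dyn_module_data) : Prop := {
  pn_integrable : forall s : M, mu.-integrable setT (EFin \o dm_pnorm s);
  pn_ge0 : forall s : M, \forall x \ae mu, 0 <= dm_pnorm s x;
  pn_norm : forall s : M, (\int[mu]_x (dm_pnorm s x)%:E)%E = (rnorm s)%:E;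
  pn_act : forall f (s : M), Linf mu f ->
    \forall x \ae mu, dm_pnorm (dm_act f s) x = rnorm (f x) * dm_pnorm s x;
  pn_triangle : forall s t : M,
    \forall x \ae mu, dm_pnorm (s + t) x <= dm_pnorm s x + dm_pnorm t x }.

Record is_dynamical (M : dyn_module_data) : Prop := {
  do_bounded : forall g (gS : g \in S), bounded_linear (dm_op gS : M -> M);
  do_one : forall (h1 : 1%g \in S) (s : M), dm_op h1 s = s;
  do_mul : forall g h (gS : g \in S) (hS : h \in S) (ghS : (g * h)%g \in S)
    (s : M), dm_op ghS s = dm_op gS (dm_op hS s);
  do_act : forall g (gS : g \in S) f (s : M), Linf mu f ->
    dm_op gS (dm_act f s) = dm_act (f \o phi g^-1%g) (dm_op gS s) }.

Record is_dyn_module (M : dyn_module_data) : Prop := {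
  dm_banach_module : is_banach_module M;
  dm_L1_normed : is_L1_normed M;
  dm_separable : exists u : nat -> M, dense (range u);
  dm_dynamical : is_dynamical M }.

Record dyn_module := DynModule {
  dm_data :> dyn_module_data;
  dm_axioms : is_dyn_module dm_data }.

Record is_dyn_module_hom (M N : dyn_module_data) (V : M -> N) : Prop := {
  dh_bounded : bounded_linear V;
  dh_act : forall f (s : M), Linf mu f -> V (dm_act f s) = dm_act f (V s);
  dh_op : forall g (gS : g \in S) (s : M), V (dm_op gS s) = dm_op gS (V s) }.

Record dyn_module_hom (M N : dyn_module_data) := DynModuleHom {
  dh_map :> M -> N;
  dh_axioms : is_dyn_module_hom dh_map }.

Lemma dh_id_axioms (M : dyn_module_data) : is_dyn_module_hom (@id M).
Proof. by split=> //; exact: bounded_linear_id. Qed.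

Lemma dh_comp_axioms (M N P : dyn_module_data) (W : dyn_module_hom N P)
  (V : dyn_module_hom M N) : is_dyn_module_hom (W \o V).
Proof.
have [bV aV oV] := dh_axioms V; have [bW aW oW] := dh_axioms W; split.
- exact: bounded_linear_comp.
- by move=> f s Lf /=; rewrite aV // aW.
- by move=> g gS s /=; rewrite oV oW.
Qed.

Definition module_category : category :=
  @Category dyn_module (fun M N => dyn_module_hom M N)
    (fun M N V W => V =1 W)
    (fun M => DynModuleHom (dh_id_axioms M))
    (fun M N P W V => DynModuleHom (dh_comp_axioms W V))
    (fun M N V => frefl V)
    (fun M N V W => @fsym _ _ V W)
    (fun M N V W X => @ftrans _ _ V W X)
    (fun M N P W W' V V' hW hV s => etrans (hW (V s)) (congr1 W' (hV s)))
    (fun M N V => frefl V)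
    (fun M N V => frefl V)
    (fun M N P Q X W V => frefl (X \o W \o V)).

Lemma mp_invK g : \forall x \ae mu, phi g (phi g^-1%g x) = x.
Proof.
apply: (filterS2 _ _ (mp_mul phi g g^-1%g) (mp_one phi)) => x.
by rewrite mulgV => -> .
Qed.

(* T_Phi(g) s = Phi_g \o s \o phi_g^-1, by [Gamma1_pushE]. *)
Definition koopman (E : dyn_bundle) g (gS : g \in S) : Gamma1 E -> Gamma1 E :=
  Gamma1_push (db_map E gS) (mp_measurable phi g^-1%g)
    (mp_preserving phi g^-1%g) (mp_invK g).

Definition Gamma1_module (E : dyn_bundle) : dyn_module_data :=
  DynModuleData (@Gamma1_act _ _ _ _ _ E) (@Gamma1_pnorm _ _ _ _ _ E)
    (@koopman E).

(* The object and morphism parts of the functor, given that the assignments are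
   well defined. *)
Definition Gamma1_obj
    (wd : forall E : dyn_bundle, is_dyn_module (Gamma1_module E)) :
    bundle_category -> module_category :=
  fun E => DynModule (wd E).

Definition Gamma1_mor
    (wd : forall E : dyn_bundle, is_dyn_module (Gamma1_module E))
    (wdV : forall (E F : dyn_bundle) (Theta : dyn_bundle_mor E F),
      @is_dyn_module_hom (Gamma1_module E) (Gamma1_module F) (V_op Theta)) :
    forall E F : bundle_category,
      hom E F -> hom (Gamma1_obj wd E) (Gamma1_obj wd F) :=
  fun E F Theta => @DynModuleHom (Gamma1_module E) (Gamma1_module F) _
    (wdV E F Theta).

End dynamics.

(* Main.v *)
Require Import Defs.
From HB Require Import structures.
From mathcomp Require Import all_boot all_order all_algebra.
From mathcomp Require Import complex generic_quotient ring_quotient.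
From mathcomp Require Import all_classical all_reals all_analysis.
From mathcomp Require Import measurable_realfun ess_sup_inf lra.

Set Implicit Arguments.
Unset Strict Implicit.
Unset Printing Implicit Defensive.

Import Order.TTheory GRing.Theory Num.Theory.
Import numFieldNormedType.Exports.

Local Open Scope classical_set_scope.
Local Open Scope ring_scope.
Local Open Scope quotient_scope.

(** Why the functor is fully faithful and essentially surjective.

    Everything rests on passing between norm estimates on modules and estimates
    valid at almost every point.  If [T] is bounded with constant [C] and
    [T (f s) = (f \o psi') (T s)], testing against truncations by measurable sets
    gives [|T s| <= C |s| \o psi'] almost everywhere ([equivariant_bound]).
    Conversely, a linear map [J] with [|J s| <= C |s|] commutes with the action
    of bounded functions: where [f] is within [e] of a constant [z], the section
    [J (f s) - f (J s) = J ((f - z) s) - (f - z) (J s)] is small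
    ([local_linear_act]).

    Morphisms.  Let the integrable sections [b n] span a dense subspace of almost
    every fiber of [E].  By the pointwise estimate and countability, for almost
    every [x] the assignment sending a combination of the [b n x] with rational
    coefficients to the same combination of the [T (b n) (psi x)] is bounded, so
    it extends to the fiber at [x]; these extensions form a premorphism
    inducing [T] ([representation]).  Two fiberwise bounded linear maps agreeing
    on the [b n] agree almost everywhere ([pm_eq_of_generating]).  The first fact
    gives fullness, the second faithfulness, and the second also turns
    identities between operators on sections into identities between morphisms
    of bundles (equivariance, cocycle law).

    Objects.  For a bundle [E], the module of integrable sections is complete by
    the Riesz-Fischer argument ([Gamma1_complete]).  A set of sections that
    contains a pointwise dense sequence and is stable under gluing along
    measurable sets is dense ([glue_dense]): glue together the nearest of the
    first [n] members of the sequence and use dominated convergence.  Gluing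
    along the countably many sets given by the separability of the measure then
    shows that the module is separable ([Gamma1_separable]).

    Conversely let [u] be a dense sequence in an abstract module [M].  For
    almost every [x] the map sending [c] to the value at [x] of
    [|c 0 u 0 + c 1 u 1 + ... |] is a seminorm on finite sequences [c] of rational
    scalars.  It extends to scalar sequences ([seminorm_extension]), and the
    fiber at [x] is the Hausdorff completion ([completion]).  A section is declared
    measurable when its distance to each rational combination is a measurable
    function; countable infima show that this is a measurable Banach bundle
    ([fiber_bundle]).  Sending [u n] to the [n]-th coordinate section extends to a
    map [J] from [M] to the integrable sections that preserves pointwise norms,
    hence is isometric and linear over bounded functions; its range is closed,
    stable under gluing and pointwise dense, hence everything
    ([realization_iso]).  The operators of [M], conjugated by [J], come from
    premorphisms by [representation], and these define the dynamical bundle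
    ([transported_bundle]). *)

(** * Real-valued norms, convergence and completeness *)

Section norms.
Context {R : realType} {k : scalar_kind}.
Local Notation K := (scalar_field R k).
Implicit Types V : normedModType K.

Lemma emb_gt0 (e : R) : (0 < emb e :> K) = (0 < e).
Proof. by rewrite !lt_neqAle -(@emb0 R k) ler_emb (inj_eq emb_inj). Qed.

Lemma gt0_emb (e : K) : 0 < e -> exists2 r : R, 0 < r & e = emb r.
Proof.
by move=> e0; exists (re e); rewrite -?emb_gt0 emb_re // ltW.
Qed.

Lemma ltr_emb (a b : R) : (emb a < emb b :> K) = (a < b).
Proof. by rewrite !lt_neqAle ler_emb (inj_eq emb_inj). Qed.

Lemma rnorm_distC V (v w : V) : rnorm (v - w) = rnorm (w - v).
Proof. by rewrite -[in RHS]opprB rnormN. Qed.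

Lemma rnorm_triang V (w v u : V) : rnorm (v - u) <= rnorm (v - w) + rnorm (w - u).
Proof. by rewrite -[v - u](subrKA w); exact: rnormD. Qed.

Lemma ler_rnormB V (v w : V) : `|rnorm v - rnorm w| <= rnorm (v - w).
Proof.
have := rnormD (v - w) w; have := rnormD (w - v) v.
rewrite !subrK (rnorm_distC w v) ler_norml => h1 h2; apply/andP; split; lra.
Qed.

Lemma ball_rnorm V (v w : V) (e : R) : ball v (emb e : K) w = (rnorm (v - w) < e) :> Prop.
Proof. by rewrite -ball_normE /= -rnormE ltr_emb. Qed.

Lemma cvg_rnormP V (F : set_system V) {FF : Filter F} (v : V) :
  F --> v <-> forall e : R, 0 < e -> \forall w \near F, rnorm (v - w) < e.
Proof.
split=> [/cvg_ballP h e e0|h].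
  have := h (emb e); rewrite emb_gt0 => /(_ e0).
  by apply: filterS => w; rewrite ball_rnorm.
apply/cvg_ballP => e /gt0_emb[r r0 ->].
by move: (h r r0); apply: filterS => w; rewrite ball_rnorm.
Qed.

Lemma cvg_rnorm0 V (u : nat -> V) (v : V) :
  u n @[n --> \oo] --> v <-> rnorm (u n - v) @[n --> \oo] --> (0 : R).
Proof.
split=> [/cvg_rnormP h|h].
  apply/cvgr0Pnorm_lt => e e0; have := h e e0; rewrite near_map.
  by apply: filterS => n; rewrite ger0_norm ?rnorm_ge0 // rnorm_distC.
apply/cvg_rnormP => e e0; move/cvgr0Pnorm_lt: h => /(_ e e0).
by rewrite near_map; apply: filterS => n; rewrite ger0_norm ?rnorm_ge0 // rnorm_distC.
Qed.

Lemma cauchy_rnormP V (F : set_system V) {FF : ProperFilter F} :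
  cauchy F <-> forall e : R, 0 < e -> exists v, F [set w | rnorm (v - w) < e].
Proof.
rewrite cauchyP; split=> [h e e0|h e /gt0_emb[r r0 ->]].
  have := h (emb e); rewrite emb_gt0 => /(_ e0)[v hv]; exists v.
  by apply: filterS hv => w; rewrite ball_rnorm.
have [v hv] := h r r0; exists v.
by apply: filterS hv => w; rewrite ball_rnorm.
Qed.

Lemma dense_rnormP V (A : set V) :
  dense A <-> forall v (e : R), 0 < e -> exists2 a, A a & rnorm (v - a) < e.
Proof.
split=> [dA v e e0|dA U [v Uv] oU].
  have e0' : 0 < emb e :> K by rewrite emb_gt0.
  have [] := dA (ball v (emb e))^°.
  - by exists v; apply: nbhsx_ballx.
  - exact: open_interior.
  by move=> a [/interior_subset + Aa]; rewrite ball_rnorm; exists a.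
have /nbhs_ballP[e /= /gt0_emb[r r0 ->] vU] : nbhs v U by apply: open_nbhs_nbhs.
by have [a Aa] := dA v r r0; rewrite -ball_rnorm => /vU Ua; exists a.
Qed.

(** Sequences with increments below these powers are used as rapidly Cauchy
    sequences, because the sums of their tails are explicit. *)
Definition half_pow (n : nat) : R := 2^-1 ^+ n.

Lemma half_pow_gt0 n : 0 < half_pow n.
Proof. by rewrite exprn_gt0 // invr_gt0. Qed.

Lemma half_powS n : half_pow n.+1 + half_pow n.+1 = half_pow n.
Proof. by rewrite /half_pow exprS; lra. Qed.

Lemma half_pow_cvg0 : half_pow @ \oo --> (0 : R).
Proof. by apply: cvg_expr; rewrite ger0_norm ?invr_ge0 // invf_lt1 // ltr1n. Qed.

Lemma half_pow_lt (e : R) : 0 < e -> exists n, half_pow n < e.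
Proof.
move=> e0; have /cvgr0Pnorm_lt /(_ e e0)[n _ h] := half_pow_cvg0.
by exists n; have := h n (leqnn n); rewrite ger0_norm // ltW ?half_pow_gt0.
Qed.

Lemma half_pow_le n m : (n <= m)%N -> half_pow m <= half_pow n.
Proof.
move=> nm; rewrite /half_pow ler_wiXn2l ?invr_ge0 //.
by rewrite invf_le1 // ler1n.
Qed.

Lemma rapid_tail V (u : nat -> V) :
  (forall n, rnorm (u n - u n.+1) < half_pow n) ->
  forall n m, (n <= m)%N -> rnorm (u n - u m) <= half_pow n + half_pow n.
Proof.
move=> hu n m /subnKC <-; move: (m - n)%N => j {m}; elim: j n => [|j ih] n.
  by rewrite addn0 subrr rnorm0 addr_ge0 // ltW ?half_pow_gt0.
apply: (le_trans (rnorm_triang (u n.+1) _ _)); apply: lerD; first exact: ltW.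
by rewrite -addSnnS -half_powS.
Qed.

(** Together with [cvg_perturb], this replaces a rapidly Cauchy sequence by
    nearby points of a dense subspace. *)
Lemma rapid_perturb V (u w : nat -> V) :
  (forall n, rnorm (u n - u n.+1) < half_pow n) ->
  (forall n, rnorm (u n - w n) < half_pow n) ->
  forall n m, (n <= m)%N -> rnorm (w n - w m) <= 4 * half_pow n.
Proof.
move=> hu hw n m nm.
have h1 : rnorm (w n - u n) < half_pow n by rewrite rnorm_distC.
have h2 := rapid_tail hu nm; have h3 := hw m; have h4 := half_pow_le nm.
have h5 := rnorm_triang (u n) (w n) (w m).
have h6 := rnorm_triang (u m) (u n) (w m); lra.
Qed.

Lemma cvg_perturb V (u w : nat -> V) (v : V) :
  (forall n, rnorm (u n - w n) < half_pow n) ->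
  (forall e : R, 0 < e ->
     exists N, forall n, (N <= n)%N -> rnorm (v - w n) <= e) ->
  u n @[n --> \oo] --> v.
Proof.
move=> hw hv; apply/cvg_rnorm0/cvgr0Pnorm_lt => e e0.
have e2 : 0 < e / 2 by rewrite divr_gt0.
have [N hN] := half_pow_lt e2; have [M hM] := hv _ e2.
exists (maxn N M) => // n /=; rewrite geq_max => /andP[Nn Mn].
rewrite ger0_norm ?rnorm_ge0 //.
have h1 := rnorm_triang (w n) (u n) v; have h2 := hw n.
have h3 := half_pow_le Nn; have := hM n Mn; rewrite rnorm_distC => h4; lra.
Qed.

(** A point chosen in the common part of consecutive small members of a Cauchy
    filter gives a rapidly Cauchy sequence with the same limit. *)
Lemma complete_of_rapid V :
  (forall u : nat -> V, (forall n, rnorm (u n - u n.+1) < half_pow n) ->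
     exists v : V, u n @[n --> \oo] --> v) ->
  forall F : set_system V, ProperFilter F -> cauchy F -> cvg F.
Proof.
move=> hV F FF /cauchy_rnormP cF.
have hp n : 0 < half_pow n.+2 by exact: half_pow_gt0.
have [c hc] := choice (fun n => cF (half_pow n.+2) (hp n)).
pose A n := [set w | rnorm (c n - w) < half_pow n.+2].
have hA n : exists w, A n w /\ A n.+1 w.
  by have [w] := @filter_ex _ _ FF _ (filterI (hc n) (hc n.+1)); exists w.
have [u hu] := choice hA.
have rapid n : rnorm (u n - u n.+1) < half_pow n.
  have [un un1] := hu n; have [un' _] := hu n.+1.
  apply: (le_lt_trans (rnorm_triang (c n.+1) _ _)).
  rewrite rnorm_distC -half_powS; apply: ltrD.
    by apply: (lt_le_trans un1); apply: half_pow_le; apply: leqW.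
  by apply: (lt_le_trans un'); apply: half_pow_le; apply: leqW.
have [v cuv] := hV u rapid.
have /cvgr0Pnorm_lt uv := (cvg_rnorm0 u v).1 cuv.
apply/cvg_ex; exists v; apply/cvg_rnormP => e e0.
have e20 : 0 < e / 2 by rewrite divr_gt0.
have [N hN] := half_pow_lt e20.
have [M _ hM] := uv _ e20.
pose n := maxn M N; apply: filterS (hc n) => w wA.
have [un _] := hu n.
apply: (le_lt_trans (rnorm_triang (u n) _ _)).
apply: (@lt_le_trans _ _ (e / 2 + e / 2)); last by rewrite -splitr.
apply: ltrD.
  rewrite rnorm_distC -[ltLHS]ger0_norm ?rnorm_ge0 //.
  by apply: hM; rewrite /= leq_maxl.
apply: (lt_trans _ hN); apply: (le_lt_trans (rnorm_triang (c n) _ _)).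
apply: (@lt_le_trans _ _ (half_pow n.+2 + half_pow n.+2)).
  by apply: ltrD => //; rewrite rnorm_distC.
rewrite half_powS; apply: half_pow_le; apply: leqW; exact: leq_maxr.
Qed.

Lemma cauchy_seq_cvg V :
  (forall F : set_system V, ProperFilter F -> cauchy F -> cvg F) ->
  forall u : nat -> V,
    (forall e : R, 0 < e -> exists N, forall n, (N <= n)%N -> rnorm (u N - u n) < e) ->
    exists v : V, u n @[n --> \oo] --> v.
Proof.
move=> cV u cu; apply/cvg_ex; apply: cV.
apply/cauchy_rnormP => e e0; have [N hN] := cu e e0.
by exists (u N); exists N.
Qed.

End norms.

(** * Rational scalars and polynomials with rational coefficients *)

Section rational_scalars.
Context {R : realType} {k : scalar_kind}.
Local Notation K := (scalar_field R k).

Lemma reB (z w : K) : re (z - w) = re z - re w.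
Proof. by rewrite /re; case: k z w => // -[a b] [c d]. Qed.

Lemma imB (z w : K) : im (z - w) = im z - im w.
Proof. by rewrite /im; case: k z w => /= [z w|[a b] [c d] //]; rewrite subrr. Qed.

Lemma reM (z w : K) : re (z * w) = re z * re w - im z * im w.
Proof.
by rewrite /re /im; case: k z w => /= [z w|[a b] [c d] //]; rewrite mulr0 subr0.
Qed.

Lemma imM (z w : K) : im (z * w) = re z * im w + im z * re w.
Proof.
by rewrite /re /im; case: k z w => /= [z w|[a b] [c d] //];
  rewrite mulr0 mul0r addr0.
Qed.

Lemma re1 : re (1 : K) = 1. Proof. by rewrite /re; case: k. Qed.
Lemma im1 : im (1 : K) = 0. Proof. by rewrite /im; case: k. Qed.

Lemma re_im_inj (z w : K) : re z = re w -> im z = im w -> z = w.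
Proof. by rewrite /re /im; case: k z w => //= -[a b] [c d] /= -> ->. Qed.

Lemma rnorm_re_im (z : K) : rnorm z <= `|re z| + `|im z|.
Proof.
rewrite -(@ler_emb R k) rnormE embD /re /im /emb; case: k z => /= [z|z].
  by rewrite normr0 addr0.
rewrite [z in leLHS]complexE; apply: (le_trans (ler_normD _ _)).
rewrite normrM; apply: lerD; first by rewrite normc_def /= expr0n addr0 sqrtr_sqr.
by rewrite !normc_def /= !expr0n /= !addr0 add0r expr1n sqrtr1 mul1r sqrtr_sqr.
Qed.

(** Over the real scalars [im z] is zero, so the premise forces [b] to be zero. *)
Lemma exists_re_im (z : K) (a b : R) : (im z = 0 -> b = 0) ->
  exists w : K, re w = a /\ im w = b.
Proof.
rewrite /re /im; case: k z => /= [z ->|z _] //; first by exists a.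
by exists (a +i* b)%C.
Qed.

(** Stated through real and imaginary parts, the definition covers real and
    complex scalars at once and gives a countable dense subring. *)
Definition ratK : {pred K} := [pred z : K |
  `[< (exists p : rat, re z = ratr p) /\ (exists q : rat, im z = ratr q) >]].

Lemma ratKP (z : K) : reflect ((exists p : rat, re z = ratr p) /\
  (exists q : rat, im z = ratr q)) (z \in ratK).
Proof. exact: asboolP. Qed.

Lemma ratK_subring : subring_closed ratK.
Proof.
split=> [|z w /ratKP[[p hp] [q hq]] /ratKP[[p' hp'] [q' hq']]
         |z w /ratKP[[p hp] [q hq]] /ratKP[[p' hp'] [q' hq']]].
- by apply/ratKP; split; [exists 1; rewrite re1 rmorph1|
    exists 0; rewrite im1 rmorph0].
- apply/ratKP; split; [exists (p - p')|exists (q - q')].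
    by rewrite reB hp hp' rmorphB.
  by rewrite imB hq hq' rmorphB.
- apply/ratKP; split; [exists (p * p' - q * q')|exists (p * q' + q * p')].
    by rewrite reM hp hp' hq hq' rmorphB !rmorphM.
  by rewrite imM hp hp' hq hq' rmorphD !rmorphM.
Qed.

HB.instance Definition _ := GRing.isSubringClosed.Build K ratK ratK_subring.

Lemma ratr_approx (a e : R) : 0 < e -> exists q : rat, `|a - ratr q| < e.
Proof.
move=> e0; have : `]a - e, a + e[ !=set0.
  by exists a; rewrite /= in_itv /=; apply/andP; split; lra.
move=> /(@dense_rat R) /(_ (@itv_open _ _ _ _)) [r [+ [q _ qr]]].
rewrite /= -qr in_itv /= => /andP[h1 h2]; exists q; rewrite ltr_norml; lra.
Qed.

Lemma ratK_approx (z : K) (e : R) : 0 < e ->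
  exists2 w : K, w \in ratK & rnorm (z - w) < e.
Proof.
move=> e0; have e20 : 0 < e / 2 by rewrite divr_gt0.
have [p hp] := ratr_approx (re z) e20.
have [q [hq hq0]] : exists q : rat, `|im z - ratr q| < e / 2 /\
    (im z = 0 -> ratr q = 0 :> R).
  have [->|z0] := eqVneq (im z) 0.
    by exists 0; rewrite rmorph0 subrr normr0.
  have [q hq] := ratr_approx (im z) e20; exists q; split=> // h.
  by rewrite h eqxx in z0.
have [w [hw1 hw2]] := exists_re_im (ratr p) hq0.
exists w.
  by apply/ratKP; split; [exists p|exists q].
apply: (le_lt_trans (rnorm_re_im _)); rewrite reB imB hw1 hw2.
by rewrite [ltRHS]splitr ltrD.
Qed.

(** An enumeration of the polynomials with rational coefficients.  They serve as
    finite sequences of rational scalars; being countable, they can be quantified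
    over inside almost-everywhere statements. *)
Definition rat_poly (n : nat) : {poly K} :=
  if unpickle n is Some l then
    Poly [seq xget (0 : K) [set z | re z = ratr pq.1 /\ im z = ratr pq.2] |
          pq : rat * rat <- l]
  else 0.

Lemma rat_polyP (c : {poly K}) :
  c \is a polyOver ratK <-> exists n, c = rat_poly n.
Proof.
pose g (pq : rat * rat) : K :=
  xget 0 [set z | re z = ratr pq.1 /\ im z = ratr pq.2].
have gD pq : g pq \in ratK.
  rewrite /g; case: xgetP => [z -> /= [h1 h2]|_]; last exact: rpred0.
  by apply/ratKP; split; [exists pq.1|exists pq.2].
have gS (z : K) : z \in ratK -> exists pq, z = g pq.
  move=> /ratKP[[p hp] [q hq]]; exists (p, q); rewrite /g.
  case: xgetP => [w _ [h1 h2]|/(_ z)]; last by move=> /=; tauto.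
  by apply: re_im_inj; rewrite ?h1 ?h2.
have gL (s : seq K) : {subset s <= ratK} -> exists l, s = map g l.
  elim: s => [|z s ih] h; first by exists [::].
  have [l ->] : exists l, s = map g l.
    by apply: ih => w ws; apply: h; rewrite inE ws orbT.
  have [pq ->] := gS z (h z (mem_head _ _)).
  by exists (pq :: l).
split=> [/polyOverP cD|[n ->]].
  have [l hl] : exists l, c = map g l :> seq K.
    by apply: gL => z /(nthP 0)[i _ <-]; exact: cD.
  exists (pickle l); rewrite /rat_poly pickleK -/g -hl.
  by rewrite polyseqK.
rewrite /rat_poly; case: unpickle => [l|]; last exact: rpred0.
apply/polyOverP => i; rewrite coef_Poly -/g.
have [il|il] := ltnP i (size l).
  by rewrite (nth_map (0, 0)).
by rewrite nth_default ?size_map // rpred0.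
Qed.

End rational_scalars.

(** * Seminorms and finite linear combinations *)

Section seminorms.
Context {R : realType} {k : scalar_kind}.
Local Notation K := (scalar_field R k).

Record seminorm (V : lmodType K) := Seminorm {
  sn_fun :> V -> R;
  snD : forall v w, sn_fun (v + w) <= sn_fun v + sn_fun w;
  snZ : forall a v, sn_fun (a *: v) = rnorm a * sn_fun v }.

Section seminorm_theory.
Variables (V : lmodType K) (p : seminorm V).

Lemma sn0 : p 0 = 0.
Proof. by rewrite -(scale0r 0) snZ rnorm0 mul0r. Qed.

Lemma rnorm1 : rnorm (1 : K) = 1 :> R.
Proof. by apply: (@emb_inj R k); rewrite rnormE normr1 /emb; case: k. Qed.

Lemma snN v : p (- v) = p v.
Proof. by rewrite -scaleN1r snZ rnormN rnorm1 mul1r. Qed.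

Lemma sn_distC v w : p (v - w) = p (w - v).
Proof. by rewrite -snN opprB. Qed.

Lemma sn_ge0 v : 0 <= p v.
Proof. by have := snD p v (- v); rewrite subrr sn0 snN; lra. Qed.

Lemma sn_triang v w u : p (v - u) <= p (v - w) + p (w - u).
Proof. by rewrite -[v - u](subrKA w) snD. Qed.

Lemma sn_dist v w : `|p v - p w| <= p (v - w).
Proof.
have := snD p (v - w) w; have := snD p (w - v) v.
rewrite !subrK (sn_distC w v) ler_norml => h1 h2; apply/andP; split; lra.
Qed.

End seminorm_theory.

Lemma rnormM (a b : K) : rnorm (a * b) = rnorm a * rnorm b :> R.
Proof. exact: (@rnormZ R k K). Qed.

Section pullback.
Variables (V W : lmodType K) (f : {linear V -> W}) (p : seminorm W).
Lemma pullbackD v w : p (f (v + w)) <= p (f v) + p (f w).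
Proof. by rewrite linearD snD. Qed.
Lemma pullbackZ a v : p (f (a *: v)) = rnorm a * p (f v).
Proof. by rewrite linearZ snZ. Qed.
Definition pullback_sn := Seminorm pullbackD pullbackZ.
End pullback.

Definition norm_sn (V : normedModType K) : seminorm V :=
  Seminorm (@rnormD _ _ V) (@rnormZ _ _ V).

Section eval.
Variables (V : lmodType K) (u : nat -> V).

(** Finite sequences of coefficients are encoded as polynomials, which already
    form a vector space with basis ['X^i]. *)
Definition lincomb (c : {poly K}) : V := \sum_(i < size c) c`_i *: u i.

Lemma lincomb_widen n (c : {poly K}) : (size c <= n)%N ->
  lincomb c = \sum_(i < n) c`_i *: u i.
Proof.
move=> cn; rewrite /lincomb (big_ord_widen n (fun i => c`_i *: u i)) // big_mkcond /=.
apply: eq_bigr => i _; case: ltnP => // h.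
by rewrite nth_default // scale0r.
Qed.

Lemma lincomb_is_linear : linear lincomb.
Proof.
move=> a c c'; pose n := maxn (size (a *: c + c')) (maxn (size c) (size c')).
rewrite !(@lincomb_widen n) ?leq_max ?leqnn ?orbT //.
rewrite scaler_sumr -big_split /=; apply: eq_bigr => i _.
by rewrite coefD coefZ scalerDl scalerA.
Qed.

HB.instance Definition _ := GRing.isLinear.Build K {poly K} V *:%R lincomb lincomb_is_linear.

Lemma lincombX n : lincomb 'X^n = u n.
Proof.
rewrite (@lincomb_widen n.+1) ?size_polyXn // big_ord_recr /= big1 ?add0r.
  by rewrite coefXn eqxx scale1r.
by move=> i _; rewrite coefXn ltn_eqF // scale0r.
Qed.

End eval.

Section linear_predicate.
Variables (V W : lmodType K) (L : V -> W).
Hypothesis lL : linear L.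

Lemma linear_subE v w : L (v - w) = L v - L w.
Proof. by rewrite addrC -scaleN1r lL scaleN1r addrC. Qed.

Lemma linear_0E : L 0 = 0.
Proof. by rewrite -(subrr 0) linear_subE subrr. Qed.

Lemma linear_scaleE a v : L (a *: v) = a *: L v.
Proof. by have := lL a v 0; rewrite !addr0 linear_0E addr0. Qed.

Lemma linear_sumE n (a : 'I_n -> V) : L (\sum_(i < n) a i) = \sum_(i < n) L (a i).
Proof.
elim: n a => [|n ih] a; first by rewrite !big_ord0 linear_0E.
by rewrite !big_ord_recl -{1}[a ord0]scale1r lL ih scale1r.
Qed.

Lemma linear_lincomb (u : nat -> V) c : L (lincomb u c) = lincomb (L \o u) c.
Proof. by rewrite /lincomb linear_sumE; apply: eq_bigr => i _; rewrite linear_scaleE. Qed.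

End linear_predicate.

Lemma lincomb_id (c : {poly K}) : lincomb (fun i => 'X^i) c = c.
Proof. by rewrite /lincomb -poly_def coefK. Qed.

Lemma lin_lincomb (V : lmodType K) (u : nat -> V) :
  lin [set u n | n in [set: nat]] = range (lincomb u).
Proof.
apply/seteqP; split=> [v [n [c [a [ha ->]]]]|_ [c _ <-]].
  elim: n c a ha => [|n ih] c a ha.
    by exists 0; rewrite // big_ord0 linear0.
  rewrite big_ord_recl /=.
  have [d _ <-] := ih (fun i => c (lift ord0 i)) (fun i => a (lift ord0 i))
    (fun i => ha (lift ord0 i)).
  have [m _ <-] := ha ord0.
  by exists (c ord0 *: 'X^m + d); rewrite // lincomb_is_linear lincombX.
by exists (size c), (fun i => c`_i), (fun i => u i); split=> // i; exists i.
Qed.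

Lemma mul_lt_of_lt_div (t b e : R) : 0 < e -> 0 <= b -> 0 <= t ->
  t < e / (b + 1) -> t * b < e.
Proof.
move=> e0 b0 t0 h; have b1 : 0 < b + 1 by rewrite ltr_wpDl.
apply: (@le_lt_trans _ _ (t * (b + 1))).
  by rewrite ler_wpM2l // lerDl.
by rewrite -ltr_pdivlMr.
Qed.

Lemma ratK_approxM (a : K) (b e : R) : 0 < e -> 0 <= b ->
  exists2 a' : K, a' \in ratK & rnorm (a - a') * b < e.
Proof.
move=> e0 b0; have e1 : 0 < e / (b + 1) by rewrite divr_gt0 // ltr_wpDl.
have [a' Da' ha'] := ratK_approx a e1; exists a' => //.
by apply: mul_lt_of_lt_div => //; exact: rnorm_ge0.
Qed.

(** By induction on the polynomial: composing a seminorm with multiplication by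
    ['X] gives a seminorm again, so no weights on coefficients are needed. *)
Lemma rat_poly_approx (n : seminorm {poly K}) (c : {poly K}) (e : R) : 0 < e ->
  exists2 d, d \is a polyOver (@ratK R k) & n (c - d) < e.
Proof.
elim/poly_ind: c n e => [|c a ih] n e e0.
  by exists 0; rewrite ?rpred0 // subr0 sn0.
have e20 : 0 < e / 2 by rewrite divr_gt0.
have nD v w : n ((v + w) * 'X) <= n (v * 'X) + n (w * 'X).
  by rewrite mulrDl snD.
have nZ b v : n ((b *: v) * 'X) = rnorm b * n (v * 'X).
  by rewrite -scalerAl snZ.
have [d Dd hd] := ih (Seminorm nD nZ) _ e20.
have [a' Da' ha'] := ratK_approxM a e20 (sn_ge0 n 1).
exists (d * 'X + a'%:P).
  by rewrite rpredD ?polyOverC // rpredM ?polyOverX.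
rewrite opprD addrACA [e]splitr; apply: (le_lt_trans (snD n _ _)).
apply: ltrD; first by move: hd; rewrite /= mulrBl.
by rewrite -polyCB -[(a - a')%:P]mulr1 mul_polyC snZ.
Qed.

End seminorms.

(** * Extending seminorms and bounded maps from rational combinations *)

Section seminorm_extension.
Context {R : realType} {k : scalar_kind}.
Local Notation K := (scalar_field R k).
Local Notation D := (polyOver (@ratK R k)).
Variable q : {poly K} -> R.
Hypothesis qD : forall c d, c \is a D -> d \is a D -> q (c + d) <= q c + q d.
Hypothesis qZ : forall a d, a \in @ratK R k -> d \is a D ->
  q (a *: d) = rnorm a * q d.

Let q0 : q 0 = 0.
Proof. by rewrite -(scale0r 0) qZ ?rpred0 // rnorm0 mul0r. Qed.

Let q_ge0 d : d \is a D -> 0 <= q d.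
Proof.
move=> Dd; have := qD Dd (rpredNr Dd); rewrite subrr q0 -scaleN1r qZ //.
  by rewrite rnormN rnorm1 mul1r; lra.
by rewrite rpredN rpred1.
Qed.

(* The largest seminorm with the values of [q] on the basis; it dominates [q]. *)
Let wt (c : {poly K}) : R := \sum_(i < size c) rnorm c`_i * q 'X^i.

Let wt_widen n (c : {poly K}) : (size c <= n)%N ->
  wt c = \sum_(i < n) rnorm c`_i * q 'X^i.
Proof.
move=> cn; rewrite /wt (big_ord_widen n (fun i => rnorm c`_i * q 'X^i)) //.
rewrite big_mkcond /=; apply: eq_bigr => i _; case: ltnP => // h.
by rewrite nth_default // rnorm0 mul0r.
Qed.

Let wtD c d : wt (c + d) <= wt c + wt d.
Proof.
pose n := maxn (size (c + d)) (maxn (size c) (size d)).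
rewrite !(@wt_widen n) ?leq_max ?leqnn ?orbT //.
rewrite -big_split /=; apply: ler_sum => i _.
by rewrite coefD -mulrDl ler_wpM2r ?q_ge0 ?polyOverXn // (rnormD (c`_i : K)).
Qed.

Let wtZ a c : wt (a *: c) = rnorm a * wt c.
Proof.
pose n := maxn (size (a *: c)) (size c).
rewrite !(@wt_widen n) ?leq_max ?leqnn ?orbT //.
rewrite mulr_sumr; apply: eq_bigr => i _.
by rewrite coefZ rnormM mulrA.
Qed.

Let wsn : seminorm {poly K} := Seminorm wtD wtZ.

Let q_le_wt d : d \is a D -> q d <= wt d.
Proof.
move=> Dd; rewrite -{1}[d]coefK poly_def /wt.
suff [] : (\sum_(i < size d) d`_i *: 'X^i) \is a D /\
  q (\sum_(i < size d) d`_i *: 'X^i) <= \sum_(i < size d) rnorm d`_i * q 'X^i by [].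
apply: (big_ind2 (fun x y => x \is a D /\ q x <= y)) => [|x1 x2 y1 y2 [D1 h1] [D2 h2]|i _].
- by rewrite rpred0 q0.
- by rewrite rpredD //; split=> //; apply: (le_trans (qD D1 D2)); exact: lerD.
- have di : d`_i \in @ratK R k by move/polyOverP: Dd.
  by rewrite polyOverZ ?polyOverXn // qZ ?polyOverXn.
Qed.

Let S c := [set q d + wt (c - d) | d in [set d | d \is a D]].

Let S_inf c : has_inf (S c).
Proof.
split; first by exists (q 0 + wt (c - 0)), 0; rewrite //= rpred0.
by exists 0 => _ [d Dd <-]; rewrite addr_ge0 ?q_ge0 // (sn_ge0 wsn).
Qed.

(* The extension is the infimal convolution of [q] and [wt]: it is dominated by
   both, and by the triangle inequality it does not go below [q]. *)
Let p c := inf (S c).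

Let p_le c d : d \is a D -> p c <= q d + wt (c - d).
Proof. by move=> Dd; apply: ge_inf; [exact: (S_inf c).2|exists d]. Qed.

Let p_adherent c e : 0 < e -> exists2 d, d \is a D & q d + wt (c - d) < p c + e.
Proof.
by move=> e0; have [_ [d Dd <-]] := inf_adherent e0 (S_inf c); exists d.
Qed.

Let p_ge0 c : 0 <= p c.
Proof.
apply: lb_le_inf; first exact: (S_inf c).1.
by move=> _ [d Dd <-]; rewrite addr_ge0 ?q_ge0 // (sn_ge0 wsn).
Qed.

Let pD c d : p (c + d) <= p c + p d.
Proof.
apply/ler_addgt0Pr => e e0; have e20 : 0 < e / 2 by rewrite divr_gt0.
have [c' Dc hc] := p_adherent c e20; have [d' Dd hd] := p_adherent d e20.
apply: (le_trans (p_le (c + d) (rpredD Dc Dd))).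
have := qD Dc Dd; have := wtD (c - c') (d - d').
by rewrite addrACA -opprD; lra.
Qed.

Let pZ_le a c : p (a *: c) <= rnorm a * p c.
Proof.
apply/ler_addgt0Pr => e e0.
have r0 : 0 <= rnorm a := rnorm_ge0 a.
have ra : 0 < rnorm a + 1 by rewrite ltr_wpDl.
have e20 : 0 < e / 2 by rewrite divr_gt0.
have e1 : 0 < e / 2 / (rnorm a + 1) by rewrite divr_gt0.
have [d Dd hd] := p_adherent c e1.
have [a' Da ha] := ratK_approxM a e20 (addr_ge0 (q_ge0 Dd) (sn_ge0 wsn d)).
have {}ha : rnorm (a - a') * (q d + wt d) < e / 2 := ha.
have Dad : a' *: d \is a D by rewrite polyOverZ.
apply: (le_trans (p_le _ Dad)).
have h1 : wt (a *: c - a' *: d) <= rnorm a * wt (c - d) + rnorm (a - a') * wt d.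
  rewrite -!wtZ; apply: le_trans (wtD _ _).
  by rewrite scalerBr scalerBl addrA subrK.
have h2 : q (a' *: d) <= (rnorm a + rnorm (a - a')) * q d.
  rewrite qZ // ler_wpM2r ?q_ge0 //.
  by have := @rnormD _ _ K a (a' - a); rewrite addrC subrK (@rnorm_distC _ _ K).
have h3 : rnorm a * (q d + wt (c - d)) <= rnorm a * p c + e / 2.
  apply: (@le_trans _ _ (rnorm a * (p c + e / 2 / (rnorm a + 1)))).
    by rewrite ler_wpM2l // ltW.
  rewrite mulrDr lerD2l mulrCA ler_piMr ?ltW // ltr_pdivrMr // mul1r.
  by rewrite ltrDl.
move: ha h1 h2 h3; rewrite !mulrDr !mulrDl; lra.
Qed.

Let pZ a c : p (a *: c) = rnorm a * p c.
Proof.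
apply/eqP; rewrite eq_le pZ_le /=; have [->|a0] := eqVneq a 0.
  by rewrite rnorm0 mul0r p_ge0.
have ra : 0 < rnorm a by rewrite lt_neqAle eq_sym rnorm_eq0 a0 rnorm_ge0.
have := pZ_le a^-1 (a *: c); rewrite scalerA mulVf // scale1r => h.
rewrite -ler_pdivlMl //; apply: (le_trans h).
rewrite ler_wpM2r ?p_ge0 // -(ler_pM2l ra) -rnormM divff // rnorm1 divff //.
by rewrite gt_eqF.
Qed.

(** A seminorm over the rational scalars is uniformly continuous on each
    finite-dimensional subspace, hence extends to all scalars. *)
Lemma seminorm_extension :
  exists p : seminorm {poly K}, forall d, d \is a D -> p d = q d.
Proof.
exists (Seminorm pD pZ) => d Dd /=; apply/eqP; rewrite eq_le; apply/andP; split.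
  by apply: (le_trans (p_le d Dd)); rewrite subrr (sn0 wsn : wt 0 = 0) addr0.
apply: lb_le_inf; first exact: (S_inf d).1.
move=> _ [c Dc <-]; have Ddc : d - c \is a D by rewrite rpredB.
by apply: (@le_trans _ _ (q c + q (d - c)));
  rewrite ?lerD2l ?q_le_wt // -{1}(subrK c d) addrC qD.
Qed.

End seminorm_extension.

Section bounded_extension.
Context {R : realType} {k : scalar_kind}.
Local Notation K := (scalar_field R k).
Local Notation D := (polyOver (@ratK R k)).
Variables (V W : normedModType K) (u : nat -> V) (v : nat -> W) (C : R).
Hypothesis W_complete :
  forall F : set_system W, ProperFilter F -> cauchy F -> cvg F.
Hypothesis C0 : 0 <= C.
Hypothesis u_dense : forall x (e : R), 0 < e ->
  exists2 d, d \is a D & rnorm (x - lincomb u d) < e.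
Hypothesis uvC : forall d, d \is a D -> rnorm (lincomb v d) <= C * rnorm (lincomb u d).

(* The closure of the graph of the map to be extended: uniqueness of values
   follows from the bound, existence from completeness. *)
Let graph (x : V) (w : W) := forall e : R, 0 < e ->
  exists d, [/\ d \is a D, rnorm (x - lincomb u d) < e & rnorm (w - lincomb v d) < e].

Let graph_ev d : d \is a D -> graph (lincomb u d) (lincomb v d).
Proof. by move=> Dd e e0; exists d; rewrite !subrr !rnorm0. Qed.

Let graph_bound x w : graph x w -> rnorm w <= C * rnorm x.
Proof.
move=> g; apply/ler_addgt0Pr => e e0; have C1 : 0 < C + 1 by rewrite ltr_wpDl.
have [d [Dd hx hw]] := g _ (divr_gt0 e0 C1).
have h1 := ler_rnormB w (lincomb v d); have h2 := ler_rnormB x (lincomb u d).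
have := uvC Dd; have : rnorm (lincomb u d) <= rnorm x + e / (C + 1).
  by move: h2; rewrite ler_norml; lra.
move=> /(ler_wpM2l C0); have : e / (C + 1) * (C + 1) = e.
  by rewrite mulfVK // gt_eqF.
by move: h1; rewrite ler_norml !mulrDr mulr1 [C * (_ / _)]mulrC; lra.
Qed.

Let graph_lin a x w x' w' : graph x w -> graph x' w' ->
  graph (a *: x + x') (a *: w + w').
Proof.
move=> g g' e e0; have e20 : 0 < e / 2 by rewrite divr_gt0.
have e40 : 0 < e / 2 / 2 by rewrite divr_gt0.
have ra : 0 < rnorm a + 1 by rewrite ltr_wpDl ?rnorm_ge0.
have [d' [Dd' hx' hw']] := g' _ e20.
have [d [Dd hx hw]] := g _ (divr_gt0 e40 ra).
have [a' Da ha] := ratK_approxM a e40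
  (addr_ge0 (rnorm_ge0 (lincomb u d)) (rnorm_ge0 (lincomb v d))).
exists (a' *: d + d'); split; first by rewrite rpredD // polyOverZ.
  rewrite linearP /= opprD addrACA [e]splitr.
  apply: (le_lt_trans (rnormD _ _)); apply: ltrD => //.
  rewrite -(subrKA (a *: lincomb u d)) [e / 2]splitr.
  apply: (le_lt_trans (rnormD _ _)); rewrite -scalerBr -scalerBl !rnormZ.
  apply: ltrD; last by apply: le_lt_trans ha; rewrite ler_wpM2l ?rnorm_ge0 // lerDl rnorm_ge0.
  by rewrite mulrC; apply: mul_lt_of_lt_div => //; exact: rnorm_ge0.
rewrite linearP /= opprD addrACA [e]splitr.
apply: (le_lt_trans (rnormD _ _)); apply: ltrD => //.
rewrite -(subrKA (a *: lincomb v d)) [e / 2]splitr.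
apply: (le_lt_trans (rnormD _ _)); rewrite -scalerBr -scalerBl !rnormZ.
apply: ltrD; last by apply: le_lt_trans ha; rewrite ler_wpM2l ?rnorm_ge0 // lerDr rnorm_ge0.
by rewrite mulrC; apply: mul_lt_of_lt_div => //; exact: rnorm_ge0.
Qed.

Let graph_fun x w w' : graph x w -> graph x w' -> w = w'.
Proof.
move=> g g'; apply/eqP; rewrite -subr_eq0 -rnorm_eq0 eq_le rnorm_ge0 andbT.
have := graph_bound (graph_lin (-1) g' g).
by rewrite !scaleN1r addNr rnorm0 mulr0 addrC.
Qed.

Let graph_total x : exists w, graph x w.
Proof.
have hd n : exists d, d \is a D /\ rnorm (x - lincomb u d) < half_pow n.
  by have [d] := u_dense x (half_pow_gt0 n); exists d.
have [d hd'] := choice hd.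
have C2 : 0 < C + C + 1 by rewrite ltr_wpDl // addr_ge0.
have [w cw] : exists w : W, lincomb v (d n) @[n --> \oo] --> w.
  apply: (cauchy_seq_cvg W_complete) => e e0.
  have [N hN] := half_pow_lt (divr_gt0 e0 C2); exists N => n Nn.
  have [DN hN'] := hd' N; have [Dn hn] := hd' n.
  rewrite -linearB /=; apply: (le_lt_trans (uvC (rpredB DN Dn))).
  rewrite linearB /=; apply: (@le_lt_trans _ _ (C * (half_pow N + half_pow N))).
    rewrite ler_wpM2l //; apply: (le_trans (rnorm_triang x _ _)).
    apply: lerD; first by rewrite rnorm_distC ltW.
    by rewrite ltW // (lt_le_trans hn) // half_pow_le.
  have := half_pow_gt0 (R := R) N; move: hN; rewrite ltr_pdivlMr //.
  by rewrite !mulrDr; lra.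
exists w => e e0; have [N hN] := half_pow_lt e0.
have /cvgr0Pnorm_lt /(_ e e0)[M _ hM] := (cvg_rnorm0 _ w).1 cw.
pose n := maxn N M; have [Dn hn] := hd' n.
exists (d n); split=> //.
  by apply: (lt_trans hn); apply: le_lt_trans hN; rewrite half_pow_le ?leq_maxl.
rewrite rnorm_distC -[ltLHS]ger0_norm ?rnorm_ge0 //.
by apply: hM; rewrite /= leq_maxr.
Qed.

Lemma bounded_extension : exists L : V -> W, [/\ linear L,
  forall x, rnorm (L x) <= C * rnorm x &
  forall d, d \is a D -> L (lincomb u d) = lincomb v d].
Proof.
have [L hL] := choice graph_total; exists L; split=> [a x y|x|d Dd].
- by apply: graph_fun (hL _) _; exact: graph_lin.
- exact: graph_bound.
- by apply: graph_fun (hL _) _; exact: graph_ev.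
Qed.

End bounded_extension.

(** * The Hausdorff completion of a seminormed space *)

Section completion.
Context {R : realType} {k : scalar_kind}.
Local Notation K := (scalar_field R k).
Variables (V : lmodType K) (p : seminorm V).
Implicit Types s t : nat -> V.

Definition cauchy_seq : {pred (nat -> V)} := [pred s : nat -> V |
  `[< forall e : R, 0 < e -> exists N, forall n m, (N <= n)%N -> (N <= m)%N ->
        p (s n - s m) < e >]].

Lemma cauchy_seqP s : reflect (forall e : R, 0 < e -> exists N, forall n m,
  (N <= n)%N -> (N <= m)%N -> p (s n - s m) < e) (s \in cauchy_seq).
Proof. exact: asboolP. Qed.

Lemma cauchy_seq_submod : submod_closed cauchy_seq.
Proof.
split=> [|a s t /cauchy_seqP hs /cauchy_seqP ht]; apply/cauchy_seqP => e e0.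
  by exists 0%N => n m _ _; rewrite -[X in p X]/(0 - 0 : V) subrr sn0.
have e20 : 0 < e / 2 by rewrite divr_gt0.
have ra : 0 < rnorm a + 1 by rewrite ltr_wpDl ?rnorm_ge0.
have [N hN] := hs _ (divr_gt0 e20 ra); have [M hM] := ht _ e20.
exists (maxn N M) => n m; rewrite !geq_max => /andP[n1 n2] /andP[m1 m2].
rewrite -[X in p X]/(a *: s n + t n - (a *: s m + t m)) opprD addrACA [e]splitr.
apply: (le_lt_trans (snD _ _ _)); apply: ltrD; last exact: hM.
rewrite -scalerBr snZ mulrC; apply: mul_lt_of_lt_div; rewrite ?rnorm_ge0 ?sn_ge0 //.
exact: hN.
Qed.

HB.instance Definition _ := GRing.isSubmodClosed.Build K (nat -> V)
  cauchy_seq cauchy_seq_submod.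

Record cseq := CSeq { cval : nat -> V; cvalP : cval \in cauchy_seq }.

HB.instance Definition _ := [isSub for cval].
HB.instance Definition _ := [Choice of cseq by <:].
HB.instance Definition _ := [SubChoice_isSubLmodule of cseq by <:].

Definition null_seq : {pred cseq} := [pred c : cseq |
  `[< p (cval c n) @[n --> \oo] --> (0 : R) >]].

Lemma null_seqP c : reflect (p (cval c n) @[n --> \oo] --> (0 : R)) (c \in null_seq).
Proof. exact: asboolP. Qed.

Lemma null_seq_submod : submod_closed null_seq.
Proof.
split=> [|a c c' /null_seqP h /null_seqP h']; apply/null_seqP.
  rewrite (_ : (fun n => _) = cst 0); first exact: cvg_cst.
  by apply/funext => n; rewrite -[cval _ n]/(0 : V) sn0.
have h0 : rnorm a * p (cval c n) + p (cval c' n) @[n --> \oo] --> (0 : R).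
  rewrite -[X in _ --> X]addr0 -[X in _ --> X + _](mulr0 (rnorm a)).
  by apply: cvgD => //; apply: cvgM => //; exact: cvg_cst.
apply: squeeze_cvgr h0; last exact: cvg_cst.
apply: nearW => n; rewrite sn_ge0 /= -snZ.
exact: (snD p (a *: cval c n) (cval c' n)).
Qed.

HB.instance Definition _ := GRing.isSubmodClosed.Build K cseq
  null_seq null_seq_submod.

Definition completion : Type := Quotient.quot null_seq.

HB.instance Definition _ := GRing.Zmodule.on completion.
HB.instance Definition _ := EqQuotient.on completion.

Lemma completion_piP (c c' : cseq) : \pi_completion c = \pi_completion c' <->
  p (cval c n - cval c' n) @[n --> \oo] --> (0 : R).
Proof.
have -> : (p (cval c n - cval c' n) @[n --> \oo] --> (0 : R)) <->
    (c - c' \in null_seq).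
  by split=> [h|/null_seqP]; [apply/null_seqP|].
by rewrite Quotient.idealrBE; split=> [->|/eqP].
Qed.

Definition completion_repr (x : completion) : nat -> V := cval (repr x).

Lemma completion_repr_pi (c : cseq) :
  p (completion_repr (\pi_completion c) n - cval c n) @[n --> \oo] --> (0 : R).
Proof. by apply/completion_piP; rewrite reprK. Qed.

Definition completion_scale (a : K) (x : completion) : completion :=
  \pi_completion (a *: repr x).

Lemma completion_scale_pi a (c : cseq) :
  completion_scale a (\pi_completion c) = \pi_completion (a *: c).
Proof.
apply/completion_piP; have := completion_repr_pi c => h.
rewrite (_ : (fun n => _) =
  fun n => rnorm a * p (completion_repr (\pi_completion c) n - cval c n)).
  rewrite -[X in _ --> X](mulr0 (rnorm a)).
  by apply: cvgM => //; exact: cvg_cst.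
by apply/funext => n; rewrite -snZ scalerBr.
Qed.

Let scaleA a b x : completion_scale a (completion_scale b x) = completion_scale (a * b) x.
Proof. by rewrite -[x]reprK !completion_scale_pi scalerA reprK. Qed.

Let scale1 : left_id 1 completion_scale.
Proof. by move=> x; rewrite -[x]reprK !completion_scale_pi scale1r. Qed.

Let piD (c c' : cseq) : \pi_completion (c + c') = \pi_completion c + \pi_completion c'.
Proof. by rewrite raddfD. Qed.

Let scaleDr : right_distributive completion_scale +%R.
Proof.
move=> a x y; rewrite -[x]reprK -[y]reprK -piD !completion_scale_pi.
by rewrite -piD scalerDr.
Qed.

Let scaleDl x : {morph completion_scale^~ x : a b / a + b}.
Proof.
by move=> a b; rewrite -[x]reprK !completion_scale_pi -piD scalerDl.
Qed.

HB.instance Definition _ := GRing.Zmodule_isLmodule.Build K completion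
  scaleA scale1 scaleDr scaleDl.

Lemma completion_piZ a c : \pi_completion (a *: c) = a *: \pi_completion c.
Proof. by rewrite -completion_scale_pi. Qed.

(** The seminorms along a Cauchy sequence form a Cauchy sequence of reals, so the
    norm on the completion can be defined as their limit. *)
Lemma cseq_norm_cvg (c : cseq) : exists r : R, p (cval c n) @[n --> \oo] --> r.
Proof.
apply: (@cauchy_seq_cvg R RealScalars R^o) => [F FF|e e0].
  exact: (@cauchy_cvg (R : completeType)).
have [N hN] := cauchy_seqP _ (cvalP c) e e0; exists N => n Nn.
by apply: (le_lt_trans (sn_dist _ _ _)); exact: hN.
Qed.

Definition completion_norm (x : completion) : R :=
  lim (p (completion_repr x n) @[n --> \oo]).

Lemma completion_norm_pi (c : cseq) :
  p (cval c n) @[n --> \oo] --> completion_norm (\pi_completion c).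
Proof.
have [r hr] := cseq_norm_cvg c.
have hr' : p (completion_repr (\pi_completion c) n) @[n --> \oo] --> r.
  have h : p (cval c n) - p (completion_repr (\pi_completion c) n - cval c n)
      @[n --> \oo] --> r.
    by rewrite -[r]subr0; apply: cvgB => //; exact: completion_repr_pi.
  have h' : p (cval c n) + p (completion_repr (\pi_completion c) n - cval c n)
      @[n --> \oo] --> r.
    by rewrite -[r]addr0; apply: cvgD => //; exact: completion_repr_pi.
  apply: squeeze_cvgr h h'; apply: nearW => n.
  by rewrite -ler_distl; exact: sn_dist.
by rewrite /completion_norm (cvg_lim _ hr').
Qed.

Arguments completion_norm_pi : clear implicits.


Lemma completion_ler_normD x y :
  emb (completion_norm (x + y)) <= emb (completion_norm x) + emb (completion_norm y) :> K.
Proof.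
rewrite -embD ler_emb -[x]reprK -[y]reprK -piD.
apply: (ler_cvg_to (completion_norm_pi (repr x + repr y)) (cvgD _ _));
  [exact: (completion_norm_pi (repr x))|exact: (completion_norm_pi (repr y))|].
apply: nearW => n; exact: (snD p (cval (repr x) n) (cval (repr y) n)).
Qed.

Lemma completion_normZ (a : K) x :
  emb (completion_norm (a *: x)) = `|a| * emb (completion_norm x) :> K.
Proof.
rewrite -rnormE -embM; congr emb; rewrite -[x]reprK -completion_piZ.
apply: (cvg_unique _ (completion_norm_pi (a *: repr x))) => //.
rewrite (_ : (fun n => _) = fun n => rnorm a * p (cval (repr x) n)).
  by apply: cvgM; [exact: cvg_cst|exact: completion_norm_pi].
by apply/funext => n; rewrite -snZ.
Qed.

Lemma completion_norm0_eq0 x : emb (completion_norm x) = 0 :> K -> x = 0.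
Proof.
rewrite -(@emb0 R k) => /emb_inj; rewrite -[x]reprK => n0.
have -> : 0 = \pi_completion 0 :> completion by rewrite raddf0.
apply/completion_piP; rewrite -n0.
rewrite (_ : (fun n => _) = fun n => p (cval (repr x) n)).
  exact: completion_norm_pi.
by apply/funext => n; congr (p _); exact: subr0.
Qed.

HB.instance Definition _ := @Lmodule_isNormed.Build K completion
  (fun x => emb (completion_norm x)) completion_ler_normD completion_normZ
  completion_norm0_eq0.

Lemma rnorm_completion (x : completion) : rnorm x = completion_norm x.
Proof. exact: re_emb. Qed.

Lemma cst_cauchy_seq v : (fun=> v) \in cauchy_seq.
Proof. by apply/cauchy_seqP => e e0; exists 0%N => n m _ _; rewrite subrr sn0. Qed.

Definition completion_inj (v : V) : completion :=
  \pi_completion (CSeq (cst_cauchy_seq v)).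

Lemma completion_inj_linear : linear completion_inj.
Proof.
move=> a v w; rewrite /completion_inj -completion_piZ -piD.
by congr (\pi_completion _); apply: val_inj.
Qed.

HB.instance Definition _ := GRing.isLinear.Build K V completion *:%R
  completion_inj completion_inj_linear.

Lemma completion_inj_norm v : rnorm (completion_inj v) = p v.
Proof.
rewrite rnorm_completion.
have h : p (cval (CSeq (cst_cauchy_seq v)) n) @[n --> \oo] --> p v.
  exact: (@cvg_cst _ (p v)).
exact: (cvg_unique _ (completion_norm_pi _) h).
Qed.

Lemma completion_seq_approx (c : cseq) (e : R) : 0 < e ->
  exists N, forall n, (N <= n)%N ->
    rnorm (\pi_completion c - completion_inj (cval c n)) <= e.
Proof.
move=> e0; have [N hN] := cauchy_seqP _ (cvalP c) e e0; exists N => n Nn.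
have -> : \pi_completion c - completion_inj (cval c n) =
    \pi_completion (c - CSeq (cst_cauchy_seq (cval c n))) by rewrite raddfB.
rewrite rnorm_completion.
apply: ler_cvg_to (completion_norm_pi _) (cvg_cst e) _.
by exists N => // m Nm; apply/ltW/hN.
Qed.

Lemma completion_inj_approx (x : completion) (e : R) : 0 < e ->
  exists v, rnorm (x - completion_inj v) < e.
Proof.
move=> e0; have e20 : 0 < e / 2 by rewrite divr_gt0.
have [N hN] := completion_seq_approx (repr x) e20.
exists (cval (repr x) N); move: (hN N (leqnn N)); rewrite reprK => h.
by apply: (le_lt_trans h); rewrite ltr_pdivrMr // ltr_pMr // ltr1n.
Qed.

Lemma completion_complete (F : set_system completion) :
  ProperFilter F -> cauchy F -> cvg F.
Proof.
apply: complete_of_rapid F => u hu.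
have [v hv] := choice (fun n => completion_inj_approx (u n) (@half_pow_gt0 R n)).
have hle n m : (n <= m)%N -> p (v n - v m) <= 4 * half_pow n.
  move=> nm; rewrite -completion_inj_norm linearB.
  exact: (rapid_perturb hu hv nm).
have hp n : 0 < half_pow n :> R := half_pow_gt0 n.
have vC : v \in cauchy_seq.
  apply/cauchy_seqP => e e0; have e8 : 0 < e / 8 by rewrite divr_gt0.
  have [N hN] := half_pow_lt e8; exists N => n m Nn Nm.
  have h1 := hle _ _ Nn; have h2 := hle _ _ Nm; have h3 := sn_triang p (v n) (v N) (v m).
  move: h1; rewrite sn_distC => h1; have := hp N; lra.
exists (\pi_completion (CSeq vC)); apply: (cvg_perturb hv) => e e0.
exact: completion_seq_approx (CSeq vC) e e0.
Qed.

HB.instance Definition _ := Uniform_isComplete.Build completion completion_complete.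

End completion.

(** * Essentially bounded scalar functions *)

Section scalar_functions.
Context {R : realType} {k : scalar_kind}.
Context {d : measure_display} {Omega : measurableType d}.
Context {mu : {measure set Omega -> \bar R}}.
Local Notation K := (scalar_field R k).
Implicit Types f g : Omega -> K.

Lemma im_emb (a : R) : im (emb a : K) = 0.
Proof. by rewrite /im /emb; case: k. Qed.

Lemma kmeasurable_emb (h : Omega -> R) : measurable_fun setT h ->
  kmeasurable (fun x => emb (h x) : K).
Proof.
move=> mh; split.
  by rewrite (_ : _ \o _ = h) //; apply/funext => x /=; rewrite re_emb.
rewrite (_ : _ \o _ = cst 0); first exact: measurable_cst.
by apply/funext => x /=; rewrite im_emb.
Qed.

Lemma kmeasurable_cst (a : K) : kmeasurable (fun _ : Omega => a : K).
Proof. by split; exact: measurable_cst. Qed.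

Lemma kmeasurableB f g : kmeasurable f -> kmeasurable g ->
  kmeasurable (fun x => f x - g x).
Proof.
move=> [rf jf] [rg jg]; split.
  rewrite (_ : _ \o _ = fun x => re (f x) - re (g x)).
    exact: (measurable_funB rf rg).
  by apply/funext => x /=; rewrite reB.
rewrite (_ : _ \o _ = fun x => im (f x) - im (g x)).
  exact: (measurable_funB jf jg).
by apply/funext => x /=; rewrite imB.
Qed.

Lemma kmeasurableM f g : kmeasurable f -> kmeasurable g ->
  kmeasurable (fun x => f x * g x).
Proof.
move=> [rf jf] [rg jg]; split.
  rewrite (_ : _ \o _ = fun x => re (f x) * re (g x) - im (f x) * im (g x)).
    by apply: measurable_funB; apply: measurable_funM.
  by apply/funext => x /=; rewrite reM.
rewrite (_ : _ \o _ = fun x => re (f x) * im (g x) + im (f x) * re (g x)).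
  by apply: measurable_funD; apply: measurable_funM.
by apply/funext => x /=; rewrite imM.
Qed.

Lemma kmeasurable_comp f (h : Omega -> Omega) : measurable_fun setT h ->
  kmeasurable f -> kmeasurable (f \o h).
Proof.
move=> mh [rf jf]; split.
  exact: (measurableT_comp rf mh).
exact: (measurableT_comp jf mh).
Qed.

Lemma Linf_norm_le f (C : R) : 0 <= C -> (\forall x \ae mu, rnorm (f x) <= C) ->
  (Linf_norm mu f <= C%:E)%E.
Proof.
move=> C0 h; rewrite /Linf_norm unlock /Lnorm; case: ifPn => _; last by rewrite lee_fin.
apply/ess_supP; apply: filterS h => x h.
by rewrite /= ger0_norm ?rnorm_ge0 // lee_fin.
Qed.

Lemma Linf_norm_ge f : \forall x \ae mu, ((rnorm (f x))%:E <= Linf_norm mu f)%E.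
Proof.
rewrite /Linf_norm unlock /Lnorm; case: ifPn => [mu0|].
  apply: filterS (ess_sup_ge mu (abse \o (fun x => (rnorm (f x))%:E))) => x.
  by rewrite /= ger0_norm ?rnorm_ge0.
rewrite -leNgt measure_le0 => /eqP mu0; exact: measure0_ae.
Qed.

Lemma Linf_of_bound f (C : R) : kmeasurable f ->
  (\forall x \ae mu, rnorm (f x) <= C) -> Linf mu f.
Proof.
move=> mf h; split=> //; apply: (@le_lt_trans _ _ `|C|%:E); last exact: ltry.
apply: Linf_norm_le => //; apply: filterS h => x h.
exact: le_trans h (ler_norm _).
Qed.

Lemma Linf_cst (a : K) : Linf mu (fun=> a : K).
Proof.
by apply: (@Linf_of_bound _ (rnorm a)); [exact: kmeasurable_cst|exact: aeW].
Qed.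

Lemma LinfB f g : Linf mu f -> Linf mu g -> Linf mu (fun x => f x - g x).
Proof.
move=> Lf Lg; have [C _ hC] := Linf_bound Lf; have [C' _ hC'] := Linf_bound Lg.
apply: (@Linf_of_bound _ (C + C')).
  by apply: kmeasurableB; [exact: Lf.1|exact: Lg.1].
apply: filterS2 hC hC' => x h h'; rewrite (le_trans (rnormD _ _)) // rnormN.
exact: lerD.
Qed.

Lemma LinfM f g : Linf mu f -> Linf mu g -> Linf mu (fun x => f x * g x).
Proof.
move=> Lf Lg; have [C _ hC] := Linf_bound Lf; have [C' _ hC'] := Linf_bound Lg.
apply: (@Linf_of_bound _ (C * C')).
  by apply: kmeasurableM; [exact: Lf.1|exact: Lg.1].
apply: filterS2 hC hC' => x h h'; rewrite rnormM.
by apply: ler_pM => //; exact: rnorm_ge0.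
Qed.

Lemma LinfD f g : Linf mu f -> Linf mu g -> Linf mu (fun x => f x + g x).
Proof.
move=> Lf Lg; rewrite (_ : (fun x => _) = fun x => f x - (-1 * g x)).
  by apply: LinfB => //; apply: LinfM => //; exact: Linf_cst.
by apply/funext => x; rewrite mulN1r opprK.
Qed.

Definition kindic (A : set Omega) : Omega -> K := fun x => emb (\1_A x).

Lemma rnorm_kindic A x : rnorm (kindic A x) = \1_A x.
Proof. by rewrite rnorm_emb // indicE; case: (_ \in _). Qed.

Lemma kindic1 (A : set Omega) x : A x -> kindic A x = 1.
Proof.
move=> Ax; rewrite /kindic indicE mem_set //; apply: re_im_inj.
  by rewrite re_emb re1.
by rewrite im_emb im1.
Qed.

Lemma kindic0 (A : set Omega) x : ~ A x -> kindic A x = 0.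
Proof. by move=> Ax; rewrite /kindic indicE memNset // emb0. Qed.

Lemma Linf_kindic (A : set Omega) : measurable A -> Linf mu (kindic A).
Proof.
move=> mA; apply: (@Linf_of_bound _ 1).
  by apply: kmeasurable_emb; exact: measurable_indic.
apply: aeW => x; rewrite rnorm_kindic indicE.
by case: (_ \in _).
Qed.

Section composition.
Variable psi' : Omega -> Omega.
Hypothesis mpsi' : measurable_fun setT psi'.
Hypothesis ppsi' : forall A, measurable A -> mu (psi' @^-1` A) = mu A.

Lemma Linf_comp f : Linf mu f -> Linf mu (f \o psi').
Proof.
move=> Lf; have [C _ hC] := Linf_bound Lf; apply: (@Linf_of_bound _ C).
  by apply: kmeasurable_comp => //; exact: Lf.1.
exact: (ae_preimage mpsi' ppsi' hC).
Qed.

Lemma mp_integral (h : Omega -> \bar R) : measurable_fun setT h ->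
  (forall x, 0 <= h x)%E -> (\int[mu]_x h (psi' x) = \int[mu]_x h x)%E.
Proof.
move=> mh h0.
have <- : (\int[pushforward mu psi']_x h x = \int[mu]_x h (psi' x))%E.
  by rewrite ge0_integral_pushforward.
pose f : {mfun Omega >-> Omega} :=
  HB.pack psi' (isMeasurableFun.Build _ _ _ _ _ mpsi').
rewrite (@eq_measure_integral _ _ _ setT mu (pushforward mu f)) //.
by move=> A mA _; rewrite -[RHS]ppsi'.
Qed.

End composition.

(** Countably many constants approximate every scalar; the sets where a function
    is near one of them cover the space. *)
Lemma ratK_enum : exists g : nat -> K, forall z (e : R), 0 < e ->
  exists n, rnorm (z - g n) < e.
Proof.
exists (fun n => (rat_poly n : {poly K})`_0) => z e /(ratK_approx z)[w Dw hw].
have : w%:P \is a polyOver (@ratK R k) by rewrite polyOverC.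
by move=> /rat_polyP[n hn]; exists n; rewrite -hn coefC.
Qed.

End scalar_functions.

(** * Banach modules with a pointwise norm *)

Section L1_normed_modules.
Context {R : realType} {k : scalar_kind}.
Context {d : measure_display} {Omega : measurableType d}.
Context {mu : {measure set Omega -> \bar R}}.
Context {G : groupType} {S : umagmaClosed G}.
Local Notation K := (scalar_field R k).

Section one_module.
Variable M : @dyn_module_data R k d Omega G S.
Hypothesis bM : is_banach_module (mu := mu) M.
Hypothesis nM : is_L1_normed (mu := mu) M.
Implicit Types (s t : M) (f : Omega -> K).

(** By continuity from the sums of elements [f s], which are dense because the
    module is non-degenerate; on them the claim is associativity. *)
Lemma act_1 s : dm_act (fun=> 1) s = s.
Proof.
have L1 := @Linf_cst R k d Omega mu 1.
apply/eqP; rewrite -subr_eq0 -rnorm_eq0 eq_le rnorm_ge0 andbT.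
apply/ler_addgt0Pr => e e0; rewrite add0r.
have e20 : 0 < e / 2 by rewrite divr_gt0.
have [v hv vs] := (dense_rnormP _).1 (bm_nondegenerate bM) s _ e20.
have {hv} hv : dm_act (fun=> 1) v = v.
  case: hv => n [c [a [ha ->]]].
  rewrite (linear_sumE (bm_linear bM L1)); apply: eq_bigr => i _.
  rewrite (linear_scaleE (bm_linear bM L1)); have [f [t [Lf ->]]] := ha i.
  rewrite -(bm_mul bM) //; congr (_ *: dm_act _ _).
  by apply/funext => x; rewrite mul1r.
have h : rnorm (dm_act (fun=> 1) (s - v)) <= rnorm (s - v).
  rewrite -lee_fin; apply: (le_trans (bm_norm bM _ L1)).
  rewrite -[leRHS]mul1e lee_wpmul2r ?lee_fin ?rnorm_ge0 //.
  by apply: Linf_norm_le => //; apply: aeW => x; rewrite rnorm1.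
have hB : dm_act (fun=> 1) (s - v) = dm_act (fun=> 1) s - v.
  by rewrite (linear_subE (bm_linear bM L1)) hv.
rewrite hB in h; apply: (le_trans (rnorm_triang v _ _)).
rewrite [rnorm (v - s)]rnorm_distC; lra.
Qed.

Lemma act_cst a s : dm_act (fun=> a) s = a *: s.
Proof.
rewrite -[in RHS](act_1 s) -(bm_scalel bM) //; last exact: Linf_cst.
by congr dm_act; apply/funext => x; rewrite mulr1.
Qed.

Lemma act_subl f g s : Linf mu f -> Linf mu g ->
  dm_act (fun x => f x - g x) s = dm_act f s - dm_act g s.
Proof.
move=> Lf Lg; rewrite -scaleN1r -(bm_scalel bM) // -(bm_addl bM) //.
  by congr dm_act; apply/funext => x; rewrite mulN1r.
by apply: LinfM => //; exact: Linf_cst.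
Qed.

Lemma pnorm_scale a s : \forall x \ae mu,
  dm_pnorm (a *: s) x = rnorm a * dm_pnorm s x.
Proof. by rewrite -act_cst; exact: (pn_act nM s (Linf_cst a)). Qed.

Lemma pnorm_opp s : \forall x \ae mu, dm_pnorm (- s) x = dm_pnorm s x.
Proof.
rewrite -scaleN1r; apply: filterS (pnorm_scale (-1) s) => x ->.
by rewrite rnormN rnorm1 mul1r.
Qed.

Lemma pnorm_dist s t : \forall x \ae mu,
  `|dm_pnorm s x - dm_pnorm t x| <= dm_pnorm (s - t) x.
Proof.
have h1 := pn_triangle nM (s - t) t; have h2 := pn_triangle nM (t - s) s.
have h3 := pnorm_opp (s - t).
apply: filterS3 h1 h2 h3 => x; rewrite !subrK opprB => h1 h2 h3.
by rewrite ler_norml; apply/andP; split; lra.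
Qed.

Lemma measurable_pnorm s : measurable_fun setT (dm_pnorm s).
Proof. exact/measurable_EFinP/(measurable_int mu)/pn_integrable. Qed.

Lemma pnorm_eq0 s : (\forall x \ae mu, dm_pnorm s x = 0) -> s = 0.
Proof.
move=> h; apply/eqP; rewrite -rnorm_eq0 -(inj_eq (@EFin_inj R)) -(pn_norm nM).
rewrite -[X in _ == X](integral0 mu setT); apply/eqP; apply: ae_eq_integral => //.
- exact/measurable_EFinP/measurable_pnorm.
- by apply: filterS h => x -> _.
Qed.

Lemma norm_truncation (A : set Omega) s : measurable A ->
  (rnorm (dm_act (kindic A) s))%:E = (\int[mu]_(x in A) (dm_pnorm s x)%:E)%E.
Proof.
move=> mA; rewrite -(pn_norm nM) [RHS]integral_mkcond.
apply: ae_eq_integral => //.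
- exact/measurable_EFinP/measurable_pnorm.
- apply/(measurable_restrictT _ mA).
  by apply: measurable_funTS; exact/measurable_EFinP/measurable_pnorm.
apply: filterS (pn_act nM s (Linf_kindic mA)) => x -> _.
rewrite rnorm_kindic patchE indicE.
by case: (_ \in _); rewrite ?mul1r ?mul0r.
Qed.

End one_module.
End L1_normed_modules.

(** * Pointwise estimates for module maps *)

Section ae_comparison.
Context {R : realType} {d : measure_display} {Omega : measurableType d}.
Variable mu : {measure set Omega -> \bar R}.

Lemma indic_preimage (psi : Omega -> Omega) (A : set Omega) x :
  \1_(psi @^-1` A) x = \1_A (psi x) :> R.
Proof.
by rewrite !indicE; congr (nat_of_bool _)%:R; apply/idP/idP; rewrite !inE.
Qed.

Lemma measurable_ltset (f g : Omega -> R) : measurable_fun setT f ->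
  measurable_fun setT g -> measurable [set x | f x < g x].
Proof.
move=> /measurable_EFinP mf /measurable_EFinP mg.
have := measurable_lte measurableT mf mg; rewrite setTI.
by congr measurable; apply/seteqP; split=> x /=; rewrite lte_fin.
Qed.

(** The premise on the set where [g] is below [f] forces the integral of [f - g]
    over that set to vanish. *)
Lemma ae_le_of_integral (f g : Omega -> R) :
  mu.-integrable setT (EFin \o f) -> mu.-integrable setT (EFin \o g) ->
  (forall A, measurable A ->
     (\int[mu]_(x in A) (f x)%:E <= \int[mu]_(x in A) (g x)%:E)%E) ->
  \forall x \ae mu, f x <= g x.
Proof.
move=> jf jg h.
have mf : measurable_fun setT f by apply/measurable_EFinP/(measurable_int mu).
have mg : measurable_fun setT g by apply/measurable_EFinP/(measurable_int mu).
pose A := [set x | g x < f x].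
have mA : measurable A.
  exact: measurable_ltset.
have jfA : mu.-integrable A (EFin \o f) by apply: integrableS jf.
have jgA : mu.-integrable A (EFin \o g) by apply: integrableS jg.
have hA : (\int[mu]_(x in A) `|(f x)%:E - (g x)%:E| = 0)%E.
  apply/eqP; rewrite eq_le; apply/andP; split; last exact: integral_ge0.
  rewrite (_ : (\int[mu]_(x in A) _)%E = (\int[mu]_(x in A) ((f x)%:E - (g x)%:E))%E).
    rewrite (integralB mA jfA jgA) sube_le0; exact: h.
  apply: eq_integral => x; rewrite inE => Ax.
  by rewrite gee0_abs // -EFinB lee_fin subr_ge0 ltW.
have mfg : measurable_fun A (fun x => ((f x)%:E - (g x)%:E)%E).
  apply: measurable_funTS; apply: emeasurable_funB; exact/measurable_EFinP.
move/(ae_eq_integral_abs mu mA mfg): hA; apply: filterS => x hx.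
rewrite leNgt; apply/negP => Ax; have /= := hx Ax.
by rewrite -EFinB => -[] /eqP; rewrite subr_eq0 gt_eqF.
Qed.

End ae_comparison.

Section module_maps.
Context {R : realType} {k : scalar_kind}.
Context {d : measure_display} {Omega : measurableType d}.
Context {mu : {measure set Omega -> \bar R}}.
Context {G : groupType} {S : umagmaClosed G}.
Local Notation K := (scalar_field R k).

Lemma norm_truncation_abs (M : @dyn_module_data R k d Omega G S)
    (nM : is_L1_normed (mu := mu) M) (A : set Omega) (s : M) : measurable A ->
  (rnorm (dm_act (kindic A) s))%:E = (\int[mu]_x (\1_A x * `|dm_pnorm s x|)%:E)%E.
Proof.
move=> mA; rewrite (norm_truncation nM _ mA) integral_mkcond.
apply: ae_eq_integral => //.
- apply/(measurable_restrictT _ mA).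
  by apply: measurable_funTS; exact/measurable_EFinP/(measurable_pnorm nM).
- apply/measurable_EFinP; apply: measurable_funM; first exact: measurable_indic.
  by apply: measurableT_comp => //; exact: measurable_pnorm nM s.
apply: filterS (pn_ge0 nM s) => x s0 _.
by rewrite patchE indicE; case: (_ \in _); rewrite ?mul1r ?mul0r ?ger0_norm.
Qed.

Variables M N : @dyn_module_data R k d Omega G S.
Hypothesis bM : is_banach_module (mu := mu) M.
Hypothesis bN : is_banach_module (mu := mu) N.
Hypothesis nM : is_L1_normed (mu := mu) M.
Hypothesis nN : is_L1_normed (mu := mu) N.

(** Replacing [f] by [f - z] with [z] constant leaves the defect
    [J (f s) - f (J s)] unchanged, and the pointwise bound makes it small where [f]
    is close to [z].  Countably many [z] are enough. *)
Lemma local_linear_act (J : M -> N) (C : R) : linear J ->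
  (forall s, \forall x \ae mu, dm_pnorm (J s) x <= C * dm_pnorm s x) ->
  forall f s, Linf mu f -> J (dm_act f s) = dm_act f (J s).
Proof.
move=> lJ hJ f s Lf; have [g hg] := @ratK_enum R k.
apply/eqP; rewrite -subr_eq0; apply/eqP/(pnorm_eq0 nN).
have hn n : \forall x \ae mu,
    dm_pnorm (J (dm_act f s) - dm_act f (J s)) x <=
    rnorm (f x - g n) * (C * dm_pnorm s x + dm_pnorm (J s) x).
  pose h : Omega -> K := fun x => f x - g n.
  have Lh : Linf mu h by apply: LinfB => //; exact: Linf_cst.
  have eJ : J (dm_act f s) - dm_act f (J s) =
            J (dm_act h s) - dm_act h (J s).
    rewrite (act_subl bM) ?(act_subl bN) //; try exact: Linf_cst.
    rewrite (act_cst bM) (act_cst bN) linear_subE // linear_scaleE //.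
    by rewrite opprB addrA subrK.
  rewrite eJ.
  have t1 := pn_triangle nN (J (dm_act h s)) (- dm_act h (J s)).
  have t2 := pnorm_opp bN nN (dm_act h (J s)).
  have t3 := pn_act nN (J s) Lh; have t4 := hJ (dm_act h s).
  have t5 := pn_act nM s Lh.
  apply: filterS2 (filterI t1 (filterI t2 t3)) (filterI t4 t5).
  move=> x [h1 [h2 h3]] [h4 h5]; apply: (le_trans h1); rewrite h2 h3 mulrDr.
  by rewrite lerD2r (le_trans h4) // h5 mulrCA.
have h0 := pn_ge0 nN (J (dm_act f s) - dm_act f (J s)).
apply: filterS2 h0 (ae_foralln hn) => x h0 h.
apply/eqP; rewrite eq_le h0 andbT; apply/ler_addgt0Pr => e e0; rewrite add0r.
set b := C * dm_pnorm s x + dm_pnorm (J s) x in h.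
have [n hn'] := hg (f x) (e / (`|b| + 1)) (divr_gt0 e0 (ltr_wpDl (normr_ge0 _) ltr01)).
apply: (le_trans (h n)); apply: (@le_trans _ _ (rnorm (f x - g n) * `|b|)).
  by rewrite ler_wpM2l ?rnorm_ge0 // ler_norm.
by apply/ltW/mul_lt_of_lt_div => //; exact: rnorm_ge0.
Qed.

Section equivariant.
Variables (psi psi' : Omega -> Omega).
Hypothesis mpsi : measurable_fun setT psi.
Hypothesis mpsi' : measurable_fun setT psi'.
Hypothesis ppsi' : forall A, measurable A -> mu (psi' @^-1` A) = mu A.
Hypothesis psiK : \forall x \ae mu, psi (psi' x) = x.

(** For a measurable set [A], truncating [T s] to [A] amounts to applying [T] to
    the truncation of [s] to the preimage of [A]; the norm bound for the latter is
    the integral over [A] of the claimed inequality. *)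
Lemma equivariant_bound (T : M -> N) (C : R) : 0 <= C ->
  (forall s, rnorm (T s) <= C * rnorm s) ->
  (forall f s, Linf mu f -> T (dm_act f s) = dm_act (f \o psi') (T s)) ->
  forall s, \forall x \ae mu, dm_pnorm (T s) x <= C * dm_pnorm s (psi' x).
Proof.
move=> C0 TC Ta s.
have ms := measurable_pnorm nM s.
have ms' : measurable_fun setT (fun x => dm_pnorm s (psi' x)).
  exact: measurableT_comp ms mpsi'.
have s0 : \forall x \ae mu, 0 <= dm_pnorm s (psi' x).
  exact: (ae_preimage mpsi' ppsi' (pn_ge0 nM s)).
have js : mu.-integrable setT (EFin \o (fun x => dm_pnorm s (psi' x))).
  apply/integrableP; split; first exact/measurable_EFinP.
  have /integrableP[_] := pn_integrable nM s.
  rewrite -(mp_integral mpsi' ppsi') //.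
  by apply: measurableT_comp => //; exact/measurable_EFinP.
apply: ae_le_of_integral.
- exact: pn_integrable.
- rewrite (_ : _ \o _ = fun x => (C%:E * (dm_pnorm s (psi' x))%:E)%E) //.
  exact: integrableZl.
move=> A mA; have mB : measurable (psi @^-1` A).
  by rewrite -[X in measurable X]setTI; exact: mpsi.
have mI : measurable_fun setT (fun x => \1_(psi @^-1` A) (psi' x) : R).
  have mB' : measurable_fun setT (\1_(psi @^-1` A) : Omega -> R).
    exact: measurable_indic.
  exact: measurableT_comp mB' mpsi'.
rewrite -(norm_truncation nN _ mA).
have -> : dm_act (kindic A) (T s) = T (dm_act (kindic (psi @^-1` A)) s).
  rewrite Ta; last exact: Linf_kindic.
  apply: (bm_ae bN); first exact: Linf_kindic.
    by apply: Linf_comp => //; exact: Linf_kindic.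
  by apply: filterS psiK => x e; rewrite /kindic /= indic_preimage e.
apply: (@le_trans _ _ (C * rnorm (dm_act (kindic (psi @^-1` A)) s))%:E).
  by rewrite lee_fin.
rewrite EFinM (norm_truncation_abs nM _ mB).
rewrite -(mp_integral mpsi' ppsi'); first last.
- by move=> x; rewrite lee_fin mulr_ge0 // indicE; case: (_ \in _).
- apply/measurable_EFinP; apply: measurable_funM; first exact: measurable_indic.
  exact: measurableT_comp.
rewrite -ge0_integralZl_EFin //; first last.
- apply/measurable_EFinP; apply: measurable_funM; last exact: measurableT_comp.
  exact: mI.
rewrite [leRHS]integral_mkcond le_eqVlt; apply/orP; left; apply/eqP.
apply: ae_eq_integral => //.
- apply: measurable_funeM; apply/measurable_EFinP.
  apply: measurable_funM; last exact: measurableT_comp.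
  exact: mI.
- apply/(measurable_restrictT _ mA); apply: measurable_funTS.
  by apply/measurable_EFinP; apply: measurable_funM.
apply: filterS2 psiK s0 => x e x0 _ /=.
rewrite patchE indic_preimage e indicE ger0_norm //.
by case: (_ \in _); rewrite /= ?mul1r ?mul0r ?mule0 // EFinM.
Qed.

End equivariant.
End module_maps.

(** * Completeness of the space of integrable sections *)

Section summable_increments.
Context {R : realType} {k : scalar_kind}.
Local Notation K := (scalar_field R k).
Variable V : completeNormedModType K.
Variable v : nat -> V.

Let incr n : \bar R := (rnorm (v n - v n.+1))%:E.

Let incr_ge0 n : (0 <= incr n)%E.
Proof. by rewrite lee_fin rnorm_ge0. Qed.

Let dist_le_tail N n : (N <= n)%N ->
  ((rnorm (v N - v n))%:E <= \sum_(N <= j <oo) incr j)%E.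
Proof.
move=> /subnKC <-; move: (n - N)%N => m.
apply: (@le_trans _ _ (\sum_(N <= j < N + m) incr j)%E); last first.
  exact: nneseries_lim_ge.
elim: m => [|m ih]; first by rewrite addn0 subrr rnorm0 big_geq.
rewrite addnS big_nat_recr ?leq_addr //=; apply: le_trans (leeD ih (le_refl _)).
by rewrite -EFinD lee_fin rnorm_triang.
Qed.

(** Fiberwise half of the Riesz-Fischer argument. *)
Lemma summable_increments_cvg : (\sum_(0 <= j <oo) incr j < +oo)%E ->
  exists2 l : V, v n @[n --> \oo] --> l &
    forall N, ((rnorm (l - v N))%:E <= \sum_(N <= j <oo) incr j)%E.
Proof.
move=> fin.
have tail0 := nneseries_tail_cvg fin (fun n _ => incr_ge0 n).
have [l vl] : exists l : V, v n @[n --> \oo] --> l.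
  apply: cauchy_seq_cvg => [F FF|e e0]; first exact: cauchy_cvg.
  have e_nbhs : ereal_nbhs 0%E (fun y => y < e%:E)%E.
    by apply: open_ereal_lt'; rewrite lte_fin.
  have [N _ hN] := tail0 _ e_nbhs; exists N => n Nn.
  by rewrite -lte_fin; apply: le_lt_trans (hN N (leqnn N)); exact: dist_le_tail.
exists l => // N.
have tail_ge0 : (0 <= \sum_(N <= j <oo) incr j)%E by apply: nneseries_ge0.
case E : (\sum_(N <= j <oo) incr j)%E => [r| |]; last by rewrite E in tail_ge0.
  rewrite lee_fin; apply/ler_addgt0Pr => e e0.
  have /cvgr0Pnorm_lt /(_ e e0)[M _ hM] := (cvg_rnorm0 v l).1 vl.
  pose n := maxn M N; have := hM n (leq_maxl _ _).
  rewrite ger0_norm ?rnorm_ge0 // rnorm_distC => h.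
  apply: (le_trans (rnorm_triang (v n) _ _)); rewrite addrC; apply: lerD; last exact: ltW.
  by rewrite -lee_fin -E rnorm_distC; apply: dist_le_tail; exact: leq_maxr.
exact: leey.
Qed.

End summable_increments.

Section Gamma1_basics.
Context {R : realType} {k : scalar_kind}.
Context {d : measure_display} {Omega : measurableType d}.
Context {mu : {measure set Omega -> \bar R}}.
Local Notation K := (scalar_field R k).
Variable E : mbundle k mu.
Implicit Types s t : Gamma1 E.

Lemma Gamma1_repr_msec s : msec (Gamma1_repr s).
Proof. exact: (Gamma1_reprP s).1. Qed.

Lemma rnorm_Gamma1 s : (rnorm s)%:E = (\int[mu]_x (rnorm (Gamma1_repr s x))%:E)%E.
Proof. by rewrite -EFin_Gamma1_norm; congr EFin; exact: re_emb. Qed.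

Lemma Gamma1_exists (s : section E) : s \in integrable_section E ->
  exists t : Gamma1 E, \forall x \ae mu, Gamma1_repr t x = s x.
Proof.
by move=> js; exists (\pi_(Gamma1 E) (L1Section js)); exact: Gamma1_repr_pi.
Qed.

Lemma Gamma1_repr_lin (a : K) s t : \forall x \ae mu,
  Gamma1_repr (a *: s + t) x = a *: Gamma1_repr s x + Gamma1_repr t x.
Proof.
apply: filterS2 (Gamma1_repr_add (a *: s) t) (Gamma1_repr_scale a s) => x -> e.
by congr (_ + _); exact: e.
Qed.

Lemma Gamma1_repr_sub s t : \forall x \ae mu,
  Gamma1_repr (s - t) x = Gamma1_repr s x - Gamma1_repr t x.
Proof.
rewrite addrC -scaleN1r; apply: filterS (Gamma1_repr_lin (-1) t s) => x ->.
by rewrite scaleN1r addrC.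
Qed.

Lemma Gamma1_repr0 : \forall x \ae mu, Gamma1_repr (0 : Gamma1 E) x = 0.
Proof.
have h : \forall x \ae mu, Gamma1_repr (0 *: (0 : Gamma1 E)) x =
    0 *: Gamma1_repr (0 : Gamma1 E) x := Gamma1_repr_scale 0 0.
by apply: filterS h => x; rewrite !scale0r.
Qed.

Lemma Gamma1_repr_lincomb (u : nat -> Gamma1 E) (c : {poly K}) : \forall x \ae mu,
  Gamma1_repr (lincomb u c) x = lincomb (fun n => Gamma1_repr (u n) x) c.
Proof.
rewrite /lincomb; elim: (size c) => [|n ih].
  by apply: filterS Gamma1_repr0 => x; rewrite !big_ord0.
have h := Gamma1_repr_lin c`_n (u n) (\sum_(i < n) c`_i *: u i).
apply: filterS2 ih h => x ih h.
by rewrite !big_ord_recr /= addrC h ih addrC.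
Qed.

Lemma msecB (s t : section E) : msec s -> msec t -> msec (fun x => s x - t x).
Proof.
move=> ms mt; rewrite (_ : (fun x => _) = fun x => s x + -1 *: t x).
  by apply: msecD => //; exact: msecZ.
by apply: functional_extensionality_dep => x; rewrite scaleN1r.
Qed.

Lemma Gamma1_norm_le s (h : Omega -> \bar R) : measurable_fun setT h ->
  (forall x, 0 <= h x)%E ->
  (\forall x \ae mu, (rnorm (Gamma1_repr s x))%:E <= h x)%E ->
  ((rnorm s)%:E <= \int[mu]_x h x)%E.
Proof.
move=> mh h0 hs; rewrite rnorm_Gamma1; apply: ae_ge0_le_integral => //.
- by move=> x _; rewrite lee_fin rnorm_ge0.
- exact: (measurable_rnorm (Gamma1_repr_msec s)).
- by apply: filterS hs => x hx _.
Qed.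

Lemma rnorm_Gamma1B s t : (rnorm (s - t))%:E =
  (\int[mu]_x (rnorm (Gamma1_repr s x - Gamma1_repr t x))%:E)%E.
Proof.
rewrite rnorm_Gamma1; apply: ae_eq_integral => //.
- exact: (measurable_rnorm (Gamma1_repr_msec _)).
- by apply: measurable_rnorm; apply: msecB; exact: Gamma1_repr_msec.
- by apply: filterS (Gamma1_repr_sub s t) => x -> _.
Qed.

Lemma sum_half_pow N :
  (\sum_(N <= j <oo) (half_pow j)%:E <= (half_pow N + half_pow N)%:E :> \bar R)%E.
Proof.
have h0 n : (0 <= (half_pow n)%:E :> \bar R)%E by rewrite lee_fin ltW ?half_pow_gt0.
apply: lime_le; first by apply: is_cvg_nneseries => n _ _.
exists N => // n /= /subnKC <-; move: (n - N)%N => m.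
suff : \sum_(N <= j < N + m) half_pow j + (half_pow (N + m) + half_pow (N + m)) =
    half_pow N + half_pow N :> R.
  move=> <-; rewrite sumEFin lee_fin lerDl addr_ge0 // ltW ?half_pow_gt0 //.
elim: m => [|m ih]; first by rewrite addn0 big_geq // add0r.
by rewrite addnS big_nat_recr ?leq_addr //= half_powS -addrA.
Qed.

(** For a rapidly Cauchy sequence the sum of the norms of the increments is
    integrable, hence finite almost everywhere, and its tails dominate the
    distance to the fiberwise limit. *)
Lemma Gamma1_complete (F : set_system (Gamma1 E)) :
  ProperFilter F -> cauchy F -> cvg F.
Proof.
apply: complete_of_rapid F => u hu.
pose v n x := Gamma1_repr (u n) x.
pose g n x := (rnorm (v n x - v n.+1 x))%:E.
have g0 n x : (0 <= g n x)%E by rewrite lee_fin rnorm_ge0.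
have mg n : measurable_fun setT (g n).
  by apply: measurable_rnorm; apply: msecB; exact: Gamma1_repr_msec.
pose H N x := (\sum_(N <= j <oo) g j x)%E.
have HE N : H N = fun x => (\sum_(0 <= j <oo) g (j + N)%N x)%E.
  by apply/funext => x; rewrite /H (nneseries_addn (f := fun j => g j x)).
have H0 N x : (0 <= H N x)%E by apply: nneseries_ge0.
have mH N : measurable_fun setT (H N).
  by rewrite HE; apply: ge0_emeasurable_sum.
have iH N : (\int[mu]_x H N x <= (half_pow N + half_pow N)%:E)%E.
  rewrite HE integral_nneseries //.
  rewrite (nneseries_addn (f := fun j => \int[mu]_x g j x)%E); last first.
    by move=> i; apply: integral_ge0.
  apply: le_trans (sum_half_pow N); apply: lee_nneseries => [i _ _|i _].
    by apply: integral_ge0.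
  by rewrite /g /v -rnorm_Gamma1B lee_fin ltW.
have aeH : \forall x \ae mu, (H 0%N x < +oo)%E.
  have jH : mu.-integrable setT (H 0%N).
    apply/integrableP; split=> //; apply: le_lt_trans (ltry (half_pow 0 + half_pow 0)).
    under eq_integral do rewrite gee0_abs //.
    exact: iH.
  apply: filterS (integrable_ae measurableT jH) => x /(_ I).
  by rewrite fin_numE => /andP[_ /eqP]; rewrite ltey => /eqP.
have hl x : exists l : E x, (H 0%N x < +oo)%E ->
    v n x @[n --> \oo] --> l /\ forall N, ((rnorm (l - v N x))%:E <= H N x)%E.
  have [fin|fin] := pselect (H 0%N x < +oo)%E; last by exists 0 => /fin.
  by have [l vl lH] := summable_increments_cvg fin; exists l.
pose l x := sval (cid (hl x)).
have lP x : (H 0%N x < +oo)%E ->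
    v n x @[n --> \oo] --> l x /\ forall N, ((rnorm (l x - v N x))%:E <= H N x)%E.
  exact: (svalP (cid (hl x))).
have ml : msec l.
  apply: (msec_lim (u := v)) => [n|]; first exact: Gamma1_repr_msec.
  by apply: filterS aeH => x /lP[].
have jl : l \in integrable_section E.
  apply/integrable_sectionP; split => //; apply/integrableP; split.
    exact: measurable_rnorm.
  have hle : (\int[mu]_x `|(rnorm (l x))%:E| <=
      \int[mu]_x (H 0%N x + (rnorm (v 0%N x))%:E))%E.
    apply: ae_ge0_le_integral => //.
    - by apply: measurableT_comp => //; exact: measurable_rnorm.
    - by move=> x _; rewrite adde_ge0 // lee_fin rnorm_ge0.
    - apply: emeasurable_funD => //; exact: (measurable_rnorm (Gamma1_repr_msec (u 0%N))).
    apply: filterS aeH => x /lP[_ /(_ 0%N) h] _.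
    rewrite gee0_abs ?lee_fin ?rnorm_ge0 //.
    apply: le_trans (leeD h (le_refl _)).
    by rewrite -EFinD lee_fin -[in leLHS](subrK (v 0%N x) (l x)) rnormD.
  apply: (le_lt_trans hle); rewrite ge0_integralD //; first last.
  - exact: (measurable_rnorm (Gamma1_repr_msec (u 0%N))).
  - by move=> x _; rewrite lee_fin rnorm_ge0.
  rewrite -rnorm_Gamma1; apply: lte_add_pinfty; last exact: ltry.
  by apply: le_lt_trans (iH 0%N) (ltry _).
have [t ht] := Gamma1_exists jl.
exists t; apply/cvg_rnorm0.
have tN N : rnorm (u N - t) <= half_pow N + half_pow N.
  rewrite rnorm_distC -lee_fin; apply: le_trans (iH N).
  apply: Gamma1_norm_le => //.
  apply: filterS3 aeH ht (Gamma1_repr_sub t (u N)) => x /lP[_ h] e ->.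
  by rewrite e; exact: h.
have h0 : half_pow N + half_pow N @[N --> \oo] --> (0 : R).
  by rewrite -[X in _ --> X]addr0; apply: cvgD; exact: half_pow_cvg0.
apply: squeeze_cvgr (cvg_cst 0) h0.
by apply: nearW => n; rewrite rnorm_ge0 tN.
Qed.

End Gamma1_basics.

(** * The module of integrable sections *)

Section Gamma1_module_axioms.
Context {R : realType} {k : scalar_kind}.
Context {d : measure_display} {Omega : measurableType d}.
Context {mu : {measure set Omega -> \bar R}}.
Context {G : groupType} {S : umagmaClosed G}.
Local Notation K := (scalar_field R k).
Variable E : mbundle k mu.
Implicit Types s t : Gamma1 E.

Lemma Gamma1_repr_act (f : Omega -> K) s : Linf mu f ->
  \forall x \ae mu, Gamma1_repr (Gamma1_act f s) x = f x *: Gamma1_repr s x.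
Proof.
move=> Lf; rewrite /Gamma1_act; case: pselect => // Lf'.
exact: (Gamma1_repr_pi (L1Section (act_integrable s Lf'))).
Qed.

Variable op : forall g : G, g \in S -> Gamma1 E -> Gamma1 E.

(** With the operators as a parameter, the module axioms are established at once
    for bundles with and without dynamics. *)
Definition Gamma1_data : @dyn_module_data R k d Omega G S :=
  DynModuleData (@Gamma1_act _ _ _ _ _ E) (@Gamma1_pnorm _ _ _ _ _ E) op.

Lemma Gamma1_act_linear (f : Omega -> K) : Linf mu f ->
  linear (Gamma1_act f : Gamma1 E -> Gamma1 E).
Proof.
move=> Lf a s t; apply: Gamma1_eq.
apply: filterS3 (filterI (Gamma1_repr_lin a s t) (Gamma1_repr_act (a *: s + t) Lf))
  (filterI (Gamma1_repr_act s Lf) (Gamma1_repr_act t Lf))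
  (Gamma1_repr_lin a (Gamma1_act f s) (Gamma1_act f t)).
by move=> x [e1 ->] [e2 e3] ->; rewrite e1 e2 e3 scalerDr !scalerA mulrC.
Qed.

Lemma Gamma1_act1 s : Gamma1_act (fun=> 1) s = s.
Proof.
apply: Gamma1_eq; apply: filterS (Gamma1_repr_act s (Linf_cst 1)) => x ->.
by rewrite scale1r.
Qed.

Lemma Gamma1_banach : is_banach_module (mu := mu) Gamma1_data.
Proof.
split.
- exact: Gamma1_complete.
- move=> f f' s Lf Lf' e; apply: Gamma1_eq.
  apply: filterS3 e (Gamma1_repr_act s Lf) (Gamma1_repr_act s Lf').
  by move=> x /= -> -> ->.
- move=> f f' s Lf Lf'; apply: Gamma1_eq.
  have Lff := LinfD Lf Lf'.
  apply: filterS3 (Gamma1_repr_act s Lff)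
    (filterI (Gamma1_repr_act s Lf) (Gamma1_repr_act s Lf'))
    (Gamma1_repr_add (Gamma1_act f s) (Gamma1_act f' s)).
  by move=> x /= -> [h1 h2] ->; rewrite h1 h2 scalerDl.
- move=> a f s Lf; apply: Gamma1_eq.
  have Laf := LinfM (Linf_cst a) Lf.
  apply: filterS3 (Gamma1_repr_act s Laf) (Gamma1_repr_act s Lf)
    (Gamma1_repr_scale a (Gamma1_act f s)).
  by move=> x /= -> h1 h2; rewrite -scalerA -h1 -h2.
- exact: Gamma1_act_linear.
- move=> f f' s Lf Lf'; apply: Gamma1_eq.
  apply: filterS3 (Gamma1_repr_act s (LinfM Lf Lf')) (Gamma1_repr_act s Lf')
    (Gamma1_repr_act (Gamma1_act f' s) Lf).
  by move=> x /= -> h1 ->; rewrite h1 scalerA.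
- move=> f s Lf; case fN : (Linf_norm mu f) => [r| |].
  + have hr : \forall x \ae mu, rnorm (f x) <= r.
      by apply: filterS (Linf_norm_ge f (mu := mu)) => x; rewrite fN lee_fin.
    have r0 : (0 <= `|r|%:E)%E by rewrite lee_fin.
    have h : ((rnorm (Gamma1_act f s))%:E <= `|r|%:E * (rnorm s)%:E)%E.
      rewrite (rnorm_Gamma1 s) -ge0_integralZl_EFin //; first last.
      * exact: (measurable_rnorm (Gamma1_repr_msec s)).
      * by move=> x _; rewrite lee_fin rnorm_ge0.
      apply: Gamma1_norm_le.
      * by apply: measurable_funeM; exact: (measurable_rnorm (Gamma1_repr_msec s)).
      * by move=> x; rewrite mule_ge0 // lee_fin rnorm_ge0.
      apply: filterS2 hr (Gamma1_repr_act s Lf) => x hx ->.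
      rewrite -EFinM lee_fin rnormZ ler_wpM2r ?rnorm_ge0 //.
      exact: le_trans hx (ler_norm _).
    have [rp|rn] := lerP 0 r; first by rewrite ger0_norm in h.
    have z : s = 0.
      rewrite -(Gamma1_act1 s); apply: Gamma1_eq.
      apply: filterS3 hr (Gamma1_repr_act s (Linf_cst 1)) (Gamma1_repr0 E).
      by move=> x /(le_trans (rnorm_ge0 _)); rewrite leNgt rn.
    have -> : dm_act f (s : Gamma1_data) = 0.
      by rewrite z; exact: linear_0E (Gamma1_act_linear Lf).
    by rewrite z !rnorm0 mule0.
  + by have := Lf.2; rewrite fN.
  + have h := Linf_norm_ge f (mu := mu).
    have z t : t = 0.
      apply: Gamma1_eq; apply: filterS h => x.
      by rewrite fN leeNy_eq.
    have -> : dm_act f (s : Gamma1_data) = 0 by exact: z.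
    by rewrite (z s) !rnorm0 mule0.
- apply/dense_rnormP => v e e0; exists v; last by rewrite subrr rnorm0.
  exists 1%N, (fun=> 1), (fun=> v); split; last by rewrite big_ord1 scale1r.
  move=> _; exists (fun=> 1), v; split; first exact: Linf_cst.
  by rewrite /= Gamma1_act1.
Qed.

Lemma Gamma1_L1_normed : is_L1_normed (mu := mu) Gamma1_data.
Proof.
split.
- by move=> s; exact: (Gamma1_reprP s).2.
- by move=> s; apply: aeW => x; exact: rnorm_ge0.
- by move=> s; rewrite rnorm_Gamma1.
- move=> f s Lf; apply: filterS (Gamma1_repr_act s Lf) => x e.
  by rewrite /= /Gamma1_pnorm e rnormZ.
- move=> s t; apply: filterS (Gamma1_repr_add s t) => x e.
  by rewrite /= /Gamma1_pnorm e rnormD.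
Qed.

End Gamma1_module_axioms.

Section pnorm_preserving_maps.
Context {R : realType} {k : scalar_kind}.
Context {d : measure_display} {Omega : measurableType d}.
Context {mu : {measure set Omega -> \bar R}}.
Context {G : groupType} {S : umagmaClosed G}.
Local Notation K := (scalar_field R k).
Variable M : @dyn_module_data R k d Omega G S.
Hypothesis bM : is_banach_module (mu := mu) M.
Hypothesis nM : is_L1_normed (mu := mu) M.
Variables (E : mbundle k mu) (J : M -> Gamma1 E).

Lemma pnorm_preserving_norm (s : M) (t : Gamma1 E) :
  (\forall x \ae mu, rnorm (Gamma1_repr t x) = dm_pnorm s x) -> rnorm t = rnorm s.
Proof.
move=> e; apply: EFin_inj; rewrite rnorm_Gamma1 -(pn_norm nM).
apply: ae_eq_integral => //.
- exact: (measurable_rnorm (Gamma1_repr_msec _)).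
- exact/measurable_EFinP/(measurable_pnorm nM).
- by apply: filterS e => x -> _.
Qed.

Hypothesis lJ : linear J.
Hypothesis Jp : forall s, \forall x \ae mu,
  rnorm (Gamma1_repr (J s) x) = dm_pnorm s x.

Lemma pnorm_preserving_act (f : Omega -> K) s : Linf mu f ->
  J (dm_act f s) = Gamma1_act f (J s).
Proof.
move=> Lf; pose N := @Gamma1_data R k d Omega mu G S E (fun _ _ => id).
apply: (@local_linear_act R k d Omega mu G S M N bM (Gamma1_banach _) nM
  (Gamma1_L1_normed _) J 1) => // t.
by apply: filterS (Jp t) => x e; rewrite mul1r -e; exact: lexx.
Qed.

End pnorm_preserving_maps.

(** * Gluing along measurable sets, and density *)

Section gluing.
Context {R : realType} {k : scalar_kind}.
Context {d : measure_display} {Omega : measurableType d}.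
Context {mu : {measure set Omega -> \bar R}}.
Local Notation K := (scalar_field R k).
Variable E : mbundle k mu.
Implicit Types s t : Gamma1 E.

Lemma msec_if (A : set Omega) (s t : section E) : measurable A ->
  msec s -> msec t -> msec (fun x => if x \in A then s x else t x).
Proof.
move=> mA ms mt; pose f : Omega -> K := kindic A.
have mf : kmeasurable f by apply: kmeasurable_emb; exact: measurable_indic.
rewrite (_ : (fun x => _) = fun x => f x *: (s x - t x) + t x).
  by apply: msecD => //; apply: msecM => //; exact: msecB.
apply: functional_extensionality_dep => x; case: ifPn => [|/negP] xA.
  by rewrite /f kindic1 ?scale1r ?subrK // -in_setE.
by rewrite /f kindic0 ?scale0r ?add0r // => /mem_set.
Qed.

Definition Gamma1_glue (A : set Omega) s t : Gamma1 E :=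
  Gamma1_act (kindic A) s + Gamma1_act (kindic (~` A)) t.

Lemma Gamma1_repr_glue (A : set Omega) s t : measurable A ->
  \forall x \ae mu, Gamma1_repr (Gamma1_glue A s t) x =
    if x \in A then Gamma1_repr s x else Gamma1_repr t x.
Proof.
move=> mA; have LA := @Linf_kindic R k d Omega mu A mA.
have LC := @Linf_kindic R k d Omega mu _ (measurableC mA).
apply: filterS3 (Gamma1_repr_act s LA) (Gamma1_repr_act t LC)
  (Gamma1_repr_add (Gamma1_act (kindic A) s) (Gamma1_act (kindic (~` A)) t)).
move=> x h1 h2 ->; rewrite h1 h2; case: ifPn => [|/negP] xA.
  rewrite in_setE in xA.
  by rewrite kindic1 // kindic0 ?scale1r ?scale0r ?addr0 // => /(_ xA).
have nA : ~ A x by move=> /mem_set.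
by rewrite kindic0 // kindic1 ?scale1r ?scale0r ?add0r.
Qed.

(** The nearest of the first [n] members of the sequence to [t], fiber by fiber, is
    obtained by finitely many gluings.  Its distance to [t] decreases to zero and
    is at most the norm of [t], since the starting value is the zero section. *)
Lemma glue_dense (w : nat -> Gamma1 E) (Z : set (Gamma1 E)) :
  (\forall x \ae mu, forall (v : E x) (e : R), 0 < e ->
     exists n, rnorm (v - Gamma1_repr (w n) x) < e) ->
  Z 0 -> (forall n, Z (w n)) ->
  (forall A s t, measurable A -> Z s -> Z t -> Z (Gamma1_glue A s t)) ->
  forall t (e : R), 0 < e -> exists2 z, Z z & rnorm (t - z) < e.
Proof.
move=> wD Z0 Zw Zg t.
pose dist s x := rnorm (Gamma1_repr t x - Gamma1_repr s x).
have mdist s : measurable_fun setT (dist s).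
  by apply: msec_norm; apply: msecB; exact: Gamma1_repr_msec.
pose A n s := [set x | dist (w n) x < dist s x].
have mA n s : measurable (A n s) by exact: measurable_ltset.
pose z := fix z n := if n is n'.+1 then Gamma1_glue (A n' (z n')) (w n') (z n') else 0.
have Zz n : Z (z n) by elim: n => //= n ih; exact: Zg.
have zS n : \forall x \ae mu, dist (z n.+1) x = Num.min (dist (w n) x) (dist (z n) x).
  apply: filterS (Gamma1_repr_glue (w n) (z n) (mA n (z n))) => x.
  rewrite /dist /= => ->; case: ifPn => [|/negP] xA.
    by rewrite in_setE in xA; rewrite min_l // ltW.
  have {}xA : ~ A n (z n) x by move=> /mem_set.
  by rewrite min_r // leNgt; apply/negP.
have z_dom : \forall x \ae mu, forall n, dist (z n) x <= rnorm (Gamma1_repr t x).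
  apply: filterS2 (ae_foralln zS) (Gamma1_repr0 E) => x hS h0.
  elim=> [|n ih]; first by rewrite /dist /= h0 subr0.
  by rewrite hS ge_min ih orbT.
have z_cvg : \forall x \ae mu, dist (z n) x @[n --> \oo] --> (0 : R).
  apply: filterS2 (ae_foralln zS) wD => x hS hD.
  apply/cvgr0Pnorm_lt => e e0; have [N hN] := hD (Gamma1_repr t x) e e0.
  exists N.+1 => // n /= /subnKC <-; rewrite ger0_norm ?rnorm_ge0 //.
  elim: (n - N.+1)%N => [|m ih]; first by rewrite addn0 hS gt_min hN.
  by rewrite addnS hS gt_min ih orbT.
move=> e e0.
have [|||||_ _ h] := @dominated_convergence _ _ _ mu setT measurableT
  (fun n x => (dist (z n) x)%:E) (cst 0%E) (fun x => (rnorm (Gamma1_repr t x))%:E).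
- by move=> n; exact/measurable_EFinP.
- exact: measurable_cst.
- apply: filterS z_cvg => x hx _; apply: cvg_EFin => //.
  by apply: nearW.
- exact: (Gamma1_reprP t).2.
- apply: filterS z_dom => x hx n _.
  by rewrite abse_EFin lee_fin ger0_norm ?rnorm_ge0.
rewrite integral0 in h.
have e_nbhs : ereal_nbhs 0%E (fun y => y < e%:E)%E.
  by apply: open_ereal_lt'; rewrite lte_fin.
have [N _ hN] := h _ e_nbhs; exists (z N) => //.
by rewrite -lte_fin rnorm_Gamma1B; exact: (hN N (leqnn N)).
Qed.

End gluing.

(** * Generating sequences and separability *)

Section generators.
Context {R : realType} {k : scalar_kind}.
Context {d : measure_display} {Omega : measurableType d}.
Context {mu : {measure set Omega -> \bar R}}.
Local Notation K := (scalar_field R k).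
Local Notation D := (polyOver (@ratK R k)).
Variable E : mbundle k mu.
Implicit Types s t : Gamma1 E.

(** Rational combinations are used so that density of a countable set of sections
    can be read off at almost every point. *)
Definition generating (b : nat -> Gamma1 E) : Prop :=
  \forall x \ae mu, forall (v : E x) (e : R), 0 < e ->
    exists2 c, c \is a D & rnorm (v - lincomb (fun n => Gamma1_repr (b n) x) c) < e.

Definition ess_bounded s : Prop :=
  exists2 C : R, 0 <= C & \forall x \ae mu, rnorm (Gamma1_repr s x) <= C.

Lemma dense_lin_rat_poly (V : normedModType K) (u : nat -> V) :
  dense (lin [set u n | n in [set: nat]]) -> forall v (e : R), 0 < e ->
  exists2 c, c \is a D & rnorm (v - lincomb u c) < e.
Proof.
rewrite lin_lincomb => /dense_rnormP h v e e0.
have e20 : 0 < e / 2 by rewrite divr_gt0.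
have [_ [c _ <-] hc] := h v _ e20.
have [c' Dc' hc'] := rat_poly_approx
  (pullback_sn (lincomb u : {linear {poly K} -> V}) (norm_sn V)) c e20.
exists c' => //; rewrite [e]splitr.
apply: (le_lt_trans (rnorm_triang (lincomb u c) _ _)); apply: ltrD => //.
by move: hc'; rewrite /= linearB.
Qed.

(** Truncate where the section is large and outside an exhausting sequence of
    sets of finite measure. *)
Lemma sigma_finite_truncation (s : section E) : sigma_finite setT mu -> msec s ->
  exists2 t : nat -> Gamma1 E, (forall n, ess_bounded (t n)) &
    \forall x \ae mu, \forall n \near \oo, Gamma1_repr (t n) x = s x.
Proof.
move=> /sigma_finiteP[A [AT ndA mA]] ms.
pose B n := A n `&` [set x | rnorm (s x) <= n%:R].
have mB n : measurable (B n).
  apply: measurableI; first exact: (mA n).1.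
  rewrite (_ : [set x | _] = ~` [set x | n%:R < rnorm (s x)]).
    by apply/measurableC/measurable_ltset => //; exact: msec_norm.
  by apply/seteqP; split=> x /=; rewrite leNgt; [move/negP|move/negP].
pose tr n : section E := fun x => if x \in B n then s x else 0.
have tr_le n x : rnorm (tr n x) <= n%:R * \1_(A n) x.
  rewrite /tr; case: ifPn => [|_]; last first.
    by rewrite rnorm0 mulr_ge0 // indicE; case: (_ \in _).
  by rewrite in_setE => -[Ax /= sx]; rewrite indicE mem_set // mulr1.
have jtr n : tr n \in integrable_section E.
  apply: (@ae_integrable_section _ _ _ _ _ _ _ (fun x => n%:R * \1_(A n) x)).
  - by apply: msec_if => //; exact: msec0.
  - rewrite (_ : _ \o _ = fun x => ((n%:R)%:E * (\1_(A n) x)%:E)%E) //.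
    apply: integrableZl => //; apply/integrableP; split.
      by apply/measurable_EFinP; apply: measurable_indic; exact: (mA n).1.
    under eq_integral do rewrite gee0_abs ?lee_fin //.
    by rewrite integral_indic ?setIT; [exact: (mA n).2| |exact: (mA n).1].
  - by apply: aeW => x.
have [t ht] := choice (fun n => Gamma1_exists (jtr n)).
exists t => [n|].
  exists n%:R => //; apply: filterS (ht n) => x ->.
  by apply: (le_trans (tr_le n x)); rewrite ler_piMr // indicE.
apply: filterS (ae_foralln ht) => x hx.
have [m Am] : exists m, A m x.
  by have : setT x by []; rewrite AT => -[m _ Ax]; exists m.
have sx : rnorm (s x) < (Num.bound (rnorm (s x)))%:R.
  exact/archi_boundP/rnorm_ge0.
exists (maxn m (Num.bound (rnorm (s x)))) => // n /=; rewrite geq_max => /andP[mn bn].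
rewrite hx /tr mem_set //; split.
  by have /subsetPset := ndA _ _ mn; exact.
by apply: (le_trans (ltW sx)); rewrite ler_nat.
Qed.

Lemma exists_generating : sigma_finite setT mu -> separable_bundle E ->
  exists2 b : nat -> Gamma1 E, (forall n, ess_bounded (b n)) & generating b.
Proof.
move=> sf [u mu' hu].
have ht n : exists t : nat -> Gamma1 E, (forall m, ess_bounded (t m)) /\
    \forall x \ae mu, \forall m \near \oo, Gamma1_repr (t m) x = u n x.
  by have [t] := sigma_finite_truncation sf (mu' n); exists t.
have [t ht'] := choice ht.
pose idx n : nat * nat := odflt (0%N, 0%N) (unpickle n).
exists (fun n => t (idx n).1 (idx n).2) => [n|]; first exact: (ht' _).1.
apply: filterS2 hu (ae_foralln (fun n => (ht' n).2)) => x dx hx.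
apply: dense_lin_rat_poly => O O0 oO; have [v [Ov lv]] := dx O O0 oO.
exists v; split => //; case: lv => N [c [a [ha ->]]].
exists N, c, a; split => // i; have [n _ <-] := ha i.
have [m _ hm] := hx n; exists (pickle (n, m)) => //.
by rewrite /idx pickleK; exact: (hm m (leqnn m)).
Qed.

Lemma ess_bounded_glue A s t : measurable A -> ess_bounded s -> ess_bounded t ->
  ess_bounded (Gamma1_glue A s t).
Proof.
move=> mA [C C0 hC] [C' C'0 hC']; exists (C + C'); first exact: addr_ge0.
apply: filterS3 hC hC' (Gamma1_repr_glue s t mA) => x h h' ->.
by case: ifP => _; [rewrite (le_trans h) // lerDl|rewrite (le_trans h') // lerDr].
Qed.

Lemma ess_bounded_lin (a : K) s t : ess_bounded s -> ess_bounded t ->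
  ess_bounded (a *: s + t).
Proof.
move=> [C C0 hC] [C' C'0 hC']; exists (rnorm a * C + C').
  by rewrite addr_ge0 // mulr_ge0 // rnorm_ge0.
apply: filterS3 hC hC' (Gamma1_repr_lin a s t) => x h h' ->.
apply: (le_trans (rnormD _ _)); apply: lerD => //.
by rewrite rnormZ ler_wpM2l ?rnorm_ge0.
Qed.

Lemma ess_bounded0 : ess_bounded 0.
Proof. by exists 0 => //; apply: filterS (Gamma1_repr0 E) => x ->; rewrite rnorm0. Qed.

Lemma ess_bounded_lincomb (b : nat -> Gamma1 E) (c : {poly K}) :
  (forall n, ess_bounded (b n)) -> ess_bounded (lincomb b c).
Proof.
move=> hb; rewrite /lincomb; elim: (size c) => [|n ih].
  by rewrite big_ord0; exact: ess_bounded0.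
by rewrite big_ord_recr /= addrC; exact: ess_bounded_lin.
Qed.

Lemma generating_dense (b : nat -> Gamma1 E) : generating b ->
  \forall x \ae mu, forall (v : E x) (e : R), 0 < e ->
     exists n, rnorm (v - Gamma1_repr (lincomb b (rat_poly n)) x) < e.
Proof.
move=> gb; apply: filterS2 gb (ae_foralln (fun n => Gamma1_repr_lincomb b (rat_poly n))).
move=> x h h' v e e0; have [c /rat_polyP[n ->] hc] := h v e e0.
by exists n; rewrite h'.
Qed.

Lemma glue_close A s t s' t' : measurable A ->
  rnorm (Gamma1_glue A s t - Gamma1_glue A s' t') <= rnorm (s - s') + rnorm (t - t').
Proof.
move=> mA; rewrite -lee_fin EFinD (rnorm_Gamma1 (s - s')) (rnorm_Gamma1 (t - t')).
rewrite -ge0_integralD //; first last.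
- exact: (measurable_rnorm (Gamma1_repr_msec _)).
- by move=> x _; rewrite lee_fin rnorm_ge0.
- exact: (measurable_rnorm (Gamma1_repr_msec _)).
- by move=> x _; rewrite lee_fin rnorm_ge0.
apply: Gamma1_norm_le.
- by apply: emeasurable_funD; exact: (measurable_rnorm (Gamma1_repr_msec _)).
- by move=> x; rewrite adde_ge0 // lee_fin rnorm_ge0.
apply: filterS3 (filterI (Gamma1_repr_glue s t mA) (Gamma1_repr_glue s' t' mA))
  (Gamma1_repr_sub (Gamma1_glue A s t) (Gamma1_glue A s' t'))
  (filterI (Gamma1_repr_sub s s') (Gamma1_repr_sub t t')).
move=> x [h1 h2] -> [h3 h4]; rewrite h1 h2 h3 h4 -EFinD lee_fin.
by case: ifP => _; rewrite ?lerDl ?lerDr rnorm_ge0.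
Qed.

Definition symdiff (A B : set Omega) := (A `\` B) `|` (B `\` A).

Lemma glue_close_set A B s t (C : R) : measurable A -> measurable B -> 0 <= C ->
  (\forall x \ae mu, rnorm (Gamma1_repr s x - Gamma1_repr t x) <= C) ->
  ((rnorm (Gamma1_glue A s t - Gamma1_glue B s t))%:E <= C%:E * mu (symdiff B A))%E.
Proof.
move=> mA mB C0 hC; have mS : measurable (symdiff B A).
  by apply: measurableU; exact: measurableD.
have -> : (C%:E * mu (symdiff B A) = \int[mu]_x (C%:E * (\1_(symdiff B A) x)%:E))%E.
  rewrite ge0_integralZl_EFin // ?integral_indic ?setIT //.
  exact/measurable_EFinP/measurable_indic.
apply: Gamma1_norm_le.
- by apply: measurable_funeM; exact/measurable_EFinP/measurable_indic.
- by move=> x; rewrite mule_ge0 // lee_fin // indicE; case: (_ \in _).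
apply: filterS3 (filterI (Gamma1_repr_glue s t mA) (Gamma1_repr_glue s t mB))
  (Gamma1_repr_sub (Gamma1_glue A s t) (Gamma1_glue B s t)) hC.
move=> x [h1 h2] -> h3; rewrite h1 h2 -EFinM lee_fin indicE.
have cases : x \in symdiff B A = (x \in A) (+) (x \in B).
  apply/idP/idP; rewrite in_setE.
    move=> [[/mem_set -> h]|[/mem_set -> h]]; first by rewrite memNset.
    by rewrite (memNset h).
  case: (boolP (x \in A)); case: (boolP (x \in B)) => //=; rewrite ?in_setE.
    by move=> /negP xB xA _; right; split=> // /mem_set.
  by move=> xB /negP xA _; left; split=> // /mem_set.
rewrite cases; case: (x \in A); case: (x \in B);
  rewrite /= ?subrr ?rnorm0 ?mulr1 ?mulr0 // rnorm_distC //.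
Qed.

(** Binary trees of gluings along the given countable family of sets, with
    rational combinations of bounded generators at the leaves, form a countable set
    whose closure is stable under all gluings: as the sections are bounded,
    replacing a set by one at small distance changes the glued section little. *)
Lemma Gamma1_separable : sigma_finite setT mu -> separable_measure mu ->
  separable_bundle E -> exists u : nat -> Gamma1 E, dense (range u).
Proof.
move=> sf [A mA hA] sE; have [b bb gb] := exists_generating sf sE.
pose w n := lincomb b (rat_poly n).
pose q := fix q (T : GenTree.tree nat) : Gamma1 E :=
  match T with
  | GenTree.Leaf n => w n
  | GenTree.Node n [:: T1; T2] => Gamma1_glue (A n) (q T1) (q T2)
  | _ => 0
  end.
have qN n T1 T2 : q (GenTree.Node n [:: T1; T2]) = Gamma1_glue (A n) (q T1) (q T2) by [].
have qb : forall T, ess_bounded (q T).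
  fix IH 1; case=> [n|n l]; first exact: ess_bounded_lincomb.
  case: l => [|T1 [|T2 [|? ?]]]; try exact: ess_bounded0.
  by rewrite qN; apply: ess_bounded_glue; [exact: mA|exact: IH|exact: IH].
pose Z := [set z | forall e : R, 0 < e -> exists T, rnorm (z - q T) < e].
have Zq T : Z (q T) by move=> e e0; exists T; rewrite subrr rnorm0.
have Zdense t (e : R) : 0 < e -> exists2 z, Z z & rnorm (t - z) < e.
  apply: (glue_dense (generating_dense gb)) => [|n|B s s' mB Zs Zs'].
  - have /rat_polyP[n hn] : (0 : {poly K}) \is a D by exact: rpred0.
    by have := Zq (GenTree.Leaf n); rewrite /= /w -hn linear0.
  - exact: (Zq (GenTree.Leaf n)).
  - move=> e' e'0; have e2 : 0 < e' / 2 by rewrite divr_gt0.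
    have e4 : 0 < e' / 2 / 2 by rewrite divr_gt0.
    have [T hT] := Zs _ e4; have [T' hT'] := Zs' _ e4.
    have [C C0 hC] := qb T; have [C' C'0 hC'] := qb T'.
    have CC : 0 < C + C' + 1 by rewrite ltr_wpDl // addr_ge0.
    have [n hn] := hA B _ mB (divr_gt0 e2 CC).
    exists (GenTree.Node n [:: T; T']); rewrite qN [e']splitr.
    apply: (le_lt_trans (rnorm_triang (Gamma1_glue B (q T) (q T')) _ _)); apply: ltrD.
      apply: (le_lt_trans (glue_close _ _ _ _ mB)).
      by rewrite [e' / 2]splitr ltrD.
    rewrite -lte_fin.
    apply: le_lt_trans (glue_close_set mB (mA n) (addr_ge0 C0 C'0) _) _.
      apply: filterS2 hC hC' => x h h'; rewrite (le_trans (rnormD _ _)) // rnormN.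
      exact: lerD.
    apply: (@le_lt_trans _ _ ((C + C' + 1)%:E * mu (symdiff (A n) B))%E).
      by rewrite lee_wpmul2r // lee_fin lerDl.
    have -> : (e' / 2)%:E = ((C + C' + 1)%:E * (e' / 2 / (C + C' + 1))%:E)%E.
      by rewrite -EFinM [(C + C' + 1) * _]mulrC mulfVK // gt_eqF.
    by rewrite lte_pmul2l // lte_fin.
exists (fun n => odflt 0 (omap q (unpickle n))); apply/dense_rnormP => t e e0.
have e2 : 0 < e / 2 by rewrite divr_gt0.
have [z Zz hz] := Zdense t _ e2; have [T hT] := Zz _ e2.
exists (q T); first by exists (pickle T) => //; rewrite pickleK.
by apply: (le_lt_trans (rnorm_triang z _ _)); rewrite [e]splitr ltrD.
Qed.

End generators.

(** * Operators on sections and morphisms of bundles *)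

Section fiberwise_maps.
Context {R : realType} {k : scalar_kind}.
Context {d : measure_display} {Omega : measurableType d}.
Context {mu : {measure set Omega -> \bar R}}.
Local Notation K := (scalar_field R k).
Local Notation D := (polyOver (@ratK R k)).
Implicit Types E F : mbundle k mu.

Lemma at_fiber_inj E x : injective (@at_fiber _ _ _ _ _ E x).
Proof. by move=> v w /(congr1 (vec_at ^~ x)); rewrite !vec_atK. Qed.

(** The target point is left free so that composites over different base maps can
    be compared. *)
Definition fiberwise_linear E F (Phi : total_space E -> total_space F) : Prop :=
  \forall x \ae mu, exists (y : Omega) (L : E x -> F y), bounded_linear L /\
    forall v, Phi (at_fiber v) = at_fiber (L v).

Lemma pm_fiberwise_linear psi E F (Phi : premorphism psi E F) : fiberwise_linear Phi.
Proof.
by apply: filterS (pm_linear Phi) => x [L bL PL]; exists (psi x), L.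
Qed.

(** At almost every point both maps are bounded linear and agree on the values of
    the generators, hence on a dense subset of the fiber. *)
Lemma pm_eq_of_generating E F (Phi Psi : total_space E -> total_space F)
    (b : nat -> Gamma1 E) : generating b ->
  fiberwise_linear Phi -> fiberwise_linear Psi ->
  (forall n, \forall x \ae mu, Phi (at_fiber (Gamma1_repr (b n) x)) =
                               Psi (at_fiber (Gamma1_repr (b n) x))) ->
  pm_eq Phi Psi.
Proof.
move=> gb lPhi lPsi /ae_foralln e; rewrite /pm_eq.
apply: filterS3 (filterI gb e) lPhi lPsi.
move=> x [gx ex] [y [L [bL PL]]] [y' [L' [bL' PL']]] v; rewrite PL PL'.
have yy : y = y'.
  by have := congr1 (@projT1 _ _) (ex 0%N); rewrite PL PL'.
case: y' / yy L' bL' PL' => L' [lL' [C' hC']] PL'; congr at_fiber.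
case: bL => lL [C hC].
pose u n := Gamma1_repr (b n) x.
have eu n : L (u n) = L' (u n).
  by apply: at_fiber_inj; rewrite -PL -PL'; exact: ex.
have eev c : L (lincomb u c) = L' (lincomb u c).
  by rewrite !linear_lincomb //; congr (lincomb _ c); apply/funext => n; exact: eu.
apply/eqP; rewrite -subr_eq0 -rnorm_eq0 eq_le rnorm_ge0 andbT.
apply/ler_addgt0Pr => r r0; rewrite add0r.
have CC : 0 < `|C| + `|C'| + 1 by rewrite ltr_wpDl // addr_ge0.
have [c _ hc] := gx v _ (divr_gt0 r0 CC).
apply: (le_trans (rnorm_triang (L (lincomb u c)) _ _)).
have -> : L v - L (lincomb u c) = L (v - lincomb u c) by rewrite linear_subE.
have -> : L (lincomb u c) - L' v = L' (lincomb u c - v) by rewrite linear_subE // eev.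
apply: (@le_trans _ _ (rnorm (v - lincomb u c) * (`|C| + `|C'|))).
  rewrite mulrDr; apply: lerD.
    by apply: (le_trans (hC _)); rewrite mulrC ler_wpM2l ?rnorm_ge0 ?ler_norm.
  by apply: (le_trans (hC' _)); rewrite rnorm_distC mulrC ler_wpM2l ?rnorm_ge0 ?ler_norm.
apply/ltW/mul_lt_of_lt_div => //; rewrite ?rnorm_ge0 ?addr_ge0 //.
Qed.

Section over_base_map.
Variables (E F : mbundle k mu) (psi psi' : Omega -> Omega).
Hypothesis mpsi : measurable_fun setT psi.
Hypothesis ppsi : forall A, measurable A -> mu (psi @^-1` A) = mu A.
Hypothesis mpsi' : measurable_fun setT psi'.
Hypothesis ppsi' : forall A, measurable A -> mu (psi' @^-1` A) = mu A.
Hypothesis psiK : \forall x \ae mu, psi (psi' x) = x.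
Hypothesis psi'K : \forall x \ae mu, psi' (psi x) = x.

Lemma Gamma1_push_repr (Phi : premorphism psi E F) (s : Gamma1 E) :
  \forall x \ae mu, Phi (at_fiber (Gamma1_repr s (psi' x))) =
    at_fiber (Gamma1_repr (Gamma1_push Phi mpsi' ppsi' psiK s) x).
Proof. by have := Gamma1_pushE Phi mpsi' ppsi' psiK (repr s); rewrite reprK. Qed.

Lemma Gamma1_push_fwd (Phi : premorphism psi E F) (s : Gamma1 E) :
  \forall x \ae mu, Phi (at_fiber (Gamma1_repr s x)) =
    at_fiber (Gamma1_repr (Gamma1_push Phi mpsi' ppsi' psiK s) (psi x)).
Proof.
have h := ae_preimage mpsi ppsi (Gamma1_push_repr Phi s).
by apply: filterS2 h psi'K => x + e; rewrite e.
Qed.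

Lemma Gamma1_push_eq (Phi : premorphism psi E F) (s : Gamma1 E) (t : Gamma1 F) :
  (\forall x \ae mu, Phi (at_fiber (Gamma1_repr s x)) =
                     at_fiber (Gamma1_repr t (psi x))) ->
  Gamma1_push Phi mpsi' ppsi' psiK s = t.
Proof.
move=> /(ae_preimage mpsi' ppsi') h; apply: Gamma1_eq.
apply: filterS3 h psiK (Gamma1_push_repr Phi s) => x + e.
by rewrite e => -> /at_fiber_inj.
Qed.

Section representation.
Variables (T : Gamma1 E -> Gamma1 F) (C : R) (b : nat -> Gamma1 E).
Hypothesis mu_sf : sigma_finite setT mu.
Hypothesis lT : linear T.
Hypothesis C0 : 0 <= C.
Hypothesis TC : forall s, \forall x \ae mu,
  rnorm (Gamma1_repr (T s) x) <= C * rnorm (Gamma1_repr s (psi' x)).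
Hypothesis gb : generating b.

Let TC' s : \forall x \ae mu,
  rnorm (Gamma1_repr (T s) (psi x)) <= C * rnorm (Gamma1_repr s x).
Proof.
have h := ae_preimage mpsi ppsi (TC s).
by apply: filterS2 h psi'K => x + e; rewrite e.
Qed.

Let u x n := Gamma1_repr (b n) x.
Let v x n := Gamma1_repr (T (b n)) (psi x).

Let T_ev c : \forall x \ae mu, Gamma1_repr (T (lincomb b c)) (psi x) = lincomb (v x) c.
Proof.
rewrite linear_lincomb //.
exact: (ae_preimage mpsi ppsi (Gamma1_repr_lincomb (T \o b) c)).
Qed.

(* The extension to the fiber at [x] of the map sending the value of each
   generator to the value at [psi x] of its image under [T]. *)
Let fiber_map x (L : E x -> F (psi x)) := [/\ linear L,
  forall w, rnorm (L w) <= C * rnorm w &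
  forall c, c \is a D -> L (lincomb (u x) c) = lincomb (v x) c].

Let exists_fiber_map : \forall x \ae mu, exists L, @fiber_map x L.
Proof.
have h1 := ae_foralln (fun n => TC' (lincomb b (rat_poly n))).
have h2 := ae_foralln (fun n => T_ev (rat_poly n)).
have h3 := ae_foralln (fun n => Gamma1_repr_lincomb b (rat_poly n)).
apply: filterS2 gb (filterI h1 (filterI h2 h3)) => x gx [h [h' h'']].
apply: bounded_extension => // [G FG|c /rat_polyP[n ->]].
  exact: cauchy_cvg.
by have := h n; rewrite h' h''.
Qed.

Let fiber_map_choice x : exists L : E x -> F (psi x),
  (exists L', @fiber_map x L') -> fiber_map L.
Proof.
have [[L' hL']|n] := pselect (exists L', @fiber_map x L').
  by exists L'.
by exists (fun=> 0).
Qed.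

Let L x := sval (cid (fiber_map_choice x)).

Let L_fiber : \forall x \ae mu, fiber_map (@L x).
Proof.
by apply: filterS exists_fiber_map => x; exact: (svalP (cid (fiber_map_choice x))).
Qed.

Let Phi (p : total_space E) : total_space F := at_fiber (L (projT2 p)).

(* Both sides are within [C |s x - w x|] of the image of [w x], for every
   rational combination [w] of the generators. *)
Let Phi_section s : \forall x \ae mu,
  Phi (at_fiber (Gamma1_repr s x)) = at_fiber (Gamma1_repr (T s) (psi x)).
Proof.
have h1 := ae_foralln (fun n => TC' (s - lincomb b (rat_poly n))).
have h2 := ae_foralln (fun n => T_ev (rat_poly n)).
have h3 := ae_foralln (fun n => Gamma1_repr_lincomb b (rat_poly n)).
have h4 := ae_foralln (fun n => Gamma1_repr_sub s (lincomb b (rat_poly n))).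
have h5 := ae_foralln (fun n => ae_preimage mpsi ppsi
  (Gamma1_repr_sub (T s) (T (lincomb b (rat_poly n))))).
apply: filterS3 (filterI gb L_fiber) (filterI h1 (filterI h2 h3)) (filterI h4 h5).
move=> x [gx [lL hL Lev]] [k1 [k2 k3]] [k4 k5]; congr at_fiber.
apply/eqP; rewrite -subr_eq0 -rnorm_eq0 eq_le rnorm_ge0 andbT.
apply/ler_addgt0Pr => r r0; rewrite add0r.
have CC : 0 < C + C + 1 by rewrite ltr_wpDl // addr_ge0.
have [c Dc hc] := gx (Gamma1_repr s x) _ (divr_gt0 r0 CC).
have /rat_polyP[n cn] := Dc.
apply: (le_trans (rnorm_triang (lincomb (v x) c) _ _)); rewrite -{1}Lev //.
rewrite -linear_subE // [X in _ + X]rnorm_distC.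
apply: (@le_trans _ _ (rnorm (Gamma1_repr s x - lincomb (u x) c) * (C + C))).
  rewrite mulrDr; apply: lerD; first by rewrite [leRHS]mulrC; exact: hL.
  have := k1 n; rewrite linear_subE // k5 k2 k4 k3 -cn => h.
  by rewrite [leRHS]mulrC.
apply/ltW/mul_lt_of_lt_div => //; rewrite ?rnorm_ge0 ?addr_ge0 //.
Qed.

Let Phi_linear : \forall x \ae mu, exists2 L : E x -> F (psi x),
  bounded_linear L & forall w, Phi (at_fiber w) = at_fiber (L w).
Proof.
apply: filterS L_fiber => x [lL hL _]; exists (@L x) => //.
by split=> //; exists C.
Qed.

Let Phi_proj : \forall x \ae mu,
  forall w : E x, projT1 (Phi (at_fiber w)) = psi x.
Proof. exact: aeW. Qed.

Let Phi_bounded : (ess_sup mu (fiber_opnorm Phi) < +oo)%E.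
Proof.
apply: (@le_lt_trans _ _ C%:E); last exact: ltry.
apply/ess_supP; apply: filterS L_fiber => x [_ hL _].
by apply: fiber_opnorm_le.
Qed.

(* A measurable section is eventually equal to its truncations at almost every
   point, so its image is a pointwise limit of integrable sections. *)
Let Phi_msec (s : section E) : msec s -> exists2 t : section F, msec t &
  \forall x \ae mu, Phi (at_fiber (s x)) = at_fiber (t (psi x)).
Proof.
move=> ms; have [t _ ht] := sigma_finite_truncation mu_sf ms.
exists (push Phi psi' s); last first.
  by apply: filterS psi'K => x e; rewrite /push e vec_atK.
apply: (msec_lim (u := fun n => Gamma1_repr (T (t n)))) => [n|].
  exact: Gamma1_repr_msec.
have h1 := ae_preimage mpsi' ppsi' ht.
have h2 := ae_foralln (fun n => ae_preimage mpsi' ppsi' (Phi_section (t n))).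
apply: filterS3 h1 h2 psiK => x [N _ hN] h e.
apply/cvg_rnorm0; apply: cvg_near_cst; exists N => // n Nn.
have := h n; rewrite e hN // => eP.
by rewrite /push eP vec_atK subrr rnorm0.
Qed.

(** Off one null set the bound holds for all rational combinations of the
    generators at once, so the values of [T] at the generators determine a bounded
    map on each remaining fiber; on the null set any map will do. *)
Lemma representation : exists Phi : premorphism psi E F, forall s,
  \forall x \ae mu, Phi (at_fiber (Gamma1_repr s x)) =
                    at_fiber (Gamma1_repr (T s) (psi x)).
Proof.
by exists (Premorphism Phi_msec Phi_proj Phi_linear Phi_bounded).
Qed.

End representation.
End over_base_map.
End fiberwise_maps.

(** * The functor *)

Section push_operators.
Context {R : realType} {k : scalar_kind}.
Context {d : measure_display} {Omega : measurableType d}.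
Context {mu : {measure set Omega -> \bar R}}.
Local Notation K := (scalar_field R k).

(** A linear relation is transported along an equality of base points that is
    hidden in equalities of points of the total space. *)
Lemma at_fiber_lin (F : mbundle k mu) (y x : Omega) (a : K) (w1 w2 w3 : F y)
    (z1 z2 z3 : F x) : at_fiber w1 = at_fiber z1 -> at_fiber w2 = at_fiber z2 ->
  at_fiber w3 = at_fiber z3 -> w3 = a *: w1 + w2 -> z3 = a *: z1 + z2.
Proof.
move=> e1; have yx : y = x := congr1 (@projT1 _ _) e1.
case: x / yx z1 z2 z3 e1 => z1 z2 z3.
by move=> /at_fiber_inj -> /at_fiber_inj -> /at_fiber_inj ->.
Qed.

(** Exposes the almost-everywhere filter to the filter lemmas. *)
Lemma pm_eqE (E F : mbundle k mu) (Phi Psi : total_space E -> total_space F) :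
  pm_eq Phi Psi ->
  \forall x \ae mu, forall v : E x, Phi (at_fiber v) = Psi (at_fiber v).
Proof. by []. Qed.

Lemma fiberwise_linear_comp (E F H : mbundle k mu) (psi : Omega -> Omega)
    (Psi : total_space F -> total_space H) (Phi : premorphism psi E F) :
  measurable_fun setT psi ->
  (forall A, measurable A -> mu (psi @^-1` A) = mu A) ->
  fiberwise_linear Psi -> fiberwise_linear (Psi \o Phi).
Proof.
move=> mpsi ppsi /(ae_preimage mpsi ppsi) lPsi.
apply: filterS2 lPsi (pm_linear Phi) => x [y [L' [bL' PL']]] [L bL PL].
exists y, (L' \o L); split; first exact: bounded_linear_comp.
by move=> v; rewrite /= PL PL'.
Qed.

Variables (E F : mbundle k mu) (psi psi' : Omega -> Omega).
Hypothesis mpsi : measurable_fun setT psi.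
Hypothesis ppsi : forall A, measurable A -> mu (psi @^-1` A) = mu A.
Hypothesis mpsi' : measurable_fun setT psi'.
Hypothesis ppsi' : forall A, measurable A -> mu (psi' @^-1` A) = mu A.
Hypothesis psiK : \forall x \ae mu, psi (psi' x) = x.
Hypothesis psi'K : \forall x \ae mu, psi' (psi x) = x.
Variable Phi : premorphism psi E F.

Let T := Gamma1_push Phi mpsi' ppsi' psiK.

Lemma ae_fwd (P : Omega -> Prop) :
  (\forall x \ae mu, P (psi x)) -> \forall x \ae mu, P x.
Proof.
move=> /(ae_preimage mpsi' ppsi') h.
by apply: filterS2 h psiK => x + e; rewrite e.
Qed.

Lemma Gamma1_push_linear : linear T.
Proof.
move=> a s t; apply: Gamma1_eq.
have hL := ae_preimage mpsi' ppsi' (pm_linear Phi).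
have hl := ae_preimage mpsi' ppsi' (Gamma1_repr_lin a s t).
have h1 := Gamma1_push_repr mpsi' ppsi' psiK Phi s.
have h2 := Gamma1_push_repr mpsi' ppsi' psiK Phi t.
have h3 := Gamma1_push_repr mpsi' ppsi' psiK Phi (a *: s + t).
apply: filterS3 (filterI hL hl) (filterI h1 (filterI h2 h3))
  (Gamma1_repr_lin a (T s) (T t)).
move=> x [[L [lL _] PL] el] [e1 [e2 e3]] ->.
rewrite !PL in e1 e2 e3; apply: (at_fiber_lin e1 e2 e3).
by rewrite el lL.
Qed.

Lemma Gamma1_push_bound : exists2 C : R, 0 <= C &
  forall s, rnorm (T s) <= C * rnorm s.
Proof.
have [C C0 hC] := pm_bound Phi; exists C => // s.
have ms := msec_norm (Gamma1_repr_msec s).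
have ms' : measurable_fun setT (fun x => rnorm (Gamma1_repr s (psi' x))).
  exact: measurableT_comp ms mpsi'.
rewrite -lee_fin EFinM (rnorm_Gamma1 s).
rewrite -(mp_integral (h := fun x => (rnorm (Gamma1_repr s x))%:E) mpsi' ppsi'); first last.
- by move=> x; rewrite lee_fin rnorm_ge0.
- exact/measurable_EFinP.
rewrite -ge0_integralZl_EFin //; first last.
- exact/measurable_EFinP.
- by move=> x _; rewrite lee_fin rnorm_ge0.
apply: Gamma1_norm_le.
- by apply: measurable_funeM; exact/measurable_EFinP.
- by move=> x; rewrite mule_ge0 // lee_fin rnorm_ge0.
apply: filterS2 (ae_preimage mpsi' ppsi' hC) (Gamma1_push_repr mpsi' ppsi' psiK Phi s).
by move=> x h e; have := h (Gamma1_repr s (psi' x)); rewrite e -EFinM lee_fin.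
Qed.

Lemma Gamma1_push_bounded_linear : bounded_linear T.
Proof.
have [C _ hC] := Gamma1_push_bound; split; last by exists C.
exact: Gamma1_push_linear.
Qed.

Lemma Gamma1_push_act (f : Omega -> K) s : Linf mu f ->
  T (Gamma1_act f s) = Gamma1_act (f \o psi') (T s).
Proof.
move=> Lf; apply: (Gamma1_push_eq mpsi').
have Lf' := Linf_comp mpsi' ppsi' Lf.
have h1 := ae_preimage mpsi ppsi (Gamma1_repr_act (T s) Lf').
have h2 := Gamma1_push_fwd mpsi ppsi mpsi' ppsi' psiK psi'K Phi s.
apply: filterS3 (filterI h1 h2) (filterI psi'K (Gamma1_repr_act s Lf)) (pm_linear Phi).
move=> x [-> e2] [e -> ] [L [lL _] PL]; rewrite /= e.
rewrite PL in e2; have <- := at_fiber_inj e2; rewrite PL; congr at_fiber.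
by rewrite linear_scaleE.
Qed.

End push_operators.

Section V_operator.
Context {R : realType} {k : scalar_kind}.
Context {d : measure_display} {Omega : measurableType d}.
Context {mu : {measure set Omega -> \bar R}}.
Variables (E F : mbundle k mu) (Theta : premorphism id E F).

Lemma V_op_repr (s : Gamma1 E) : \forall x \ae mu,
  Theta (at_fiber (Gamma1_repr s x)) = at_fiber (Gamma1_repr (V_op Theta s) x).
Proof. exact: Gamma1_push_repr. Qed.

Lemma V_op_eq (s : Gamma1 E) (t : Gamma1 F) :
  (\forall x \ae mu, Theta (at_fiber (Gamma1_repr s x)) =
                     at_fiber (Gamma1_repr t x)) -> V_op Theta s = t.
Proof. exact: Gamma1_push_eq. Qed.

End V_operator.

Section functor.
Context {R : realType} (k : scalar_kind).
Context {d : measure_display} {Omega : measurableType d}.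
Context {mu : {measure set Omega -> \bar R}}.
Context {G : groupType} (S : umagmaClosed G) (phi : mp_system mu G).
Hypothesis mu_sf : sigma_finite [set: Omega] mu.
Hypothesis mu_sep : separable_measure mu.
Local Notation K := (scalar_field R k).
Implicit Types E F : dyn_bundle k S phi.

Lemma mp_inv'K g : \forall x \ae mu, phi g^-1%g (phi g x) = x.
Proof.
apply: (filterS2 _ _ (mp_mul phi g^-1%g g) (mp_one phi)) => x.
by rewrite mulVg => -> .
Qed.

Let mphi g := mp_measurable phi g.
Let pphi g := mp_preserving phi g.

Lemma koopman_fwd E g (gS : g \in S) (s : Gamma1 E) : \forall x \ae mu,
  db_map E gS (at_fiber (Gamma1_repr s x)) =
  at_fiber (Gamma1_repr (koopman gS s) (phi g x)).
Proof.
exact: (Gamma1_push_fwd (mphi g) (pphi g) _ _ _ (mp_inv'K g)).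
Qed.

Lemma koopman_eq E g (gS : g \in S) (s t : Gamma1 E) :
  (\forall x \ae mu, db_map E gS (at_fiber (Gamma1_repr s x)) =
                     at_fiber (Gamma1_repr t (phi g x))) ->
  koopman gS s = t.
Proof. exact: Gamma1_push_eq. Qed.

Lemma koopman_dynamical E : is_dynamical phi (Gamma1_module E).
Proof.
split.
- by move=> g gS; exact: Gamma1_push_bounded_linear.
- move=> h1 s; apply: koopman_eq.
  apply: filterS2 (pm_eqE (db_one E h1)) (mp_one phi).
  by move=> x e ->; rewrite e.
- move=> g h gS hS ghS s; apply: koopman_eq.
  have h3 := ae_preimage (mphi h) (pphi h) (koopman_fwd gS (koopman hS s)).
  apply: filterS3 (filterI (pm_eqE (db_mul E gS hS ghS)) (mp_mul phi g h))
    (koopman_fwd hS s) h3.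
  by move=> x [e ->] e' e3; rewrite -e /= e' e3.
- move=> g gS f s Lf.
  exact: (Gamma1_push_act (mphi g) (pphi g) _ _ _ (mp_inv'K g)).
Qed.

Lemma Gamma1_dyn_module E : is_dyn_module phi (Gamma1_module E).
Proof.
split.
- exact: Gamma1_banach.
- exact: Gamma1_L1_normed.
- exact: (Gamma1_separable mu_sf mu_sep (db_separable E)).
- exact: koopman_dynamical.
Qed.

Lemma V_op_dyn_module_hom E F (Theta : dyn_bundle_mor E F) :
  @is_dyn_module_hom R k d Omega mu G S (Gamma1_module E) (Gamma1_module F)
    (V_op Theta).
Proof.
split.
- exact: Gamma1_push_bounded_linear.
- move=> f s Lf; rewrite /= /V_op Gamma1_push_act //.
  by apply: aeW.
- move=> g gS s; apply: V_op_eq.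
  apply: (ae_fwd (mphi g^-1%g) (pphi g^-1%g) (mp_invK phi g)).
  apply: filterS3 (filterI (koopman_fwd gS s) (koopman_fwd gS (V_op Theta s)))
    (pm_eqE (dbm_comm Theta gS)) (V_op_repr Theta s).
  by move=> x [e1 e2] e3 e4; rewrite -e1 -e2 -e4 -[RHS]e3.
Qed.

Local Notation Fm := (Gamma1_mor Gamma1_dyn_module V_op_dyn_module_hom).

Lemma Gamma1_is_functor : is_functor Fm.
Proof.
split.
- move=> E F Theta Xi e s; apply: V_op_eq.
  by apply: filterS2 (pm_eqE e) (V_op_repr Xi s) => x -> ->.
- by move=> E s; apply: V_op_eq; apply: aeW.
- move=> E F H Xi Theta s; apply: V_op_eq.
  apply: filterS2 (V_op_repr Theta s) (V_op_repr Xi (V_op Theta s)).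
  by move=> x /= -> ->.
Qed.

Lemma Gamma1_faithful E F (Theta Xi : dyn_bundle_mor E F) :
  V_op Theta =1 V_op Xi -> pm_eq Theta Xi.
Proof.
move=> e; have [b _ gb] := exists_generating mu_sf (db_separable E).
apply: (pm_eq_of_generating gb); try exact: pm_fiberwise_linear.
move=> n; apply: filterS2 (V_op_repr Theta (b n)) (V_op_repr Xi (b n)) => x -> ->.
by rewrite e.
Qed.

(** A homomorphism satisfies a pointwise bound, so [representation] applies over
    the identity; it is equivariant because both composites with the dynamics act
    in the same way on generators. *)
Lemma Gamma1_full E F
    (h : dyn_module_hom (mu := mu) (Gamma1_module E) (Gamma1_module F)) :
  exists Theta : dyn_bundle_mor E F, V_op Theta =1 h.
Proof.
have [[lh [C hC]] ah oh] := dh_axioms h.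
have [b _ gb] := exists_generating mu_sf (db_separable E).
have hb (s : Gamma1_module E) : \forall x \ae mu,
    rnorm (Gamma1_repr (h s) x) <= `|C| * rnorm (Gamma1_repr s x).
  apply: (equivariant_bound (mu := mu) (psi := id) (psi' := id)
    (Gamma1_banach _) (Gamma1_L1_normed _) (Gamma1_L1_normed _)) => //.
  - by apply: aeW.
  - move=> t; apply: (le_trans (hC t)).
    by rewrite ler_wpM2r ?rnorm_ge0 ?ler_norm.
have [Th hTh] := representation (psi := id) (psi' := id)
  (@measurable_id _ _ setT) (fun _ _ => erefl) (@measurable_id _ _ setT) (fun _ _ => erefl)
  (aeW mu (fun _ => erefl)) (aeW mu (fun _ => erefl)) mu_sf lh (normr_ge0 C) hb gb.
have commT g (gS : g \in S) :
    pm_eq (Th \o db_map E gS) (db_map F gS \o Th).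
  apply: (pm_eq_of_generating gb).
  - apply: fiberwise_linear_comp (pm_fiberwise_linear _); [exact: mphi|exact: pphi].
  - by apply: fiberwise_linear_comp (pm_fiberwise_linear _).
  - move=> n.
    have h1 := ae_preimage (mphi g) (pphi g) (hTh (koopman gS (b n))).
    apply: filterS3 (filterI (koopman_fwd gS (b n)) (koopman_fwd gS (h (b n))))
      (hTh (b n)) h1.
    move=> x [e1 e2] e3 e4; rewrite /= e1 e3 e2 e4.
    by rewrite -[koopman gS (h (b n))](oh g gS).
exists (DynBundleMor commT) => s.
by apply: V_op_eq; exact: hTh.
Qed.

Lemma Gamma1_fully_faithful : fully_faithful Fm.
Proof.
move=> E F; split; first exact: Gamma1_faithful.
by move=> h; have [Th hTh] := Gamma1_full h; exists Th.
Qed.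

End functor.

(** * The bundle of fibers of an abstract module *)

Section measurability.
Context {R : realType} {k : scalar_kind}.
Context {d : measure_display} {Omega : measurableType d}.
Local Notation K := (scalar_field R k).

(** The function is the infimum of the countable family. *)
Lemma measurable_approx_above (f : Omega -> R) (F : nat -> Omega -> R) :
  (forall n, measurable_fun setT (F n)) -> (forall n x, f x <= F n x) ->
  (forall x (e : R), 0 < e -> exists n, F n x < f x + e) ->
  measurable_fun setT f.
Proof.
move=> mF fF Ff.
apply: (measurability _ (RGenInftyO.measurableE R)) => // _ [_ [r ->] <-].
rewrite setTI (_ : _ @^-1` _ = \bigcup_n (F n @^-1` `]-oo, r[%classic)).
  by apply: bigcupT_measurable => n; rewrite -[X in measurable X]setTI; exact: mF.
apply/seteqP; split=> [x /=|x [n _] /=]; rewrite !in_itv /= => h; last first.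
  exact: le_lt_trans (fF n x) h.
have h0 : 0 < r - f x by rewrite subr_gt0.
by have [n hn] := Ff x _ h0; exists n; rewrite //= in_itv /=; lra.
Qed.

Lemma rnorm_sqrt (z : K) : rnorm z = Num.sqrt (re z ^+ 2 + im z ^+ 2).
Proof.
apply: (@emb_inj R k); rewrite rnormE /re /im /emb; case: k z => /= [z|z].
  by rewrite expr0n addr0 sqrtr_sqr.
by rewrite normc_def.
Qed.

Lemma measurable_rnorm_scalar (f : Omega -> K) : kmeasurable f ->
  measurable_fun setT (fun x => rnorm (f x)).
Proof.
move=> [rf jf].
rewrite (_ : (fun x => _) =
  fun x => Num.sqrt ((re (f x)) ^+ 2 + (im (f x)) ^+ 2)); last first.
  by apply/funext => x; rewrite rnorm_sqrt.
apply: (measurableT_comp (f := @Num.sqrt R)).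
  by apply: continuous_measurable_fun; exact: sqrt_continuous.
by apply: measurable_funD; apply: measurable_funX.
Qed.

Variable mu : {measure set Omega -> \bar R}.
Hypothesis mu_complete : measure_is_complete mu.

Lemma measurable_ae_eq (f g : Omega -> R) : measurable_fun setT f ->
  (\forall x \ae mu, f x = g x) -> measurable_fun setT g.
Proof.
move=> /measurable_EFinP mf e; apply/measurable_EFinP.
apply: (ae_measurable_fun mu_complete _ mf).
by apply: filterS e => x /= -> _.
Qed.

(** Setting the functions to zero on a null set gives convergence everywhere;
    completeness of the measure undoes the change in the limit. *)
Lemma measurable_ae_cvg (f : nat -> Omega -> R) (g : Omega -> R) :
  (forall n, measurable_fun setT (f n)) ->
  (\forall x \ae mu, f n x @[n --> \oo] --> g x) -> measurable_fun setT g.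
Proof.
move=> mf [N [mN N0 hN]].
have mI : measurable_fun setT (\1_(~` N) : Omega -> R).
  by apply: measurable_indic; exact: measurableC.
have NC x : \1_(~` N) x = 1 :> R \/ \1_(~` N) x = 0 :> R /\ N x.
  rewrite indicE; have [xN|xN] := pselect (N x); last by left; rewrite mem_set.
  by right; rewrite memNset // => /(_ xN).
apply: (@measurable_ae_eq (fun x => \1_(~` N) x * g x)).
  apply: (measurable_fun_cvg (h := fun n x => \1_(~` N) x * f n x)) => [n|x _].
    exact: measurable_funM.
  have [xN|xN] := pselect (N x).
    rewrite indicE memNset ?mul0r; last by move=> /(_ xN).
    rewrite (_ : (fun n => _) = cst 0); first exact: cvg_cst.
    by apply/funext => n; rewrite mul0r.
  apply: cvgM; first exact: cvg_cst.
  by apply: contrapT => h; apply/xN/hN.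
exists N; split => // x /= h; apply: contrapT => xN; apply: h.
by rewrite indicE mem_set // mul1r.
Qed.

End measurability.

Section reconstruction.
Context {R : realType} {k : scalar_kind}.
Context {d : measure_display} {Omega : measurableType d}.
Context {mu : {measure set Omega -> \bar R}}.
Hypothesis mu_complete : measure_is_complete mu.
Local Notation K := (scalar_field R k).
Local Notation D := (polyOver (@ratK R k)).
Context {G : groupType} {S : umagmaClosed G}.
Variable M : @dyn_module_data R k d Omega G S.
Hypothesis bM : is_banach_module (mu := mu) M.
Hypothesis nM : is_L1_normed (mu := mu) M.
Variable u : nat -> M.
Hypothesis u_dense : dense (range u).

Let rat_scalar n : K := (rat_poly n : {poly K})`_0.

Let rat_scalarP (a : K) : a \in @ratK R k -> exists n, a = rat_scalar n.
Proof.
move=> Da; have : a%:P \is a D by rewrite polyOverC.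
by move=> /rat_polyP[n hn]; exists n; rewrite /rat_scalar -hn coefC.
Qed.

(** The seminorm axioms for rational coefficients are countably many statements,
    each valid almost everywhere. *)
Lemma exists_fiber_seminorm : exists q : Omega -> seminorm {poly K},
  \forall x \ae mu, forall c, c \is a D -> q x c = dm_pnorm (lincomb u c) x.
Proof.
pose rp n : {poly K} := rat_poly n.
have hD : \forall x \ae mu, forall m n,
    dm_pnorm (lincomb u (rp m + rp n)) x <=
    dm_pnorm (lincomb u (rp m)) x + dm_pnorm (lincomb u (rp n)) x.
  apply: ae_foralln => m; apply: ae_foralln => n; rewrite linearD.
  exact: pn_triangle.
have hZ : \forall x \ae mu, forall m n,
    dm_pnorm (lincomb u (rat_scalar m *: rp n)) x =
    rnorm (rat_scalar m) * dm_pnorm (lincomb u (rp n)) x.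
  apply: ae_foralln => m; apply: ae_foralln => n; rewrite linearZ_LR.
  exact: pnorm_scale.
pose P x (q : seminorm {poly K}) := forall c, c \is a D -> q c = dm_pnorm (lincomb u c) x.
have aeP : \forall x \ae mu, exists q, P x q.
  apply: filterS2 hD hZ => x hD hZ.
  apply: (seminorm_extension (q := fun c => dm_pnorm (lincomb u c) x)).
    by move=> c c' /rat_polyP[m ->] /rat_polyP[n ->]; exact: hD.
  by move=> a c /rat_scalarP[m ->] /rat_polyP[n ->]; exact: hZ.
have zD (v w : {poly K}) : (0 : R) <= 0 + 0 by rewrite addr0.
have zZ (a : K) (v : {poly K}) : (0 : R) = rnorm a * 0 by rewrite mulr0.
have hq x : exists q, (exists q', P x q') -> P x q.
  have [[q hq]|n] := pselect (exists q, P x q); first by exists q.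
  by exists (@Seminorm _ _ _ (fun=> 0) zD zZ).
have [q hq'] := choice hq; exists q.
by apply: filterS aeP => x; exact: hq'.
Qed.

Variable q : Omega -> seminorm {poly K}.
Hypothesis qE : \forall x \ae mu, forall c, c \is a D -> q x c = dm_pnorm (lincomb u c) x.

Let Ex x : completeNormedModType K := completion (q x).
Let j x (c : {poly K}) : Ex x := completion_inj (q x) c.

(** A section is measurable when its distances to the rational combinations of
    the coordinate sections are measurable functions.  Since these combinations are
    dense in every fiber, norms of sums and products are countable infima of
    functions of such distances. *)
Definition completion_msec : set (forall x, Ex x) :=
  [set s | forall c, c \is a D -> measurable_fun setT (fun x => rnorm (s x - j x c))].

Let j_norm x c : rnorm (j x c) = q x c.
Proof. exact: completion_inj_norm. Qed.

Let jB x c c' : j x (c - c') = j x c - j x c'.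
Proof. exact: (linearB (completion_inj (q x))). Qed.

Let jD x c c' : j x (c + c') = j x c + j x c'.
Proof. exact: (linearD (completion_inj (q x))). Qed.

Let jZ x a c : j x (a *: c) = a *: j x c.
Proof. exact: (linearZ_LR (completion_inj (q x))). Qed.

Let j_dense x (v : Ex x) (e : R) : 0 < e -> exists n, rnorm (v - j x (rat_poly n)) < e.
Proof.
move=> e0; have e2 : 0 < e / 2 by rewrite divr_gt0.
have [c hc] := completion_inj_approx v e2.
have [c' /rat_polyP[n ->] hc'] := rat_poly_approx (q x) c e2.
exists n; rewrite [e]splitr; apply: (le_lt_trans (rnorm_triang (j x c) _ _)).
by apply: ltrD => //; rewrite -jB j_norm.
Qed.

Let mq c : c \is a D -> measurable_fun setT (fun x => q x c).
Proof.
move=> Dc; apply: (measurable_ae_eq mu_complete (measurable_pnorm nM (lincomb u c))).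
by apply: filterS qE => x ->.
Qed.

Let mj c : c \is a D -> completion_msec (j^~ c).
Proof.
move=> Dc c' Dc'; rewrite (_ : (fun x => _) = fun x => q x (c - c')).
  by apply: mq; rewrite rpredB.
by apply/funext => x; rewrite -jB j_norm.
Qed.

Let completion_msec_norm s : completion_msec s -> measurable_fun setT (fun x => rnorm (s x)).
Proof.
move=> /(_ 0 (rpred0 _)); congr measurable_fun; apply/funext => x.
by rewrite (_ : j x 0 = 0) ?subr0 // -(subrr 0) jB subrr.
Qed.

Let completion_msec0 : completion_msec (fun x => 0).
Proof.
move=> c Dc; rewrite (_ : (fun x => _) = fun x => q x c); first exact: mq.
by apply/funext => x; rewrite sub0r rnormN j_norm.
Qed.

Let completion_msecD s t : completion_msec s -> completion_msec t ->
  completion_msec (fun x => s x + t x).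
Proof.
move=> ms mt c Dc.
pose F n x := rnorm (s x - j x (rat_poly n)) + rnorm (t x - j x (c - rat_poly n)).
have Drp n : (rat_poly n : {poly K}) \is a D by apply/rat_polyP; exists n.
apply: (@measurable_approx_above _ _ _ _ F).
- by move=> n; apply: measurable_funD; [exact: ms|apply: mt; rewrite rpredB].
- move=> n x; apply: le_trans (rnormD _ _).
  by rewrite jB opprB addrACA [_ + (_ - j x c)]addrA addNr add0r.
- move=> x e e0; have e2 : 0 < e / 2 by rewrite divr_gt0.
  have [n hn] := j_dense (s x) e2; exists n.
  have h : rnorm (t x - j x (c - rat_poly n)) <=
      rnorm (s x + t x - j x c) + rnorm (s x - j x (rat_poly n)).
    rewrite (rnorm_distC (s x)); apply: le_trans (rnormD _ _).
    have -> : s x + t x - j x c + (j x (rat_poly n) - s x) =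
        t x - j x (c - rat_poly n); last by [].
    rewrite jB opprB [LHS](AC (3 * 2) (2 * (4 * 3) * (1 * 5))) /=.
    by rewrite subrr addr0.
  rewrite /F; lra.
Qed.

Let completion_msecM (f : Omega -> K) s : kmeasurable f -> completion_msec s ->
  completion_msec (fun x => f x *: s x).
Proof.
move=> mf ms c Dc.
pose a n := rat_scalar n; pose rp n : {poly K} := rat_poly n.
pose F0 m n x := rnorm (f x - a m) * rnorm (s x) +
  rnorm (a m) * rnorm (s x - j x (rp n)) + rnorm (j x (a m *: rp n - c)).
pose F i := if unpickle i is Some mn then F0 mn.1 mn.2 else F0 0%N 0%N.
have Da n : a n \in @ratK R k.
  by have /polyOverP := (rat_polyP (rat_poly n : {poly K})).2 (ex_intro _ n erefl); exact.
have Drp n : rp n \is a D by apply/rat_polyP; exists n.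
have mF0 m n : measurable_fun setT (F0 m n).
  apply: measurable_funD; last first.
    rewrite (_ : (fun x => _) = fun x => q x (a m *: rp n - c)).
      by apply: mq; rewrite rpredB // polyOverZ.
    by apply/funext => x; rewrite j_norm.
  apply: measurable_funD; apply: measurable_funM => //.
  - apply: measurable_rnorm_scalar; apply: kmeasurableB => //.
    exact: kmeasurable_cst.
  - exact: completion_msec_norm.
  - exact: ms.
have F0E m n x : [/\ rnorm (f x *: s x - j x c) <= F0 m n x &
    F0 m n x <= rnorm (f x *: s x - j x c) +
      2 * (rnorm (f x - a m) * rnorm (s x) + rnorm (a m) * rnorm (s x - j x (rp n)))].
  rewrite /F0 -!rnormZ scalerBl scalerBr jB jZ.
  have h1 := rnorm_triang (a m *: s x) (f x *: s x) (j x c).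
  have h2 := rnorm_triang (a m *: j x (rp n)) (a m *: s x) (j x c).
  have h3 := rnorm_triang (a m *: s x) (a m *: j x (rp n)) (j x c).
  have h4 := rnorm_triang (f x *: s x) (a m *: s x) (j x c).
  have h5 := rnorm_distC (a m *: s x) (f x *: s x).
  have h6 := rnorm_distC (a m *: s x) (a m *: j x (rp n)).
  by split; lra.
apply: (@measurable_approx_above _ _ _ _ F) => [i|i x|x e e0].
- by rewrite /F; case: unpickle.
- by rewrite /F; case: unpickle => [[m n]|]; exact: (F0E _ _ _).1.
- have e4 : 0 < e / 4 by rewrite divr_gt0.
  have [a' /rat_scalarP[m ->] hm] := ratK_approxM (f x) e4 (rnorm_ge0 (s x)).
  have am : 0 < rnorm (rat_scalar m) + 1 :> R by rewrite ltr_wpDl ?rnorm_ge0.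
  have [n hn] := j_dense (s x) (divr_gt0 e4 am).
  exists (pickle (m, n)); rewrite /F pickleK /=.
  have := (F0E m n x).2.
  have := mul_lt_of_lt_div e4 (rnorm_ge0 (rat_scalar m)) (rnorm_ge0 _) hn.
  by rewrite [_ * rnorm (rat_scalar m)]mulrC; move: hm; rewrite -/(a m) -/(rp n); lra.
Qed.

Let completion_msecZ (a : K) s : completion_msec s -> completion_msec (fun x => a *: s x).
Proof. by move=> ms; apply: completion_msecM => //; exact: kmeasurable_cst. Qed.

Let completion_msec_lim (w : nat -> forall x, Ex x) s : (forall n, completion_msec (w n)) ->
  (\forall x \ae mu, w n x @[n --> \oo] --> s x) -> completion_msec s.
Proof.
move=> mw ws c Dc.
apply: (measurable_ae_cvg mu_complete (f := fun n x => rnorm (w n x - j x c))).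
  by move=> n; exact: mw.
apply: filterS ws => x /cvg_rnorm0 h.
have h1 : rnorm (s x - j x c) - rnorm (w n x - s x) @[n --> \oo] --> rnorm (s x - j x c).
  by rewrite -[X in _ --> X]subr0; apply: cvgB => //; exact: cvg_cst.
have h2 : rnorm (s x - j x c) + rnorm (w n x - s x) @[n --> \oo] --> rnorm (s x - j x c).
  by rewrite -[X in _ --> X]addr0; apply: cvgD => //; exact: cvg_cst.
apply: squeeze_cvgr h1 h2; apply: nearW => n; rewrite -ler_distl.
apply: (le_trans (ler_rnormB _ _)).
by rewrite [_ - _ - _](_ : _ = w n x - s x) // opprB addrA subrK.
Qed.

Let completion_bundle : mbundle k mu :=
  @MBundle R k d Omega mu Ex completion_msec completion_msec0 completion_msecD
    completion_msecZ completion_msecM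
    completion_msec_norm completion_msec_lim.

(** The sections [sec c] are the coordinate sections: at almost every point [sec c]
    has the norm of the combination of the dense sequence with coefficients [c]. *)
Lemma fiber_bundle : exists (E : mbundle k mu) (sec : {poly K} -> section E),
  [/\ forall c, c \is a D -> msec (sec c),
      forall x, linear (fun c => sec c x),
      forall x (v : E x) (e : R), 0 < e -> exists n, rnorm (v - sec (rat_poly n) x) < e &
      \forall x \ae mu, forall c, c \is a D -> rnorm (sec c x) = dm_pnorm (lincomb u c) x].
Proof.
exists completion_bundle, (fun c => j^~ c); split.
- exact: mj.
- by move=> x a c c'; rewrite jD jZ.
- by move=> x v e; exact: j_dense.
- by apply: filterS qE => x h c Dc; rewrite j_norm h.
Qed.

End reconstruction.

(** * Realizing an abstract module by sections *)

Section realization.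
Context {R : realType} {k : scalar_kind}.
Context {d : measure_display} {Omega : measurableType d}.
Context {mu : {measure set Omega -> \bar R}}.
Hypothesis mu_complete : measure_is_complete mu.
Hypothesis mu_sf : sigma_finite [set: Omega] mu.
Local Notation K := (scalar_field R k).
Local Notation D := (polyOver (@ratK R k)).
Context {G : groupType} {S : umagmaClosed G}.
Variable M : @dyn_module_data R k d Omega G S.
Hypothesis bM : is_banach_module (mu := mu) M.
Hypothesis nM : is_L1_normed (mu := mu) M.
Variable u : nat -> M.
Hypothesis u_dense : dense (range u).

Let u_poly_dense (s : M) (e : R) : 0 < e ->
  exists2 c, c \is a D & rnorm (s - lincomb u c) < e.
Proof.
move=> e0; have [_ [n _ <-] hn] := (dense_rnormP _).1 u_dense s e e0.
by exists 'X^n; rewrite ?polyOverXn // lincombX.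
Qed.

Variables (E : mbundle k mu) (sec : {poly K} -> section E).
Hypothesis sec_msec : forall c, c \is a D -> msec (sec c).
Hypothesis sec_linear : forall x, linear (fun c => sec c x).
Hypothesis sec_dense : forall x (v : E x) (e : R), 0 < e ->
  exists n, rnorm (v - sec (rat_poly n) x) < e.
Hypothesis sec_norm : \forall x \ae mu, forall c, c \is a D ->
  rnorm (sec c x) = dm_pnorm (lincomb u c) x.

Let sec_ev x c : sec c x = lincomb (fun n => sec 'X^n x) c.
Proof.
by have := linear_lincomb (sec_linear x) (fun n => 'X^n) c; rewrite lincomb_id.
Qed.

Lemma realization_separable_bundle : separable_bundle E.
Proof.
exists (fun n => sec 'X^n) => [n|]; first by apply: sec_msec; rewrite polyOverXn.
apply: aeW => x; rewrite lin_lincomb; apply/dense_rnormP => v e e0.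
have [n hn] := sec_dense v e0; exists (sec (rat_poly n) x) => //.
by exists (rat_poly n); rewrite // sec_ev.
Qed.

Let exists_gen n : exists t : Gamma1 E, \forall x \ae mu, Gamma1_repr t x = sec 'X^n x.
Proof.
have Dn : 'X^n \is a D by rewrite polyOverXn.
apply/Gamma1_exists/(ae_integrable_section (sec_msec Dn) (pn_integrable nM (u n))).
by apply: filterS sec_norm => x h; rewrite h // lincombX.
Qed.

Let v n := sval (cid (exists_gen n)).

Let v_sec c : \forall x \ae mu, Gamma1_repr (lincomb v c) x = sec c x.
Proof.
have h n : \forall x \ae mu, Gamma1_repr (v n) x = sec 'X^n x.
  exact: (svalP (cid (exists_gen n))).
apply: filterS2 (Gamma1_repr_lincomb v c) (ae_foralln h) => x -> hx.
by rewrite [RHS]sec_ev; congr (lincomb _ c); apply/funext => n; exact: hx.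
Qed.

Lemma realization_generating : generating v.
Proof.
have h n := v_sec (rat_poly n).
apply: filterS2 (ae_foralln h) (ae_foralln (fun n => Gamma1_repr_lincomb v (rat_poly n))).
move=> x hx hx' w e e0; have [n hn] := sec_dense w e0.
exists (rat_poly n); first by apply/rat_polyP; exists n.
by rewrite -hx' hx.
Qed.

Let v_pnorm c : c \is a D -> \forall x \ae mu,
  rnorm (Gamma1_repr (lincomb v c) x) = dm_pnorm (lincomb u c) x.
Proof. by move=> Dc; apply: filterS2 (v_sec c) sec_norm => x -> ->. Qed.

Let v_norm c : c \is a D -> rnorm (lincomb v c) = rnorm (lincomb u c).
Proof. by move=> Dc; apply: (pnorm_preserving_norm nM); exact: v_pnorm. Qed.

(* The extension preserves pointwise norms because they are 1-Lipschitz from the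
   module to integrable functions and agree on rational combinations. *)
Let realization_map : exists J : M -> Gamma1 E, [/\ linear J,
  forall s, \forall x \ae mu, rnorm (Gamma1_repr (J s) x) = dm_pnorm s x &
  forall c, c \is a D -> J (lincomb u c) = lincomb v c].
Proof.
have [||||J [lJ JC Jev]] := @bounded_extension R k M (Gamma1 E) u v 1.
- exact: Gamma1_complete.
- by [].
- exact: u_poly_dense.
- by move=> c Dc; rewrite mul1r v_norm.
exists J; split => // s.
pose f x := rnorm (Gamma1_repr (J s) x) - dm_pnorm s x.
have mf : measurable_fun setT f.
  apply: measurable_funB; first exact: msec_norm (Gamma1_repr_msec _).
  exact: measurable_pnorm nM s.
have mfE : measurable_fun setT (EFin \o f) by exact/measurable_EFinP.
suff h : (\int[mu]_x `|(f x)%:E| = 0)%E.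
  move/(ae_eq_integral_abs mu measurableT mfE): h; apply: filterS => x /(_ I) [].
  by move/eqP; rewrite subr_eq0 => /eqP.
apply/eqP; rewrite eq_le integral_ge0 ?andbT //; apply/lee_addgt0Pr => e e0.
rewrite add0e; have e2 : 0 < e / 2 by rewrite divr_gt0.
have [c Dc hc] := u_poly_dense s e2.
have hJ : rnorm (J s - lincomb v c) < e / 2.
  by rewrite -Jev // -linear_subE //; apply: le_lt_trans (JC _) _; rewrite mul1r.
apply: (@le_trans _ _ (\int[mu]_x ((rnorm (Gamma1_repr (J s - lincomb v c) x))%:E +
    (`|dm_pnorm (s - lincomb u c) x|)%:E))%E).
  apply: ae_ge0_le_integral => //.
  - by apply: measurableT_comp.
  - by move=> x _; rewrite adde_ge0 // lee_fin rnorm_ge0.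
  - apply: emeasurable_funD.
      exact: (measurable_rnorm (Gamma1_repr_msec _)).
    apply/measurable_EFinP; apply: measurableT_comp => //.
    exact: (measurable_pnorm nM).
  apply: filterS3 (filterI (v_pnorm Dc) (Gamma1_repr_sub (J s) (lincomb v c)))
    (pnorm_dist bM nM s (lincomb u c)) (pn_ge0 nM (s - lincomb u c)).
  move=> x [h1 ->] h2 h3 _; rewrite abse_EFin -EFinD lee_fin /f (ger0_norm h3).
  apply: (@le_trans _ _ (`|rnorm (Gamma1_repr (J s) x) - rnorm (Gamma1_repr (lincomb v c) x)|
      + `|dm_pnorm (lincomb u c) x - dm_pnorm s x|)).
    by apply: le_trans (ler_normD _ _); rewrite h1 addrA subrK.
  by apply: lerD; [exact: ler_rnormB|rewrite distrC].
rewrite ge0_integralD //; first last.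
- apply/measurable_EFinP; apply: measurableT_comp => //; exact: (measurable_pnorm nM).
- exact: (measurable_rnorm (Gamma1_repr_msec _)).
- by move=> x _; rewrite lee_fin rnorm_ge0.
rewrite -rnorm_Gamma1.
have -> : (\int[mu]_x (`|dm_pnorm (s - lincomb u c) x|)%:E = (rnorm (s - lincomb u c))%:E)%E.
  rewrite -(pn_norm nM); apply: ae_eq_integral => //.
  - apply/measurable_EFinP; apply: measurableT_comp => //; exact: (measurable_pnorm nM).
  - exact/measurable_EFinP/(measurable_pnorm nM).
  - by apply: filterS (pn_ge0 nM (s - lincomb u c)) => x h _; rewrite ger0_norm.
by rewrite -EFinD lee_fin [e in leRHS]splitr lerD // ltW.
Qed.

(** The range contains the rational combinations of the generators and is stable
    under gluing, so it is dense; being isometric, the map has closed range. *)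
Lemma realization_iso : exists (J : M -> Gamma1 E) (J' : Gamma1 E -> M),
  [/\ linear J, (forall s, \forall x \ae mu,
        rnorm (Gamma1_repr (J s) x) = dm_pnorm s x),
      cancel J J' & cancel J' J].
Proof.
have [J [lJ Jp Jev]] := realization_map.
have Jnorm s : rnorm (J s) = rnorm s by exact: (pnorm_preserving_norm nM (Jp s)).
have Ja (f : Omega -> K) s : Linf mu f -> J (dm_act f s) = Gamma1_act f (J s).
  exact: (pnorm_preserving_act bM nM lJ Jp).
have J0 : J 0 = 0 := linear_0E lJ.
have JD s t : J (s + t) = J s + J t.
  by have := lJ 1 s t; rewrite !scale1r.
have surj t : exists s, J s = t.

  have dJ r : 0 < r -> exists2 z, range J z & rnorm (t - z) < r.
    apply: (glue_dense (generating_dense realization_generating)).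
    - by exists 0.
    - move=> n; exists (lincomb u (rat_poly n)) => //.
      by apply: Jev; apply/rat_polyP; exists n.
    - move=> A _ _ mA [s _ <-] [s' _ <-].
      exists (dm_act (kindic A) s + dm_act (kindic (~` A)) s') => //.
      by rewrite JD !Ja //; apply: Linf_kindic => //; exact: measurableC.
  have hs n : exists s, rnorm (t - J s) < half_pow n.
    by have [_ [s _ <-] hs] := dJ _ (half_pow_gt0 n); exists s.
  have [s hs'] := choice hs.
  have Js : J (s n) @[n --> \oo] --> t.
    apply/cvg_rnorm0; apply: squeeze_cvgr (cvg_cst 0) half_pow_cvg0.
    by apply: nearW => n; rewrite rnorm_ge0 rnorm_distC ltW.
  have [l sl] : exists l : M, s n @[n --> \oo] --> l.
    apply: (cauchy_seq_cvg (bm_complete bM)) => e e0.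
    have e2 : 0 < e / 2 by rewrite divr_gt0.
    have [N hN] := half_pow_lt e2; exists N => n Nn.
    rewrite -Jnorm linear_subE // [e]splitr.
    apply: (le_lt_trans (rnorm_triang t _ _)); apply: ltrD.
      by rewrite rnorm_distC; apply: lt_trans hN.
    by apply: lt_trans (hs' n) _; apply: le_lt_trans hN; exact: half_pow_le.
  exists l; apply: (cvg_unique _ _ Js) => //.
  apply/cvg_rnorm0; move/cvg_rnorm0: sl => sl.
  rewrite (_ : (fun n => _) = fun n => rnorm (s n - l)) //.
  by apply/funext => n; rewrite -linear_subE // Jnorm.
have [J' J'K] := choice surj.
exists J, J'; split => // s; apply/eqP; rewrite -subr_eq0 -rnorm_eq0 -Jnorm.
by rewrite linear_subE // J'K subrr rnorm0.
Qed.

End realization.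

(** * Essential surjectivity *)

Section essential_surjectivity.
Context {R : realType} (k : scalar_kind).
Context {d : measure_display} {Omega : measurableType d}.
Context {mu : {measure set Omega -> \bar R}}.
Context {G : groupType} (S : umagmaClosed G) (phi : mp_system mu G).
Hypothesis mu_sf : sigma_finite [set: Omega] mu.
Hypothesis mu_complete : measure_is_complete mu.
Hypothesis mu_sep : separable_measure mu.
Local Notation K := (scalar_field R k).

Section transport.
Variable M : @dyn_module_data R k d Omega G S.
Hypothesis aM : is_dyn_module phi M.
Variables (E : mbundle k mu) (J : M -> Gamma1 E) (J' : Gamma1 E -> M).
Hypothesis sE : separable_bundle E.
Hypothesis lJ : linear J.
Hypothesis Jp : forall s, \forall x \ae mu,
  rnorm (Gamma1_repr (J s) x) = dm_pnorm s x.
Hypothesis JK : cancel J J'.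
Hypothesis J'K : cancel J' J.

Let bM := dm_banach_module aM.
Let nM := dm_L1_normed aM.
Let GE := @Gamma1_data R k d Omega mu G S E (fun _ _ => id).

Let lJ' : linear J'.
Proof. by move=> a s t; apply: (can_inj JK); rewrite lJ !J'K. Qed.

Let Jnorm s : rnorm (J s) = rnorm s.
Proof. exact: (pnorm_preserving_norm nM (Jp s)). Qed.

Let J'norm t : rnorm (J' t) = rnorm t.
Proof. by rewrite -Jnorm J'K. Qed.

Let Ja (f : Omega -> K) s : Linf mu f -> J (dm_act f s) = Gamma1_act f (J s).
Proof. exact: (pnorm_preserving_act bM nM lJ Jp). Qed.

Let J'a (f : Omega -> K) t : Linf mu f -> J' (Gamma1_act f t) = dm_act f (J' t).
Proof. by move=> Lf; apply: (can_inj JK); rewrite Ja // !J'K. Qed.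

Let T g (gS : g \in S) (t : Gamma1 E) : Gamma1 E := J (dm_op gS (J' t)).

Let T_map g (gS : g \in S) : exists Phi : premorphism (phi g) E E,
  forall t, \forall x \ae mu, Phi (at_fiber (Gamma1_repr t x)) =
                              at_fiber (Gamma1_repr (T gS t) (phi g x)).
Proof.
have [b _ gb] := exists_generating mu_sf sE.
have [lo [C hC]] := do_bounded (dm_dynamical aM) gS.
have lT : linear (T gS) by move=> a s t; rewrite /T lJ' lo lJ.
have TC (s : GE) : \forall x \ae mu, rnorm (Gamma1_repr (T gS s) x) <=
    `|C| * rnorm (Gamma1_repr s (phi g^-1%g x)).
  apply: (equivariant_bound (M := GE) (N := GE) (Gamma1_banach _)
    (Gamma1_L1_normed _) (Gamma1_L1_normed _) (mp_measurable phi g)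
    (mp_measurable phi g^-1%g) (mp_preserving phi g^-1%g) (mp_invK phi g)
    (normr_ge0 C)) => [t|f t Lf].
    rewrite /T Jnorm; apply: (le_trans (hC _)).
    by rewrite J'norm ler_wpM2r ?rnorm_ge0 ?ler_norm.
  rewrite /T /= J'a // (do_act (dm_dynamical aM)) // Ja //.
  by apply: Linf_comp => //; [exact: mp_measurable|exact: mp_preserving].
exact: (representation (mp_measurable phi g) (mp_preserving phi g)
  (mp_measurable phi g^-1%g) (mp_preserving phi g^-1%g) (mp_invK phi g)
  (mp_inv'K phi g) mu_sf lT (normr_ge0 C) TC gb).
Qed.

Let Phi g (gS : g \in S) : premorphism (phi g) E E := sval (cid (T_map gS)).

Let PhiE g (gS : g \in S) t : \forall x \ae mu,
  Phi gS (at_fiber (Gamma1_repr t x)) = at_fiber (Gamma1_repr (T gS t) (phi g x)).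
Proof. exact: (svalP (cid (T_map gS))). Qed.

Let Phi_one (h1 : 1%g \in S) : pm_eq (Phi h1) id.
Proof.
have [b _ gb] := exists_generating mu_sf sE.
apply: (pm_eq_of_generating gb); first exact: pm_fiberwise_linear.
  by apply: aeW => x; exists x, id; split=> //; exact: bounded_linear_id.
move=> n; apply: filterS2 (PhiE h1 (b n)) (mp_one phi) => x -> ->.
by rewrite /T (do_one (dm_dynamical aM)) J'K.
Qed.

Let Phi_mul g h (gS : g \in S) (hS : h \in S) (ghS : (g * h)%g \in S) :
  pm_eq (Phi gS \o Phi hS) (Phi ghS).
Proof.
have [b _ gb] := exists_generating mu_sf sE.
have mh := mp_measurable phi h; have ph := mp_preserving phi h.
apply: (pm_eq_of_generating gb).
- exact: fiberwise_linear_comp (pm_fiberwise_linear _).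
- exact: pm_fiberwise_linear.
move=> n; have h3 := ae_preimage mh ph (PhiE gS (T hS (b n))).
apply: filterS3 (filterI (PhiE hS (b n)) (mp_mul phi g h)) (PhiE ghS (b n)) h3.
move=> x [e1 e2] -> e3; rewrite /= e1 e3 e2.
by rewrite /T JK (do_mul (dm_dynamical aM) gS hS ghS).
Qed.

Let X : dyn_bundle k S phi := DynBundle Phi_one Phi_mul sE.

Let koopmanE g (gS : g \in S) (t : Gamma1 E) : koopman (E := X) gS t = T gS t.
Proof. by apply: koopman_eq; exact: PhiE. Qed.

(** The operators conjugated by the isomorphism are equivariant and bounded, so
    they come from premorphisms; the cocycle law holds because it holds for the
    operators. *)
Lemma transported_bundle : exists (X : dyn_bundle k S phi)
    (f : dyn_module_hom (mu := mu) (Gamma1_module X) M)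
    (g : dyn_module_hom (mu := mu) M (Gamma1_module X)),
  cancel f g /\ cancel g f.
Proof.
have hJ' : @is_dyn_module_hom R k d Omega mu G S (Gamma1_module X) M J'.
  split.
  - by split; [exact: lJ'|exists 1 => t; rewrite mul1r J'norm].
  - by move=> f t; exact: J'a.
  - by move=> g gS t; rewrite /= koopmanE /T JK.
have hJ : @is_dyn_module_hom R k d Omega mu G S M (Gamma1_module X) J.
  split.
  - by split; [exact: lJ|exists 1 => t; rewrite mul1r Jnorm].
  - by move=> f t; exact: Ja.
  - by move=> g gS t; rewrite /= koopmanE /T JK.
by exists X, (DynModuleHom hJ'), (DynModuleHom hJ).
Qed.

End transport.

Lemma Gamma1_essentially_surjective
    (wd : forall E : dyn_bundle k S phi, is_dyn_module phi (Gamma1_module E)) :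
  essentially_surjective (Gamma1_obj wd).
Proof.
move=> Y; have aY := dm_axioms Y.
have bY := dm_banach_module aY; have nY := dm_L1_normed aY.
have [u u_dense] := dm_separable aY.
have [q qE] := exists_fiber_seminorm bY nY u.
have [E [sec [ms ls ds ns]]] := fiber_bundle mu_complete nY qE.
have sE := realization_separable_bundle ms ls ds.
have [J [J' [lJ Jp JK J'K]]] := realization_iso bY nY u_dense ms ls ds ns.
have [X [f [g [fg gf]]]] := transported_bundle aY sE lJ Jp JK J'K.
by exists X, f, g; split=> s; [exact: fg|exact: gf].
Qed.

End essential_surjectivity.


Theorem theorem5p12 (R : realType) (k : scalar_kind)
    (d : measure_display) (Omega : measurableType d)
    (mu : {measure set Omega -> \bar R})
    (mu_sigma_finite : sigma_finite [set: Omega] mu)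
    (mu_complete : measure_is_complete mu)
    (mu_separable : separable_measure mu)
    (G : groupType) (S : umagmaClosed G) (phi : mp_system mu G) :
  exists (wd : forall E : dyn_bundle k S phi,
                 is_dyn_module phi (Gamma1_module E))
         (wdV : forall (E F : dyn_bundle k S phi) (Theta : dyn_bundle_mor E F),
                  @is_dyn_module_hom R k d Omega mu G S
                    (Gamma1_module E) (Gamma1_module F) (V_op Theta)),
    [/\ is_functor (Gamma1_mor wd wdV),
        essentially_surjective (Gamma1_obj wd) &
        fully_faithful (Gamma1_mor wd wdV)].
Proof.
exists (Gamma1_dyn_module mu_sigma_finite mu_separable).
exists (fun E F Theta => V_op_dyn_module_hom Theta).
split.
- exact: Gamma1_is_functor.
- exact: Gamma1_essentially_surjective.
- exact: Gamma1_fully_faithful.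
Qed.
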